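(* Let $f=(f_1,f_2):\mathbb{R}^2\to\mathbb{R}^2_1$ be a smooth function such that $M=\operatorname{graph} f=\{(x,f(x)):x\in\mathbb{R}^2\}$ is a spacelike stationary graph in $\mathbb{R}^4_1$ whose curvature integral converges absolutely, i.e. $\int_M|K|\,dM<+\infty$. Then either $f$ is affine linear, or $f=h\,\mathbf{y}_0+\mathbf{y}_1$ with $h$ a nonlinear (i.e. not affine linear) harmonic function on $\mathbb{R}^2$, $\mathbf{y}_0$ a nonzero lightlike vector in $\mathbb{R}^2_1$ and $\mathbf{y}_1\in\mathbb{R}^2_1$ a constant vector. In both cases $M$ is flat, i.e. $K\equiv 0$.
   Context: $\mathbb{R}^m_1$ denotes $\mathbb{R}^m$ with the Minkowski inner product $\langle \mathbf{u},\mathbf{v}\rangle=u_1v_1+\cdots+u_{m-1}v_{m-1}-u_mv_m$; a vector $\mathbf{y}$ is lightlike if $\langle\mathbf{y},\mathbf{y}\rangle=0$. Identify $\mathbb{R}^{2+m}_1=\mathbb{R}^2\oplus\mathbb{R}^m_1$, where $\mathbb{R}^2$ carries the Euclidean inner product. (Here $m=2$.) For smooth $f:\mathbb{R}^2\to\mathbb{R}^m_1$, put $p=\partial f/\partial x_1$, $q=\partial f/\partial x_2$. The induced metric on $M=\operatorname{graph} f\subset\mathbb{R}^{2+m}_1$ in the global coordinates $(x_1,x_2)$ is $g=g_{ij}dx_idx_j$ with $g_{11}=1+\langle p,p\rangle$, $g_{22}=1+\langle q,q\rangle$, $g_{12}=g_{21}=\langle p,q\rangle$. $M$ is spacelike if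 $(g_{ij})$ is positive definite at every point. A spacelike surface is stationary if its mean curvature vector field vanishes identically; equivalently, all coordinate functions of $\mathbb{R}^{2+m}_1$ restricted to $M$ are harmonic for the Laplace–Beltrami operator of $g$. $K$ is the Gaussian curvature of the Riemannian metric $g$ on $M$ and $dM=\det(g_{ij})^{1/2}\,dx_1\wedge dx_2$ is its area element. ''Harmonic function on $\mathbb{R}^2$'' refers to the standard Euclidean Laplacian in $(x_1,x_2)$. *)

(* Defs.v *)
From HB Require Import structures.
From mathcomp Require Import all_boot all_order all_algebra.
From mathcomp Require Import all_classical all_reals all_analysis.
Import numFieldNormedType.Exports.
Set Implicit Arguments.
Unset Strict Implicit.
Unset Printing Implicit Defensive.
Import Order.TTheory GRing.Theory Num.Theory.
Local Open Scope classical_set_scope.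
Local Open Scope ring_scope.

(* The plane R^2 is (R * R)%type, which carries both a normed module structure
   and the product sigma-algebra; its coordinates x_1, x_2 are indexed by 'I_2,
   that is by 0 and 1. *)

Section Plane.
Variable R : realType.

Definition axis (i : 'I_2) : R * R := if i == 0 then (1, 0) else (0, 1).

Definition pderiv (V : normedModType R) (i : 'I_2) (F : R * R -> V)
  : R * R -> V := fun x => 'D_(axis i) F x.

(* F is of class C^n: its iterated partial derivatives of order at most n exist
   and are continuous. *)
Fixpoint Cn (V : normedModType R) (n : nat) (F : R * R -> V) : Prop :=
  continuous F /\
  if n is k.+1 then
    forall i : 'I_2, (forall x, derivable F x (axis i)) /\ Cn k (pderiv i F)
  else True.

Definition smooth (V : normedModType R) (F : R * R -> V) : Prop :=
  forall n, Cn n F.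

Definition affine_linear (V : lmodType R) (F : R * R -> V) : Prop :=
  exists (L : {linear (R * R)%type -> V}) (c : V), forall x, F x = L x + c.

Definition harmonic_function (h : R * R -> R) : Prop :=
  Cn 2 h /\ forall x, \sum_(i < 2) pderiv i (pderiv i h) x = 0.

End Plane.

Section Minkowski.
Variables (R : realType) (m : nat).

Definition mink (u v : 'rV[R]_m) : R :=
  \sum_(i < m) (if i.+1 == m then - (u 0 i * v 0 i) else u 0 i * v 0 i).

Definition lightlike (y : 'rV[R]_m) : Prop := mink y y = 0.

End Minkowski.

(* Riemannian geometry of the plane in the global coordinates (x_1, x_2), for a
   metric given by its Gram matrix G. *)
Section Intrinsic.
Variables (R : realType) (G : R * R -> 'M[R]_2).

(* christoffel k i j is Gamma^k_{ij}. *)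
Definition christoffel (k i j : 'I_2) (x : R * R) : R :=
  2^-1 * \sum_(l < 2) invmx (G x) k l *
    (pderiv i (fun y => G y j l) x + pderiv j (fun y => G y i l) x
     - pderiv l (fun y => G y i j) x).

(* riemann l i j k is the coefficient of d_l in
   R(d_i, d_j) d_k = nabla_i nabla_j d_k - nabla_j nabla_i d_k. *)
Definition riemann (l i j k : 'I_2) (x : R * R) : R :=
  pderiv i (christoffel l j k) x - pderiv j (christoffel l i k) x
  + \sum_(n < 2) (christoffel n j k x * christoffel l i n x
                  - christoffel n i k x * christoffel l j n x).

(* <R(d_1, d_2) d_2, d_1> / det G; it equals 1 on the unit sphere. *)
Definition gauss_curvature (x : R * R) : R :=
  (\sum_(l < 2) G x 0 l * riemann l 0 1 1 x) / \det (G x).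

Definition area_density (x : R * R) : R := Num.sqrt (\det (G x)).

Definition positive_definite : Prop :=
  forall x (u : 'rV[R]_2), u != 0 ->
    0 < \sum_(i < 2) \sum_(j < 2) G x i j * u 0 i * u 0 j.

(* The integral over the surface of |K| dM. *)
Definition total_abs_curvature : \bar R :=
  (\int[lebesgue_measure \x lebesgue_measure]_(x in setT)
     (`|gauss_curvature x| * area_density x)%:E)%E.

End Intrinsic.

Section Graph.
Variables (R : realType) (m : nat) (f : R * R -> 'rV[R]_m).

(* As the timelike coordinate of both R^m_1 and R^(2+m)_1 is the last one, mink
   on 'rV_(2 + m) is the orthogonal sum of the Euclidean product and mink on
   'rV_m. *)
Definition graph_pt (x : R * R) : 'rV[R]_(2 + m) :=
  row_mx (\row_(i < 2) if i == 0 then x.1 else x.2) (f x).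

Definition graph_metric (x : R * R) : 'M[R]_2 :=
  \matrix_(i, j) ((i == j)%:R + mink (pderiv i f x) (pderiv j f x)).

Definition spacelike : Prop := positive_definite graph_metric.

(* Component of v orthogonal to the tangent plane at graph_pt x. *)
Definition normal_part (x : R * R) (v : 'rV[R]_(2 + m)) : 'rV[R]_(2 + m) :=
  v - \sum_(k < 2) \sum_(l < 2)
        (invmx (graph_metric x) k l * mink v (pderiv l graph_pt x))
          *: pderiv k graph_pt x.

(* Half the trace of the second fundamental form. *)
Definition mean_curvature (x : R * R) : 'rV[R]_(2 + m) :=
  2^-1 *: \sum_(i < 2) \sum_(j < 2) invmx (graph_metric x) i j
            *: normal_part x (pderiv i (pderiv j graph_pt) x).

Definition stationary : Prop := forall x, mean_curvature x = 0.

End Graph.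

Section GraphMetric.
Variables (R : realType) (m : nat) (f : R * R -> 'rV[R]_m).

Lemma mink_row_mx (u v : 'rV[R]_2) (u' v' : 'rV[R]_m) : (0 < m)%N ->
  mink (row_mx u u') (row_mx v v') = \sum_(i < 2) u 0 i * v 0 i + mink u' v'.
Proof.
move=> m_gt0; rewrite /mink big_split_ord /=; congr (_ + _).
  apply: eq_bigr => i _; rewrite !row_mxEl ifF //; apply/negbTE.
  rewrite neq_ltn; apply/orP; left.
  by apply: leq_ltn_trans (ltn_ord i) _; rewrite -[X in (X < _)%N]addn0 ltn_add2l.
by apply: eq_bigr => i _; rewrite !row_mxEr -addnS eqn_add2l.
Qed.

Lemma is_derive_coord (i j : 'I_2) (x : R * R) :
  is_derive x (axis R i) (fun y : R * R => if j == 0 then y.1 else y.2)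
    ((i == j)%:R : R).
Proof.
set l := fun y => _.
have la : (i == j)%:R = l (axis R i).
  by rewrite /l /axis; case: i j @l => [[|[|//]] ?] [[|[|//]] ?].
have C : (h^-1 *: ((l \o shift x) (h *: axis R i) - l x)) @[h --> 0^']
           --> ((i == j)%:R : R).
  have E : \forall h \near 0^',
      ((i == j)%:R : R) = h^-1 *: ((l \o shift x) (h *: axis R i) - l x).
    near=> h; have h0 : h != 0 by near: h; exact: nbhs_dnbhs_neq.
    rewrite la.
    have -> : (l \o shift x) (h *: axis R i) = h * l (axis R i) + l x.
      by rewrite /l /=; case: (j == 0).
    by rewrite addrK /GRing.scale /= mulKf.
  by apply: cvg_trans (near_eq_cvg E) (cvg_cst _).
split; first by apply/cvg_ex; eexists; exact: C.
exact: cvg_lim C.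
Unshelve. all: by end_near. Qed.

Lemma pderiv_graph_pt (i : 'I_2) x : derivable f x (axis R i) ->
  pderiv i (graph_pt f) x = row_mx (\row_j (i == j)%:R) (pderiv i f x).
Proof.
move=> df.
have E a : (fun y => graph_pt f y 0 a) = match fintype.split a with
    | inl j => fun y : R * R => if j == 0 then y.1 else y.2
    | inr j => fun y => f y 0 j end.
  apply/funext => y; rewrite /graph_pt mxE; case: fintype.split => // j.
  by rewrite mxE.
have D : derivable (graph_pt f) x (axis R i).
  apply/derivable_mxP => r a; rewrite ord1 E; case: fintype.split => j.
    exact: (@ex_derive _ _ _ _ _ _ _ (is_derive_coord i j x)).
  by move/derivable_mxP: df.
rewrite /pderiv derive_mx //; apply/rowP => a; rewrite mxE E [RHS]mxE.
case: fintype.split => j.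
  by rewrite mxE; exact: (@derive_val _ _ _ _ _ _ _ (is_derive_coord i j x)).
by rewrite derive_mx // mxE.
Qed.

(* graph_metric is the metric induced by the ambient product on the graph. *)
Lemma graph_metricE (x : R * R) (i j : 'I_2) : (0 < m)%N ->
  (forall k, derivable f x (axis R k)) ->
  graph_metric f x i j = mink (pderiv i (graph_pt f) x) (pderiv j (graph_pt f) x).
Proof.
move=> m_gt0 df; rewrite !pderiv_graph_pt // mink_row_mx // mxE; congr (_ + _).
rewrite (bigD1 i) //= !mxE eqxx mul1r big1 ?addr0 1?eq_sym // => k ki.
by rewrite !mxE eq_sym (negbTE ki) mul0r.
Qed.

End GraphMetric.

(* Main.v *)
Require Import Defs.
From HB Require Import structures.
From mathcomp Require Import all_boot all_order all_algebra.
From mathcomp Require Import all_classical all_reals all_analysis.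
From mathcomp Require Import measurable_realfun.
From mathcomp Require Import ring lra.
Import numFieldNormedType.Exports.
Import Order.TTheory GRing.Theory Num.Theory.
Local Open Scope classical_set_scope.
Local Open Scope ring_scope.
Set Implicit Arguments.
Unset Strict Implicit.
Unset Printing Implicit Defensive.

(* In the null coordinates s = f_0 - f_1, t = f_0 + f_1 the metric is
   g_ij = delta_ij + (s_i t_j + t_i s_j) / 2 and stationarity says that s and t are
   harmonic for g. Then the matrix (A B; B C) = g / sqrt(det g) of determinant 1 has
   curl-free rows, so that it is a Hessian and Jorgens' theorem makes it constant: its
   Beltrami coefficient satisfies C u_00 - 2 B u_01 + A u_11 = 0, is bounded, and in the
   isothermal coordinates given by the gradient of |x|^2 / 2 plus a potential, which
   do not contract distances, a logarithmic barrier proves Liouville's theorem for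
   supersolutions.

   Hence s and t have holomorphic derivatives phi_s, phi_t with phi_s phi_t constant.
   If this constant is 0, one of s, t is constant (unique continuation, by the three
   circles theorem), the metric is flat and f = h y_0 + y_1. Otherwise
   phi_s = e^(r + i tau), sqrt(det g) is an affine function of the cosine of tau, and the
   total curvature bounds the Dirichlet integral of a function w at bounded distance
   from a multiple of tau. By the Courant-Lebesgue lemma w, hence tau, has bounded
   oscillation on the boundaries of large rectangles; the maximum principle and
   Liouville's theorem make tau constant, so that f is affine. *)

(** * Derivatives along lines *)

(** All complex analysis is done with real functions: holomorphy is a first-order system, an
    argument is a potential of its differential. The isothermal coordinates are never inverted; they
    enter only through the function [dist2], which has to tend to infinity, whence the interest in a
    map that does not contract. In dimension two the logarithm of such a function is unbounded and
    nearly harmonic, which is why a one-sided bound suffices in Liouville's theorem.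

    The obstacle in the last case is that the curvature density is the Dirichlet density of tau
    times a factor [C0 k1 + D2], up to a bounded positive denominator, and that this factor can
    vanish: finite total curvature does not directly bound the Dirichlet integral of tau. The
    differential of w carries the square of the factor as a weight, so that its Dirichlet density is
    controlled, while the weight has a positive mean over a period of tau, so that w differs from a
    multiple of tau by a periodic, hence bounded, function of tau. *)

Section LineRestriction.
Variables (R : realType) (V : normedModType R).
Implicit Types (u : V -> R) (x v : V).

(** Both derivatives are limits of the same difference quotient, so that one-variable calculus
    applies to directional derivatives. *)
Lemma is_derive_line u x v (d : R) :
  is_derive x v u d <-> is_derive (0 : R) 1 (fun h : R => u (h *: v + x)) d.
Proof.
have E : (fun h : R => h^-1 *: ((u \o shift x) (h *: v) - u x)) =
  (fun h : R => h^-1 *: (((fun h : R => u (h *: v + x)) \o shift 0) (h *: (1 : R))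
      - u (0 *: v + x))).
  by apply/funext => h /=; rewrite scale0r add0r addr0 /GRing.scale /= mulr1.
by split => -[Hd Hv]; split;
  rewrite /derivable /derive ?E -?E // /derivable /derive in Hd Hv *.
Qed.

Lemma is_derive_along u x v (t d : R) :
  is_derive (t *: v + x) v u d ->
  is_derive t 1 (fun h : R => u (h *: v + x)) d.
Proof.
have E : (fun h : R => h^-1 *: ((u \o shift (t *: v + x)) (h *: v) - u (t *: v + x))) =
  (fun h : R => h^-1 *: (((fun h : R => u (h *: v + x)) \o shift t) (h *: (1 : R))
      - u (t *: v + x))).
  apply/funext => h /=; have -> : h *: (1 : R) = h by exact: mulr1.
  by rewrite scalerDl addrA.
by move=> [Hd Hv]; split; rewrite /derivable /derive E in Hd Hv *.
Qed.

Lemma is_derive_compR (phi : R -> R) u x v (a d : R) :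
  is_derive (u x) (1 : R) phi a -> is_derive x v u d ->
  is_derive x v (fun y => phi (u y)) (a * d).
Proof.
move=> Ha /is_derive_line Hd; apply/is_derive_line.
apply: (@is_derive1_comp R phi (fun h : R => u (h *: v + x)) 0 a d) Hd.
by rewrite scale0r add0r.
Qed.

End LineRestriction.

Section LineDerivatives.
Variable R : realType.
Implicit Types (u w : R * R -> R) (x v : R * R).

(** The endpoints come in either order, and the intermediate point is located only by its distance
    to [a], which is what continuity estimates need. *)
Lemma mvt (phi dphi : R -> R) (a b : R) :
  (forall t : R, is_derive t 1 phi (dphi t)) ->
  exists2 c, `|c - a| <= `|b - a| & phi b - phi a = dphi c * (b - a).
Proof.
move=> H.
have cphi : continuous phi.
  move=> t; apply/differentiable_continuous/derivable1_diffP.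
  exact: (@ex_derive _ _ _ _ _ _ _ (H t)).
case: (leP a b) => ab.
  have [c cab E] := @MVT_segment R phi dphi a b ab (fun t _ => H t)
    (continuous_subspaceT cphi).
  exists c => //; rewrite !ger0_norm ?subr_ge0 ?(itvP cab) //.
  by rewrite lerD2r (itvP cab).
have [c cab E] := @MVT_segment R phi dphi b a (ltW ab) (fun t _ => H t)
  (continuous_subspaceT cphi).
exists c; last by rewrite -opprB E -mulrN opprB.
have [bc ca] : b <= c /\ c <= a by rewrite !(itvP cab).
by rewrite ![`|_ - a|]distrC !ger0_norm ?subr_ge0 ?(ltW ab) // lerD2l lerN2.
Qed.

Lemma mvt_axis0 u p (x1 x2 y1 : R) :
  (forall x, is_derive x (axis R 0) u (p x)) ->
  exists2 c, `|c - x1| <= `|y1 - x1| &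
    u (y1, x2) - u (x1, x2) = p (c, x2) * (y1 - x1).
Proof.
move=> H.
have E (h : R) : h *: axis R 0 + (0, x2) = (h, x2).
  apply: injective_projections => /=.
    by rewrite addr0; exact: mulr1.
  by rewrite scaler0 add0r.
have [t|c c1 c2] := @mvt (fun h => u (h *: axis R 0 + (0, x2)))
  (fun h => p (h *: axis R 0 + (0, x2))) x1 y1.
  by apply: is_derive_along; exact: H.
by exists c => //; move: c2; rewrite !E.
Qed.

Lemma mvt_axis1 u p (x1 x2 y2 : R) :
  (forall x, is_derive x (axis R 1) u (p x)) ->
  exists2 c, `|c - x2| <= `|y2 - x2| &
    u (x1, y2) - u (x1, x2) = p (x1, c) * (y2 - x2).
Proof.
move=> H.
have E (h : R) : h *: axis R 1 + (x1, 0) = (x1, h).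
  apply: injective_projections => /=.
    by rewrite scaler0 add0r.
  by rewrite addr0; exact: mulr1.
have [t|c c1 c2] := @mvt (fun h => u (h *: axis R 1 + (x1, 0)))
  (fun h => p (h *: axis R 1 + (x1, 0))) x2 y2.
  by apply: is_derive_along; exact: H.
by exists c => //; move: c2; rewrite !E.
Qed.

Lemma continuous_planeP u x : {for x, continuous u} -> forall e : R, 0 < e ->
  exists2 d : R, 0 < d & forall y, `|y.1 - x.1| < d -> `|y.2 - x.2| < d ->
    `|u y - u x| < e.
Proof.
move=> cu e e0; move/cvgrPdist_lt: cu => /(_ e e0) /nbhs_ballP[d d0 Hd].
exists d => // y y1 y2; rewrite distrC; apply: Hd.
by split; rewrite /ball /= distrC.
Qed.

Lemma continuous_planeI u x : (forall e : R, 0 < e ->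
  exists2 d : R, 0 < d & forall y, `|y.1 - x.1| < d -> `|y.2 - x.2| < d ->
    `|u y - u x| < e) -> {for x, continuous u}.
Proof.
move=> H; apply/cvgrPdist_lt => e e0; have [d d0 Hd] := H e e0.
apply: filterS (nbhsx_ballx x d d0) => y [y1 y2].
by rewrite distrC; apply: Hd; rewrite distrC.
Qed.

(** The increment along [h v] is split into a horizontal and a vertical step. The mean value theorem
    turns each into a partial derivative at a point within [|h| m] of [x], and continuity of [p] and
    [q] controls the error. *)
Lemma is_derive_dir u p q x v :
  (forall x, is_derive x (axis R 0) u (p x)) ->
  (forall x, is_derive x (axis R 1) u (q x)) ->
  continuous p -> continuous q ->
  is_derive x v u (v.1 * p x + v.2 * q x).
Proof.
move=> H0 H1 cp cq.
suff C : h^-1 *: ((u \o shift x) (h *: v) - u x) @[h --> 0^'] -->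
    v.1 * p x + v.2 * q x.
  by split; [apply/cvg_ex; eexists; exact: C | exact: cvg_lim C].
apply/cvgrPdist_le => e e0.
pose m := `|v.1| + `|v.2| + 1.
have m0 : 0 < m by rewrite /m ltr_wpDl // addr_ge0.
have [d1 d10 D1] := continuous_planeP (cp x) (divr_gt0 e0 m0).
have [d2 d20 D2] := continuous_planeP (cq x) (divr_gt0 e0 m0).
pose d := Num.min d1 d2.
have d0 : 0 < d by rewrite lt_min d10.
near=> h.
have h0 : h != 0 by near: h; exact: nbhs_dnbhs_neq.
have hd : `|h| * m < d.
  rewrite -ltr_pdivlMr //; near: h.
  exact: dnbhs0_lt (divr_gt0 d0 m0).
rewrite /=.
have -> : h *: v + x = (h * v.1 + x.1, h * v.2 + x.2) by [].
have [c c1 c2] := @mvt_axis0 u p x.1 (h * v.2 + x.2) (h * v.1 + x.1) H0.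
have [c' c'1 c'2] := @mvt_axis1 u q x.1 x.2 (h * v.2 + x.2) H1.
rewrite !addrK in c1 c2 c'1 c'2.
have -> : u (h * v.1 + x.1, h * v.2 + x.2) - u x =
   h * (v.1 * p (c, h * v.2 + x.2) + v.2 * q (x.1, c')).
  rewrite [in u x](surjective_pairing x).
  have -> : u (h * v.1 + x.1, h * v.2 + x.2) =
    u (x.1, x.2) + p (c, h * v.2 + x.2) * (h * v.1) + q (x.1, c') * (h * v.2).
    by rewrite -c2 -c'2; ring.
  ring.
rewrite /GRing.scale /= mulKf //.
have v1m : `|v.1| < m by rewrite /m; have := normr_ge0 v.2; lra.
have v2m : `|v.2| < m by rewrite /m; have := normr_ge0 v.1; lra.
have sm (z : R) : `|z| < m -> `|h * z| < d.
  move=> zm; rewrite normrM; apply: le_lt_trans hd.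
  by rewrite ler_pM2l ?normr_gt0 // ltW.
have P1 : `|p (c, h * v.2 + x.2) - p x| < e / m.
  apply: D1 => /=.
    by apply: le_lt_trans c1 _; apply: lt_le_trans (sm _ v1m) _; rewrite ge_min lexx.
  by rewrite addrK; apply: lt_le_trans (sm _ v2m) _; rewrite ge_min lexx.
have P2 : `|q (x.1, c') - q x| < e / m.
  apply: D2 => /=; first by rewrite subrr normr0.
  by apply: le_lt_trans c'1 _; apply: lt_le_trans (sm _ v2m) _; rewrite ge_min lexx orbT.
set P := p (c, _) in P1 *; set Q := q (_, c') in P2 *.
have -> : v.1 * p x + v.2 * q x - (v.1 * P + v.2 * Q) =
  - (v.1 * (P - p x) + v.2 * (Q - q x)) by ring.
rewrite normrN; apply: le_trans (ler_normD _ _) _; rewrite !normrM.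
have A1 : `|v.1| * `|P - p x| <= `|v.1| * (e / m) by rewrite ler_wpM2l // ltW.
have A2 : `|v.2| * `|Q - q x| <= `|v.2| * (e / m) by rewrite ler_wpM2l // ltW.
apply: le_trans (lerD A1 A2) _; rewrite -mulrDl mulrCA ger_pMr //.
by rewrite ler_pdivrMr // mul1r /m; lra.
Unshelve. all: by end_near. Qed.

(** The same two-step path; near [x] the partial derivatives are bounded by [|p x| + 1] and
    [|q x| + 1], whose sum is [m]. This spares [smoothI] a continuity hypothesis on the function. *)
Lemma gradient_continuous u p q x :
  (forall x, is_derive x (axis R 0) u (p x)) ->
  (forall x, is_derive x (axis R 1) u (q x)) ->
  continuous p -> continuous q -> {for x, continuous u}.
Proof.
move=> H0 H1 cp cq; apply: continuous_planeI => e e0.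
have [d1 d10 D1] := continuous_planeP (cp x) ltr01.
have [d2 d20 D2] := continuous_planeP (cq x) ltr01.
pose m := `|p x| + `|q x| + 2.
have m0 : 0 < m by rewrite /m ltr_wpDl // addr_ge0.
exists (Num.min (Num.min d1 d2) (e / m)).
  by rewrite !lt_min d10 d20 divr_gt0.
move=> y; rewrite !lt_min => /andP[/andP[y11 y12] y13] /andP[/andP[y21 y22] y23].
have [c c1 c2] := @mvt_axis0 u p x.1 y.2 y.1 H0.
have [c' c'1 c'2] := @mvt_axis1 u q x.1 x.2 y.2 H1.
have -> : u y - u x = p (c, y.2) * (y.1 - x.1) + q (x.1, c') * (y.2 - x.2).
  by rewrite -c2 -c'2 -!surjective_pairing; ring.
have P1 : `|p (c, y.2)| <= `|p x| + 1.
  have : `|p (c, y.2) - p x| < 1 by apply: D1 => //=; exact: le_lt_trans c1 _.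
  move=> L; have -> : p (c, y.2) = p (c, y.2) - p x + p x by ring.
  by apply: le_trans (ler_normD _ _) _; lra.
have P2 : `|q (x.1, c')| <= `|q x| + 1.
  have : `|q (x.1, c') - q x| < 1.
    by apply: D2 => //=; rewrite ?subrr ?normr0 //; exact: le_lt_trans c'1 _.
  move=> L; have -> : q (x.1, c') = q (x.1, c') - q x + q x by ring.
  by apply: le_trans (ler_normD _ _) _; lra.
apply: le_lt_trans (ler_normD _ _) _; rewrite !normrM.
have : `|p (c, y.2)| * `|y.1 - x.1| + `|q (x.1, c')| * `|y.2 - x.2| <=
  (`|p x| + 1) * Num.max `|y.1 - x.1| `|y.2 - x.2| +
  (`|q x| + 1) * Num.max `|y.1 - x.1| `|y.2 - x.2|.
  by apply: lerD; apply: ler_pM => //; rewrite le_max lexx ?orbT.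
move/le_lt_trans; apply.
have -> (z : R) : (`|p x| + 1) * z + (`|q x| + 1) * z = m * z by rewrite /m; ring.
by rewrite mulrC -ltr_pdivlMr // gt_max y13.
Qed.

End LineDerivatives.

(** * Smooth functions of the plane *)

Section DerivativeRules.
Variables (R : realType) (V : normedModType R).
Implicit Types (u w : V -> R) (x v : V) (a b c d : R).

Lemma sder_eq u x v a b : is_derive x v u a -> a = b -> is_derive x v u b.
Proof. by move=> H <-. Qed.

Lemma sderC c x v : is_derive x v (fun=> c) 0.
Proof. exact: is_derive_cst. Qed.

Lemma sderD u w x v a b : is_derive x v u a -> is_derive x v w b ->
  is_derive x v (fun y => u y + w y) (a + b).
Proof. exact: is_deriveD. Qed.

Lemma sderN u x v a : is_derive x v u a -> is_derive x v (fun y => - u y) (- a).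
Proof. exact: is_deriveN. Qed.

Lemma sderM u w x v a b : is_derive x v u a -> is_derive x v w b ->
  is_derive x v (fun y => u y * w y) (u x * b + w x * a).
Proof. by move=> H1 H2; exact: is_deriveM. Qed.

Lemma sderX u n x v a : is_derive x v u a ->
  is_derive x v (fun y => u y ^+ n) (n%:R * u x ^+ n.-1 * a).
Proof.
move=> H1; elim: n => [|n IH]; first by rewrite mul0r mul0r; exact: sderC.
have -> : (fun y => u y ^+ n.+1) = (fun y => u y * u y ^+ n).
  by apply/funext => y; rewrite exprS.
apply: sder_eq (sderM H1 IH) _.
case: n {IH} => [|n] /=; first by rewrite expr0; ring.
by rewrite -[n.+2%:R]natr1 exprS; ring.
Qed.

Lemma sderV u x v a : u x != 0 -> is_derive x v u a ->
  is_derive x v (fun y => (u y)^-1) (- a / u x ^+ 2).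
Proof.
move=> u0 [H <-]; split; first exact: derivableV.
by rewrite deriveV // mulNr mulrC scaleNr.
Qed.

Lemma sder_ln u x v a : 0 < u x -> is_derive x v u a ->
  is_derive x v (fun y => ln (u y)) (a / u x).
Proof.
move=> u0 H; rewrite mulrC.
exact: (is_derive_compR (is_derive1_ln u0) H).
Qed.

Lemma sder_sqrt u x v a : 0 < u x -> is_derive x v u a ->
  is_derive x v (fun y => Num.sqrt (u y)) (a / (2 * Num.sqrt (u x))).
Proof.
move=> u0 H; rewrite mulrC.
exact: (is_derive_compR (is_derive1_sqrt u0) H).
Qed.

End DerivativeRules.

Section Smooth.
Variable R : realType.
Implicit Types (u w : R * R -> R) (x v : R * R) (a b c d : R) (n : nat).

Lemma Cn_cont (V : normedModType R) n (F : R * R -> V) : Cn n F -> continuous F.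
Proof. by case: n => [|n] []. Qed.

Lemma CnW (V : normedModType R) n (F : R * R -> V) : Cn n.+1 F -> Cn n F.
Proof.
elim: n F => [|n IH] F [cF H]; first by split.
split=> // i; have [dF CF] := H i; split=> //; exact: IH.
Qed.

Lemma CnI n u (p : 'I_2 -> R * R -> R) : continuous u ->
  (forall i x, is_derive x (axis R i) u (p i x)) ->
  (forall i, Cn n (p i)) -> Cn n.+1 u.
Proof.
move=> cu du Cp; split=> // i; split=> [x|].
  exact: (@ex_derive _ _ _ _ _ _ _ (du i x)).
suff -> : pderiv i u = p i by exact: Cp.
by apply/funext => x; exact: (@derive_val _ _ _ _ _ _ _ (du i x)).
Qed.

Lemma Cn_der n u i x : Cn n.+1 u -> is_derive x (axis R i) u (pderiv i u x).
Proof. by move=> [_ /(_ i) [du _]]; exact: derivableP. Qed.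

Lemma Cn_pderiv n u i : Cn n.+1 u -> Cn n (pderiv i u).
Proof. by move=> [_ /(_ i) []]. Qed.

Lemma Cn_cst n c : Cn n (fun _ : R * R => c).
Proof.
elim: n c => [|n IH] c; first by split=> // x; exact: cst_continuous.
have cc : continuous (fun _ : R * R => c) by move=> x; exact: cst_continuous.
exact: (@CnI n _ (fun _ _ => 0) cc (fun i x => sderC c x (axis R i)) (fun=> IH 0)).
Qed.

Lemma CnD n u w : Cn n u -> Cn n w -> Cn n (fun y => u y + w y).
Proof.
elim: n u w => [|n IH] u w Cu Cw.
  by split=> // x; apply: continuousD; [exact: (Cn_cont Cu)|exact: (Cn_cont Cw)].
apply: (@CnI n _ (fun i y => pderiv i u y + pderiv i w y)) => [x|i x|i].
- by apply: continuousD; [exact: (Cn_cont Cu)|exact: (Cn_cont Cw)].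
- by apply: sderD; apply: Cn_der; eassumption.
- by apply: IH; exact: Cn_pderiv.
Qed.

Lemma CnN n u : Cn n u -> Cn n (fun y => - u y).
Proof.
elim: n u => [|n IH] u Cu.
  by split=> // x; apply: continuousN; exact: (Cn_cont Cu).
apply: (@CnI n _ (fun i y => - pderiv i u y)) => [x|i x|i].
- by apply: continuousN; exact: (Cn_cont Cu).
- by apply: sderN; apply: Cn_der; eassumption.
- by apply: IH; exact: Cn_pderiv.
Qed.

Lemma CnM n u w : Cn n u -> Cn n w -> Cn n (fun y => u y * w y).
Proof.
elim: n u w => [|n IH] u w Cu Cw.
  by split=> // x; apply: continuousM; [exact: (Cn_cont Cu)|exact: (Cn_cont Cw)].
apply: (@CnI n _ (fun i y => u y * pderiv i w y + w y * pderiv i u y)) => [x|i x|i].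
- by apply: continuousM; [exact: (Cn_cont Cu)|exact: (Cn_cont Cw)].
- by apply: sderM; apply: Cn_der; eassumption.
- by apply: CnD; apply: IH; first [exact: CnW | exact: Cn_pderiv].
Qed.

Lemma CnX n u k : Cn n u -> Cn n (fun y => u y ^+ k).
Proof.
move=> Cu; elim: k => [|k IH].
  by have -> : (fun y => u y ^+ 0) = (fun=> 1) by []; exact: Cn_cst.
have -> : (fun y => u y ^+ k.+1) = (fun y => u y * u y ^+ k).
  by apply/funext => y; rewrite exprS.
exact: CnM.
Qed.

Lemma CnV n u : (forall x, u x != 0) -> Cn n u -> Cn n (fun y => (u y)^-1).
Proof.
move=> u0; elim: n u u0 => [|n IH] u u0 Cu.
  by split=> // x; apply: continuousV => //; exact: (Cn_cont Cu).
apply: (@CnI n _ (fun i y => - pderiv i u y / u y ^+ 2)) => [x|i x|i].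
- by apply: continuousV => //; exact: (Cn_cont Cu).
- by apply: sderV => //; apply: Cn_der; eassumption.
- apply: CnM; first by apply: CnN; exact: Cn_pderiv.
  apply: IH => [x|]; first by rewrite expf_neq0.
  by apply: CnX; exact: CnW.
Qed.

Lemma Cn_ln n u : (forall x, 0 < u x) -> Cn n u -> Cn n (fun y => ln (u y)).
Proof.
move=> u0 Cu.
have cl : continuous (fun y => ln (u y)).
  move=> x; have cu : {for x, continuous u} by exact: (Cn_cont Cu).
  exact: (continuous_comp cu (continuous_ln (u0 x))).
case: n Cu => [|n] Cu; first by split.
apply: (@CnI n _ (fun i y => pderiv i u y / u y)) => [//|i x|i].
- by apply: sder_ln => //; apply: Cn_der; eassumption.
- apply: CnM; first exact: Cn_pderiv.
  by apply: CnV => [x|]; [rewrite gt_eqF|exact: CnW].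
Qed.

Lemma Cn_sqrt n u : (forall x, 0 < u x) -> Cn n u -> Cn n (fun y => Num.sqrt (u y)).
Proof.
move=> u0.
have cl : continuous u -> continuous (fun y => Num.sqrt (u y)).
  by move=> cu x; exact: (continuous_comp (cu x) (@sqrt_continuous R (u x))).
elim: n => [|n IH] Cu; first by split=> //; apply: cl; exact: (Cn_cont Cu).
apply: (@CnI n _ (fun i y => pderiv i u y / (2 * Num.sqrt (u y)))) => [|i x|i].
- by apply: cl; exact: (Cn_cont Cu).
- by apply: sder_sqrt => //; apply: Cn_der; eassumption.
- apply: CnM; first exact: Cn_pderiv.
  apply: CnV => [x|]; first by rewrite mulf_neq0 // gt_eqF // ?sqrtr_gt0.
  by apply: CnM; [exact: Cn_cst|apply: IH; exact: CnW].
Qed.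

(* An opaque copy of pderiv: otherwise comparing two partial derivatives unfolds
   them down to limits along filters. *)
Fact partial_subproof : {D : 'I_2 -> (R * R -> R) -> R * R -> R | D = @pderiv R R}.
Proof. by exists (@pderiv R R). Qed.

Definition partial : 'I_2 -> (R * R -> R) -> R * R -> R := sval partial_subproof.

Lemma partialE : partial = @pderiv R R.
Proof. exact: (svalP partial_subproof). Qed.

Lemma smooth_der u i x : smooth u -> is_derive x (axis R i) u (partial i u x).
Proof. by rewrite partialE => /(_ 1%N); exact: Cn_der. Qed.

Lemma smooth_partial u i : smooth u -> smooth (partial i u).
Proof. by rewrite partialE => Su n; apply: Cn_pderiv; exact: Su. Qed.

Lemma smooth_cont u : smooth u -> continuous u.
Proof. by move=> /(_ 0%N) []. Qed.

Lemma smooth_cst c : smooth (fun _ : R * R => c).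
Proof. by move=> n; exact: Cn_cst. Qed.

Lemma smoothD u w : smooth u -> smooth w -> smooth (fun y => u y + w y).
Proof. by move=> Su Sw n; exact: CnD. Qed.

Lemma smoothN u : smooth u -> smooth (fun y => - u y).
Proof. by move=> Su n; exact: CnN. Qed.

Lemma smoothM u w : smooth u -> smooth w -> smooth (fun y => u y * w y).
Proof. by move=> Su Sw n; exact: CnM. Qed.

Lemma smoothX u k : smooth u -> smooth (fun y => u y ^+ k).
Proof. by move=> Su n; exact: CnX. Qed.

Lemma smoothV u : (forall x, u x != 0) -> smooth u -> smooth (fun y => (u y)^-1).
Proof. by move=> u0 Su n; exact: CnV. Qed.

Lemma smooth_ln u : (forall x, 0 < u x) -> smooth u -> smooth (fun y => ln (u y)).
Proof. by move=> u0 Su n; exact: Cn_ln. Qed.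

Lemma smooth_sqrt u :
  (forall x, 0 < u x) -> smooth u -> smooth (fun y => Num.sqrt (u y)).
Proof. by move=> u0 Su n; exact: Cn_sqrt. Qed.

Lemma smoothI u (p : 'I_2 -> R * R -> R) :
  (forall i x, is_derive x (axis R i) u (p i x)) ->
  (forall i, smooth (p i)) -> smooth u.
Proof.
move=> du Sp.
have cu : continuous u.
  by move=> x; apply: (@gradient_continuous R u (p 0) (p 1)) => //; exact: smooth_cont.
by case=> [|n]; [split|apply: (@CnI n _ p) => // i; exact: Sp].
Qed.

Lemma partial_eq u i (d : R * R -> R) :
  (forall x, is_derive x (axis R i) u (d x)) -> partial i u = d.
Proof.
by move=> H; rewrite partialE; apply/funext => x; exact: (@derive_val _ _ _ _ _ _ _ (H x)).
Qed.

Lemma smooth_proj (j : 'I_2) : smooth (fun x : R * R => if j == 0 then x.1 else x.2).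
Proof.
apply: (@smoothI _ (fun i _ => (i == j)%:R)) => [i x|i]; first exact: is_derive_coord.
exact: smooth_cst.
Qed.

Lemma smooth_fst : smooth (fun x : R * R => x.1).
Proof. exact: (smooth_proj 0). Qed.

Lemma smooth_snd : smooth (fun x : R * R => x.2).
Proof. exact: (smooth_proj 1). Qed.

Lemma sder_fst i x : is_derive x (axis R i) (fun x : R * R => x.1) (i == 0)%:R.
Proof. exact: (is_derive_coord i 0 x). Qed.

Lemma sder_snd i x : is_derive x (axis R i) (fun x : R * R => x.2) (i == 1)%:R.
Proof. exact: (is_derive_coord i 1 x). Qed.

Lemma ord2P (i : 'I_2) : i = 0 \/ i = 1.
Proof. by case: i => [[|[|//]] ?]; [left|right]; exact: val_inj. Qed.

Lemma sder_slice0 u (t z d : R) : is_derive (t, z) (axis R 0) u d ->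
  is_derive t 1 (fun t : R => u (t, z)) d.
Proof.
have E (h : R) : (h, z) = h *: axis R 0 + (0, z).
  apply: injective_projections => /=; last by rewrite scaler0 add0r.
  by rewrite addr0; apply/esym; exact: mulr1.
rewrite (_ : (fun t => _) = (fun t : R => u (t *: axis R 0 + (0, z)))).
  by rewrite E; exact: is_derive_along.
by apply/funext => k; rewrite E.
Qed.

Lemma sder_slice1 u (t z d : R) : is_derive (z, t) (axis R 1) u d ->
  is_derive t 1 (fun t : R => u (z, t)) d.
Proof.
have E (h : R) : (z, h) = h *: axis R 1 + (z, 0).
  apply: injective_projections => /=; first by rewrite scaler0 add0r.
  by rewrite addr0; apply/esym; exact: mulr1.
rewrite (_ : (fun t => _) = (fun t : R => u (t *: axis R 1 + (z, 0)))).
  by rewrite E; exact: is_derive_along.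
by apply/funext => k; rewrite E.
Qed.

Lemma mixed_derivatives_eq u p q A B x :
  (forall y, is_derive y (axis R 0) u (p y)) ->
  (forall y, is_derive y (axis R 1) u (q y)) ->
  (forall y, is_derive y (axis R 1) p (B y)) ->
  (forall y, is_derive y (axis R 0) q (A y)) ->
  {for x, continuous A} -> {for x, continuous B} -> A x = B x.
Proof.
move=> up uq pB qA cA cB.
apply/eqP; rewrite -subr_eq0 -normr_eq0 eq_le normr_ge0 andbT.
apply/ler_addgt0Pl => e e0; rewrite addr0.
have e2 : 0 < e / 2 by rewrite divr_gt0.
have [d1 d10 D1] := continuous_planeP cA e2.
have [d2 d20 D2] := continuous_planeP cB e2.
pose h := Num.min d1 d2 / 2.
have d0 : 0 < Num.min d1 d2 by rewrite lt_min d10.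
have h0 : 0 < h by rewrite divr_gt0.
have hd : h < Num.min d1 d2 by rewrite /h; lra.
move: (hd); rewrite lt_min => /andP[hd1 hd2].
have Eh (z : R) : z + h - z = h by rewrite addrC addKr.
(* Both mixed derivatives are hit by the same second difference. *)
pose Dl := u (x.1 + h, x.2 + h) - u (x.1 + h, x.2) - u (x.1, x.2 + h) + u (x.1, x.2).
have [c1 [c2 [E1 E2 E3]]] : exists c1 c2, [/\ `|c1 - x.1| <= h, `|c2 - x.2| <= h &
    Dl = h * h * B (c1, c2)].
  have [t|c cx Ec] := @mvt R (fun t => u (t, x.2 + h) - u (t, x.2))
      (fun t => p (t, x.2 + h) - p (t, x.2)) x.1 (x.1 + h).
    by apply: is_deriveB; apply: sder_slice0; exact: up.
  have [t|c' cx' Ec'] := @mvt R (fun t => p (c, t))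
      (fun t => B (c, t)) x.2 (x.2 + h).
    by apply: sder_slice1; exact: pB.
  move: cx cx' Ec Ec'; rewrite !Eh (ger0_norm (ltW h0)).
  by move=> ? ? Ec Ec'; exists c, c'; split=> //; rewrite /Dl; move: Ec; rewrite Ec' => Ec; lra.
have [c3 [c4 [E4 E5 E6]]] : exists c1 c2, [/\ `|c1 - x.1| <= h, `|c2 - x.2| <= h &
    Dl = h * h * A (c1, c2)].
  have [t|c cx Ec] := @mvt R (fun t => u (x.1 + h, t) - u (x.1, t))
      (fun t => q (x.1 + h, t) - q (x.1, t)) x.2 (x.2 + h).
    by apply: is_deriveB; apply: sder_slice1; exact: uq.
  have [t|c' cx' Ec'] := @mvt R (fun t => q (t, c))
      (fun t => A (t, c)) x.1 (x.1 + h).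
    by apply: sder_slice0; exact: qA.
  move: cx cx' Ec Ec'; rewrite !Eh (ger0_norm (ltW h0)).
  by move=> ? ? Ec Ec'; exists c', c; split=> //; rewrite /Dl; move: Ec; rewrite Ec' => Ec; lra.
have EAB : A (c3, c4) = B (c1, c2).
  by apply: (@mulfI _ (h * h)); rewrite ?mulf_neq0 ?gt_eqF // -E3 -E6.
have := D1 (c3, c4) (le_lt_trans E4 hd1) (le_lt_trans E5 hd1).
have := D2 (c1, c2) (le_lt_trans E1 hd2) (le_lt_trans E2 hd2).
rewrite EAB; move: (A x) (B x) (B _) => a b c.
rewrite !ltr_norml ler_norml => /andP[? ?] /andP[? ?].
by apply/andP; split; lra.
Qed.

Lemma partial01 u x : smooth u -> partial 0 (partial 1 u) x = partial 1 (partial 0 u) x.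
Proof.
move=> Su; apply: (@mixed_derivatives_eq u (partial 0 u) (partial 1 u)).
- by move=> y; exact: smooth_der.
- by move=> y; exact: smooth_der.
- by move=> y; apply: smooth_der; exact: smooth_partial.
- by move=> y; apply: smooth_der; exact: smooth_partial.
- by apply: smooth_cont; do 2!apply: smooth_partial.
- by apply: smooth_cont; do 2!apply: smooth_partial.
Qed.

Lemma partialC u i j : smooth u -> partial i (partial j u) = partial j (partial i u).
Proof.
move=> Su; apply/funext => x.
case: (ord2P i) => ->; case: (ord2P j) => ->.
- reflexivity.
- exact: partial01.
- exact/esym/partial01.
- reflexivity.
Qed.

End Smooth.

(** Recursion on the syntax of the function. The conditions that a denominator does not vanish, or
    that the argument of a logarithm or square root is positive, are left as goals. *)
Ltac smo :=
  lazymatch goal with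
  | |- smooth (fun _ => ?c) => apply smooth_cst
  | |- smooth (fun y => @GRing.add _ (@?f y) (@?g y)) =>
      apply (@smoothD _ f g); smo
  | |- smooth (fun y => @GRing.opp _ (@?f y)) => apply (@smoothN _ f); smo
  | |- smooth (fun y => @GRing.mul _ (@?f y) (@?g y)) =>
      apply (@smoothM _ f g); smo
  | |- smooth (fun y => @GRing.exp _ (@?f y) ?n) => apply (@smoothX _ f n); smo
  | |- smooth (fun y => @GRing.inv _ (@?f y)) => apply (@smoothV _ f); [|smo]
  | |- smooth (fun y => ln (@?f y)) => apply (@smooth_ln _ f); [|smo]
  | |- smooth (fun y => Num.sqrt (@?f y)) => apply (@smooth_sqrt _ f); [|smo]
  | |- smooth (fun y => fst y) => apply smooth_fst
  | |- smooth (fun y => snd y) => apply smooth_snd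
  | |- smooth (fun y => ?u y) => change (smooth u); smo
  | |- smooth (partial _ _) => apply smooth_partial; smo
  | |- _ => assumption
  end.

Ltac der_rec :=
  lazymatch goal with
  | |- is_derive _ _ (fun _ => ?c) _ => eapply sderC
  | |- is_derive _ _ (fun y => @GRing.add _ (@?f y) (@?g y)) _ =>
      eapply (@sderD _ _ f g); der_rec
  | |- is_derive _ _ (fun y => @GRing.opp _ (@?f y)) _ =>
      eapply (@sderN _ _ f); der_rec
  | |- is_derive _ _ (fun y => @GRing.mul _ (@?f y) (@?g y)) _ =>
      eapply (@sderM _ _ f g); der_rec
  | |- is_derive _ _ (fun y => @GRing.exp _ (@?f y) ?n) _ =>
      eapply (@sderX _ _ f n); der_rec
  | |- is_derive _ _ (fun y => @GRing.inv _ (@?f y)) _ =>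
      eapply (@sderV _ _ f); [|der_rec]
  | |- is_derive _ _ (fun y => ln (@?f y)) _ => eapply (@sder_ln _ _ f); [|der_rec]
  | |- is_derive _ _ (fun y => Num.sqrt (@?f y)) _ =>
      eapply (@sder_sqrt _ _ f); [|der_rec]
  | |- is_derive _ (axis _ ?i) (fun y => fst y) _ => eapply (@sder_fst _ i)
  | |- is_derive _ (axis _ ?i) (fun y => snd y) _ => eapply (@sder_snd _ i)
  | |- is_derive ?x (axis _ ?i) (fun y => ?u y) _ => eapply (@smooth_der _ u i x); smo
  | |- is_derive ?x (axis _ ?i) ?u _ => eapply (@smooth_der _ u i x); smo
  end.

(* The side conditions of inverses, logarithms and square roots come first, the
   equation for the value of the derivative last. *)
Ltac der := eapply sder_eq; [der_rec|].

(** * Potentials *)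

Section Primitive.
Variable R : realType.

Let mu := @lebesgue_measure R.

(** The half-line is dictated by [primitive], where an integral from [a] is differentiated only to
    the right of [a]. *)
Lemma zero_derive_cst (phi : R -> R) (m x y : R) :
  (forall t : R, m < t -> is_derive t 1 phi 0) -> m < x -> m < y -> phi x = phi y.
Proof.
move=> dphi.
wlog xy : x y / x <= y.
  by move=> H mx my; case: (leP x y) => [|/ltW] xy; [|apply/esym]; exact: H.
move=> mx my.
have mt (t : R) : t \in `[x, y] -> m < t.
  by rewrite in_itv /= => /andP[xt _]; exact: lt_le_trans xt.
have [||c _ /eqP] := @MVT_segment R phi (fun=> 0) x y xy.
- by move=> t txy; apply: dphi; apply: mt; apply: subset_itv_oo_cc.
- apply: derivable_within_continuous => t /mt /dphi H.
  exact: (@ex_derive _ _ _ _ _ _ _ H).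
- by rewrite mul0r subr_eq0 => /eqP.
Qed.

(** An integral is differentiated only to the right of its base point. The base point [-(|x| + 1)]
    lies to the left of both [x] and 0, and subtracting the integral up to 0 makes the value
    independent of it. *)
Lemma primitive (g : R -> R) : continuous g ->
  exists G : R -> R, (forall t : R, is_derive t 1 G (g t)) /\ G 0 = 0.
Proof.
move=> cg.
have ig a b : mu.-integrable `[a, b] (EFin \o g).
  apply: continuous_compact_integrable; first exact: segment_compact.
  exact: continuous_subspaceT.
pose F (a x : R) := (\int[mu]_(t in [set` `[a, x]]) g t)%R.
have dF (a x : R) : a < x -> is_derive x 1 (F a) (g x).
  move=> ax; have x1 : x < x + 1 by rewrite ltrDl.
  have [d1 d2] := @continuous_FTC1_closed R g a x (x + 1) x1 (ig _ _) ax (cg x).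
  by split; [exact: d1|rewrite -derive1E; exact: d2].
clearbody F.
have FD (a b x : R) : a < 0 -> b < 0 -> a < x -> b < x ->
    F a x - F a 0 = F b x - F b 0.
  move=> a0 b0 ax bx.
  have D t : Num.max a b < t -> is_derive t 1 (fun t => F a t - F b t) 0.
    rewrite gt_max => /andP[at_ bt]; rewrite -(subrr (g t)).
    by apply: is_deriveB; exact: dF.
  have := zero_derive_cst D; move=> /(_ x 0).
  rewrite !gt_max a0 b0 ax bx => /(_ isT isT) E.
  move: E; move: (F a x) (F b x) (F a 0) (F b 0) => ? ? ? ? E; lra.
pose G x := F (- (`|x : R| + 1)) x - F (- (`|x : R| + 1)) 0.
have GE (a x : R) : a < 0 -> a < x -> G x = F a x - F a 0.
  move=> a0 ax; apply: FD => //; have := ler_norm (- x); rewrite normrN => H.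
  by have := normr_ge0 x; lra.
exists G; split=> [t|]; last by rewrite /G subrr.
pose a : R := - (`|t| + 1).
have a0 : a < 0 by rewrite /a; have := normr_ge0 t; lra.
have at_ : a < t by have := ler_norm (- t); rewrite normrN /a => H; lra.
have H : is_derive t 1 (fun x => F a x - F a 0) (g t).
  rewrite -[X in is_derive _ _ _ X]subr0; apply: is_deriveB; exact: dF.
apply: near_eq_is_derive H; near=> x; rewrite (GE a x) //.
by near: x; exact: lt_nbhsr.
Unshelve. all: by end_near. Qed.

End Primitive.

Section Poincare.
Variable R : realType.

Lemma compact_rectangle (a b c d : R) : compact (`[a, b] `*` `[c, d] : set (R * R)).
Proof. by apply: compact_setX; exact: segment_compact. Qed.

Lemma bounded_on_rectangle (u : R * R -> R) (a b c d : R) : continuous u ->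
  exists M, forall x y, a <= x <= b -> c <= y <= d -> `|u (x, y)| <= M.
Proof.
move=> cu; set K := `[a, b] `*` `[c, d] : set (R * R).
have cn : {within K, continuous (fun x => `|u x|)}.
  apply: continuous_subspaceT => x.
  exact: (continuous_comp (cu x) (@norm_continuous _ _ (u x))).
case: (pselect (K !=set0)) => [K0|K0]; last first.
  exists 0 => x y xab ycd; exfalso; apply: K0; exists (x, y).
  by split; rewrite /= in_itv.
have [m mK H] := compact_EVT_max K0 (@compact_rectangle a b c d) cn.
exists `|u m| => x y xab ycd; apply: H; rewrite inE.
by split; rewrite /= in_itv.
Qed.

(* xi(x, y) = int_0^x p(t, 0) dt + int_0^y q(x, t) dt; the x-derivative of the
   second term is controlled by two mean value theorems and a bound for q_11. *)
Lemma poincare (p q : R * R -> R) : smooth p -> smooth q ->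
  (forall x, partial 1 p x = partial 0 q x) ->
  exists xi : R * R -> R, [/\ smooth xi, forall x, partial 0 xi x = p x &
    forall x, partial 1 xi x = q x].
Proof.
move=> Sp Sq pq.
have cp0 : continuous (fun t : R => p (t, 0)).
  move=> t; apply/differentiable_continuous/derivable1_diffP.
  exact: (@ex_derive _ _ _ _ _ _ _ (sder_slice0 (smooth_der 0 (t, 0) Sp))).
have cq (x : R) : continuous (fun t : R => q (x, t)).
  move=> t; apply/differentiable_continuous/derivable1_diffP.
  exact: (@ex_derive _ _ _ _ _ _ _ (sder_slice1 (smooth_der 1 (x, t) Sq))).
have [P [dP P0]] := primitive cp0.
pose Q x := sval (cid (primitive (cq x))).
have dQ (x t : R) : is_derive t 1 (Q x) (q (x, t)).
  by rewrite /Q; case: cid => /= ? [].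
have Q0 (x : R) : Q x 0 = 0 by rewrite /Q; case: cid => /= ? [].
pose xi (x : R * R) := P x.1 + Q x.1 x.2.
have d1 x : is_derive x (axis R 1) xi (q x).
  apply/is_derive_line.
  rewrite (_ : (fun h => _) = (fun h => P x.1 + Q x.1 (h + x.2))); last first.
    apply/funext => h; rewrite /xi /= scaler0 add0r; congr (_ + Q _ (_ + _)).
    exact: mulr1.
  rewrite -[q x]add0r; apply: is_deriveD.
  rewrite -[q x]mulr1; apply: (@is_derive1_comp R (Q x.1) (fun h => h + x.2)).
    by rewrite add0r [x in q x]surjective_pairing.
  exact: is_derive_shift.
have d0 x : is_derive x (axis R 0) xi (p x).
  have [M HM] := @bounded_on_rectangle (partial 0 (partial 0 q)) (x.1 - 1) (x.1 + 1)
     (- `|x.2|) (`|x.2|) (smooth_cont (smooth_partial 0 (smooth_partial 0 Sq))).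
  have key (h : R) : `|h| <= 1 ->
      `|Q (h + x.1) x.2 - Q x.1 x.2 - h * (p x - p (x.1, 0))| <= `|h| ^+ 2 * M * `|x.2|.
    move=> h1.
    (* As a function of the second coordinate the expression vanishes at 0, and by [pq] its
       derivative is the first-order Taylor remainder of [q] in the first coordinate, of size
       [h ^ 2]. *)
    have [t|c] := @mvt R (fun t => Q (h + x.1) t - Q x.1 t - h * (p (x.1, t) - p (x.1, 0)))
       (fun t => q (h + x.1, t) - q (x.1, t) - h * (partial 1 p (x.1, t))) 0 x.2.
      apply: sderD.
      apply: sderN; apply: sder_eq (sderM (sderC h t 1) (sderD (_ : is_derive t 1
        (fun t : R => p (x.1, t)) (partial 1 p (x.1, t))) (sderC (- p (x.1, 0)) t 1))) _.
        by apply: sder_slice1; exact: smooth_der.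
      by rewrite mulr0 !addr0.
    rewrite !subr0 !Q0 !subrr mulr0 !subr0 => cx E.
    rewrite -surjective_pairing in E; rewrite E normrM ler_wpM2r //.
    have [t|c' c'x E'] := @mvt R (fun t => q (t, c)) (fun t => partial 0 q (t, c)) x.1 (h + x.1).
      by apply: sder_slice0; exact: smooth_der.
    have [t|c'' c''x E''] := @mvt R (fun t => partial 0 q (t, c))
        (fun t => partial 0 (partial 0 q) (t, c)) x.1 c'.
      by apply: sder_slice0; apply: smooth_der; exact: smooth_partial.
    rewrite addrK in c'x E'; rewrite E' pq.
    have -> : partial 0 q (c', c) * h - h * partial 0 q (x.1, c) =
       h * (partial 0 (partial 0 q) (c'', c) * (c' - x.1)) by rewrite -E''; ring.
    rewrite !normrM expr2 -mulrA ler_wpM2l // mulrC.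
    have cM : `|partial 0 (partial 0 q) (c'', c)| <= M.
      apply: HM; last by rewrite -ler_norml.
      have : `|c'' - x.1| <= 1 by exact: le_trans c''x (le_trans c'x h1).
      by rewrite ler_norml => /andP[? ?]; apply/andP; split; lra.
    by apply: ler_pM.
  have Hd : is_derive (0 : R) 1 (fun h => Q (h + x.1) x.2) (p x - p (x.1, 0)).
    pose K := M * `|x.2| + 1.
    suff C : (h : R)^-1 *: (((fun h => Q (h + x.1) x.2) \o shift 0) (h *: (1 : R))
       - Q (0 + x.1) x.2) @[h --> 0^'] --> p x - p (x.1, 0).
      by split; [apply/cvg_ex; eexists; exact: C|exact: cvg_lim C].
    apply/cvgrPdist_le => e e0; near=> h.
    have h0 : h != 0 by near: h; exact: nbhs_dnbhs_neq.
    have h1 : `|h| <= 1 by near: h; exact: dnbhs0_le.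
    have he : `|h| * (M * `|x.2|) <= e.
      have MM : 0 <= `|M * `|x.2| | + 1 by rewrite addr_ge0.
      have : `|h| * (`|M * `|x.2| | + 1) <= e.
        rewrite -ler_pdivlMr ?ltr_wpDl //; near: h; apply: dnbhs0_le.
        by rewrite divr_gt0 // ltr_wpDl.
      apply: le_trans; rewrite ler_wpM2l //.
      by apply: le_trans (ler_norm _) _; rewrite lerDl.
    rewrite /= addr0 add0r.
    have -> : h *: (1 : R) = h by exact: mulr1.
    rewrite distrC -(@ler_pM2l _ `|h|) ?normr_gt0 // -normrM.
    have -> : h * (h^-1 *: (Q (h + x.1) x.2 - Q x.1 x.2) - (p x - p (x.1, 0))) =
       Q (h + x.1) x.2 - Q x.1 x.2 - h * (p x - p (x.1, 0)).
      by rewrite /GRing.scale /= mulrBr mulVKf.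
    apply: le_trans (key h h1) _.
    by rewrite expr2 -!mulrA ler_wpM2l // mulrA.
  apply/is_derive_line.
  rewrite (_ : (fun h => _) = (fun h => P (h + x.1) + Q (h + x.1) x.2)); last first.
    apply/funext => h; rewrite /xi /= scaler0 add0r.
    by have -> : h *: (1 : R) = h by exact: mulr1.
  rewrite (_ : p x = p (x.1, 0) + (p x - p (x.1, 0))); last by rewrite addrC subrK.
  apply: is_deriveD Hd.
  rewrite -[p _]mulr1; apply: (@is_derive1_comp R P (fun h => h + x.1)).
    by rewrite add0r.
  exact: is_derive_shift.
have Sxi : smooth xi.
  apply: (@smoothI _ _ (fun i => if i == 0 then p else q)) => [i x|i].
    by case: (ord2P i) => -> /=.
  by case: (ord2P i) => -> /=.
exists xi; split=> // x; first by rewrite (partial_eq d0).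
by rewrite (partial_eq d1).
Unshelve. all: by end_near. Qed.

End Poincare.

(** * Maximum principle and Liouville theorem *)

Section Elliptic.
Variable R : realType.
Implicit Types (A B C u w : R * R -> R) (x y : R * R).

(** The cofactor matrix of [(A B; B C)] contracted with the Hessian: if this matrix is a metric g
    for which the coordinates are harmonic, it is det g times the Laplacian of g, without
    first-order terms. *)
Definition ell A B C u x : R :=
  C x * partial 0 (partial 0 u) x - 2 * B x * partial 0 (partial 1 u) x
  + A x * partial 1 (partial 1 u) x.

(** The polarized symbol of [ell], that is det g times the g-product of the two gradients. *)
Definition grad_prod A B C u w x : R :=
  C x * (partial 0 u x * partial 0 w x)
  - B x * (partial 0 u x * partial 1 w x + partial 1 u x * partial 0 w x)
  + A x * (partial 1 u x * partial 1 w x).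

(** If [c] were negative, then [dphi], which vanishes at 0, would be negative just to the right of
    0, and [phi] would drop below [phi 0] there. *)
Lemma second_derivative_at_min (phi dphi : R -> R) (c d : R) : 0 < d ->
  (forall t : R, is_derive t 1 phi (dphi t)) -> is_derive (0 : R) 1 dphi c ->
  (forall t, `|t| < d -> phi 0 <= phi t) -> 0 <= c.
Proof.
move=> d0 Hphi [Hd Hc] phi0.
have dphi0 : dphi 0 = 0.
  have [_ <-] := Hphi 0.
  apply: (@derive_val _ _ _ _ _ _ _ (@derive1_at_min R phi (- d) d 0 _ _ _ _)).
  - by lra.
  - by move=> t _; exact: (@ex_derive _ _ _ _ _ _ _ (Hphi t)).
  - by rewrite in_itv /= oppr_lt0 d0.
  - by move=> t; rewrite in_itv /= -ltr_norml; exact: phi0.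
rewrite leNgt; apply/negP => c0.
have cv : (h : R)^-1 *: ((dphi \o shift 0) (h *: (1 : R)) - dphi 0) @[h --> 0^'] --> c.
  by rewrite -Hc; exact: Hd.
have [e e0 He] : exists2 e : R, 0 < e & forall h : R, 0 < h -> h < e -> dphi h < 0.
  have /cvgr_lt /(_ 0 c0) := cv.
  case/nbhs_ballP => e /= e0 He; exists e => // h h0 he.
  have := He h; rewrite /ball /= sub0r normrN gtr0_norm // => /(_ he).
  rewrite gt_eqF // => /(_ isT); rewrite dphi0 subr0 addr0.
  have -> : h *: (1 : R) = h by exact: mulr1.
  by rewrite /GRing.scale /= pmulr_rlt0 ?invr_gt0.
pose h := Num.min d e / 2.
have m0 : 0 < Num.min d e by rewrite lt_min d0.
have h0 : 0 < h by rewrite divr_gt0.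
have : h < Num.min d e by rewrite /h; lra.
rewrite lt_min => /andP[hd he].
have cphi : {within `[0, h], continuous phi}.
  apply: derivable_within_continuous => t _.
  exact: (@ex_derive _ _ _ _ _ _ _ (Hphi t)).
have [t th E] := @MVT R phi dphi 0 h h0 (fun t _ => Hphi t) cphi.
have : phi h - phi 0 < 0.
  rewrite E subr0 pmulr_llt0 //; move: th; rewrite in_itv /= => /andP[t0 th].
  by apply: He => //; exact: lt_trans he.
by rewrite subr_lt0 ltNge phi0 // gtr0_norm.
Qed.

Lemma hessian_at_min u x (v : R * R) : smooth u -> nbhs x (fun y => u x <= u y) ->
  0 <= v.1 ^+ 2 * partial 0 (partial 0 u) x
    + 2 * v.1 * v.2 * partial 0 (partial 1 u) x + v.2 ^+ 2 * partial 1 (partial 1 u) x.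
Proof.
move=> Su /nbhs_ballP[d /= d0 Hd].
pose m := `|v.1| + `|v.2| + 1.
have m0 : 0 < m by rewrite /m ltr_wpDl // addr_ge0.
have dir w y : smooth w ->
    is_derive y v w (v.1 * partial 0 w y + v.2 * partial 1 w y).
  move=> Sw; apply: is_derive_dir.
  - by move=> z; exact: smooth_der.
  - by move=> z; exact: smooth_der.
  - by apply: smooth_cont; exact: smooth_partial.
  - by apply: smooth_cont; exact: smooth_partial.
apply: (@second_derivative_at_min (fun t => u (t *: v + x))
   (fun t => v.1 * partial 0 u (t *: v + x) + v.2 * partial 1 u (t *: v + x)) _ (d / m)).
- exact: divr_gt0.
- by move=> t; apply: is_derive_along; exact: dir.
- apply: (proj1 (is_derive_line (fun y => v.1 * partial 0 u y + v.2 * partial 1 u y) x v _)).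
  apply: sder_eq.
    apply: sderD; apply: sderM; first [exact: sderC | apply: dir; exact: smooth_partial].
  rewrite (partialC 1 0 Su).
  move: (partial 0 (partial 0 u) x) (partial 0 (partial 1 u) x) (partial 1 (partial 1 u) x).
  by move: (partial 0 u x) (partial 1 u x) => a b c e f; ring.
- move=> t; rewrite ltr_pdivlMr // => tm.
  rewrite scale0r add0r; apply: Hd.
  have K z : `|z| <= m -> `|t * z| < d.
    by move=> zm; rewrite normrM; apply: le_lt_trans tm; rewrite ler_wpM2l.
  by split; rewrite /ball /= opprD addrCA subrr addr0 normrN; apply: K;
    rewrite /m; [have := normr_ge0 v.2|have := normr_ge0 v.1]; lra.
Qed.

(** The Hessian is tested on [(1, 0)] and on [(-B, A)]: [A] times [ell] is its value at the second
    vector plus [A C - B ^ 2] times its value at the first. *)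
Lemma ell_at_min A B C u x : 0 < A x -> 0 <= A x * C x - B x ^+ 2 -> smooth u ->
  nbhs x (fun y => u x <= u y) -> 0 <= ell A B C u x.
Proof.
move=> A0 D0 Su Hm.
have := hessian_at_min (1, 0) Su Hm; have := hessian_at_min (- B x, A x) Su Hm.
rewrite /ell /=.
move: (partial 0 (partial 0 u) x) (partial 0 (partial 1 u) x) (partial 1 (partial 1 u) x).
move: (A x) (B x) (C x) A0 D0 => a b c a0 d0 p q r H1 H2.
have p0 : 0 <= p by move: H2; lra.
rewrite -(pmulr_rge0 _ a0).
have := mulr_ge0 d0 p0; nra.
Qed.

(** With a strict inequality the second derivative test alone decides. It is reached later by adding
    a multiple of a barrier or of [x.1 ^ 2]. *)
Lemma min_not_interior A B C u (K : set (R * R)) : compact K -> K !=set0 ->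
  (forall x, 0 < A x) -> (forall x, 0 <= A x * C x - B x ^+ 2) ->
  smooth u -> (forall x, nbhs x K -> ell A B C u x < 0) ->
  exists z, [/\ K z, ~ nbhs z K & forall y, K y -> u z <= u y].
Proof.
move=> cK K0 A0 D0 Su Lu.
have [z] := compact_EVT_min K0 cK (continuous_subspaceT (smooth_cont Su)).
rewrite inE => Kz Hz; exists z; split => //; last by move=> y Ky; apply: Hz; rewrite inE.
move=> nK; have : 0 <= ell A B C u z.
  apply: ell_at_min => //; apply: filterS nK => y Ky.
  by apply: Hz; rewrite inE.
by rewrite leNgt Lu.
Qed.

Lemma nbhs_continuous_lt u w x : continuous u -> continuous w -> u x < w x ->
  nbhs x (fun y => u y < w y).
Proof.
move=> cu cw; rewrite -subr_gt0 => H.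
have c : w y - u y @[y --> x] --> w x - u x by apply: cvgB; [exact: cw|exact: cu].
move/cvgr_gt: c => /(_ 0 H); apply: filterS => y /=.
by rewrite subr_gt0.
Qed.

Lemma ell_comp A B C u x (phi phi1 phi2 : R -> R) : smooth u ->
  (forall y, is_derive (u y) 1 phi (phi1 (u y))) ->
  (forall y, is_derive (u y) 1 phi1 (phi2 (u y))) ->
  ell A B C (fun y => phi (u y)) x =
    phi1 (u x) * ell A B C u x + phi2 (u x) * grad_prod A B C u u x.
Proof.
move=> Su H1 H2.
have E1 i : partial i (fun y => phi (u y)) = fun y => phi1 (u y) * partial i u y.
  by apply: partial_eq => y; apply: is_derive_compR => //; exact: smooth_der.
have E2 i j : partial i (fun y => phi1 (u y) * partial j u y) = 
    fun y => phi1 (u y) * partial i (partial j u) y + partial j u y * (phi2 (u y) * partial i u y).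
  apply: partial_eq => y; apply: sderM.
    by apply: is_derive_compR => //; exact: smooth_der.
  by apply: smooth_der; exact: smooth_partial.
rewrite /ell /grad_prod !E1 !E2.
move: (partial 0 (partial 0 u) x) (partial 0 (partial 1 u) x) (partial 1 (partial 1 u) x).
by move: (partial 0 u x) (partial 1 u x) => a b c e f; ring.
Qed.

End Elliptic.

(** * Logarithmic barriers in isothermal coordinates *)

Section Liouville.
Variable R : realType.
Implicit Types (u w : R * R -> R) (x y : R * R).

(** The maximum norm makes the balls squares, so that compactness comes from [compact_rectangle];
    its square is at most the square of the Euclidean distance. *)
Definition supdist x y : R := Num.max `|x.1 - y.1| `|x.2 - y.2|.

Lemma supdist_continuous y : continuous (fun x => supdist x y).
Proof.
move=> x.
have c1 : {for x, continuous (fun x : R * R => x.1 - y.1)}.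
  by apply: continuousB; [exact: cvg_fst|exact: cst_continuous].
have c2 : {for x, continuous (fun x : R * R => x.2 - y.2)}.
  by apply: continuousB; [exact: cvg_snd|exact: cst_continuous].
exact: (continuous_max (continuous_comp c1 (@norm_continuous _ _ (x.1 - y.1)))
                       (continuous_comp c2 (@norm_continuous _ _ (x.2 - y.2)))).
Qed.

Lemma compact_annulus y (r s : R) : compact [set x | r <= supdist x y <= s].
Proof.
have -> : [set x | r <= supdist x y <= s] =
    (`[y.1 - s, y.1 + s] `*` `[y.2 - s, y.2 + s]) `&`
    (fun x => supdist x y) @^-1` [set t | r <= t].
  apply/seteqP; split => x /=; rewrite !in_itv /= /supdist ge_max.
    by move=> /andP[-> /andP[]]; rewrite !ler_distl => /andP[-> ->] /andP[-> ->].
  move=> [[/andP[? ?] /andP[? ?]] ->] /=; rewrite !ler_distl.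
  by do 2!(apply/andP; split => //); apply/andP.
apply: compact_closedI; first exact: compact_rectangle.
by apply: preimage_closed (@closed_ge R r) => x _; exact: supdist_continuous.
Qed.

Variables A B C : R * R -> R.
Hypothesis A_gt0 : forall x, 0 < A x.
Hypothesis det1 : forall x, A x * C x - B x ^+ 2 = 1.

Lemma annulus_min v y (r s : R) x : smooth v ->
  (forall z, r <= supdist z y -> ell A B C v z < 0) -> r <= supdist x y <= s ->
  exists z, (supdist z y = r \/ supdist z y = s) /\ v z <= v x.
Proof.
move=> Sv Lv xK; pose K := [set x | r <= supdist x y <= s].
have [| | | | |z [Kz nKz Hz]] := @min_not_interior R A B C v K (@compact_annulus y r s).
- by exists x.
- exact: A_gt0.
- by move=> z; rewrite det1.
- exact: Sv.
- by move=> z /nbhs_singleton /andP[rz _]; exact: Lv.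
exists z; split; last exact: Hz.
have := Kz; rewrite /K /= => /andP[rz zs].
have [zr|rz'] := leP (supdist z y) r.
  by left; apply/eqP; rewrite eq_le zr rz.
have [sz|sz] := leP s (supdist z y).
  by right; apply/eqP; rewrite eq_le sz zs.
exfalso; apply: nKz.
have cs c : continuous (fun _ : R * R => c : R) by move=> ?; exact: cst_continuous.
have n1 := nbhs_continuous_lt (cs r) (@supdist_continuous y) rz'.
have n2 := nbhs_continuous_lt (@supdist_continuous y) (cs s) sz.
by apply: filterS2 n1 n2 => t t1 t2; rewrite /K /= (ltW t1) (ltW t2).
Qed.

Variables xi eta : R * R -> R.
Hypothesis Sxi : smooth xi.
Hypothesis Seta : smooth eta.
Hypothesis Lxi : forall x, ell A B C xi x = 0.
Hypothesis Leta : forall x, ell A B C eta x = 0.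
Hypothesis conf : forall x, grad_prod A B C xi xi x = grad_prod A B C eta eta x.
Hypothesis orth : forall x, grad_prod A B C xi eta x = 0.
Hypothesis J_gt0 : forall x, 0 < grad_prod A B C xi xi x.
Hypothesis expand : forall x y,
  (x.1 - y.1) ^+ 2 + (x.2 - y.2) ^+ 2 <= (xi x - xi y) ^+ 2 + (eta x - eta y) ^+ 2.

(** Squared distance to [y] in the coordinates [(xi, eta)], which are conformal by [conf] and
    [orth]; by [expand] it dominates the Euclidean one. *)
Definition dist2 y x : R := (xi x - xi y) ^+ 2 + (eta x - eta y) ^+ 2.

Lemma smooth_dist2 y : smooth (dist2 y).
Proof. by rewrite /dist2; smo. Qed.

Lemma dist2_ge0 y x : 0 <= dist2 y x.
Proof. by rewrite addr_ge0 // sqr_ge0. Qed.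

Lemma supdist_dist2 x y : supdist x y ^+ 2 <= dist2 y x.
Proof.
apply: le_trans (expand x y).
have s1 := sqr_ge0 (x.1 - y.1); have s2 := sqr_ge0 (x.2 - y.2).
by rewrite /supdist maxEle; case: ifP => _; rewrite real_normK ?num_real //; lra.
Qed.

(** In the coordinates [(xi, eta)] the operator is [grad_prod xi xi] times the flat Laplacian, and
    the function |z|^2 has flat Laplacian 4 and squared gradient 4 |z|^2. *)
Lemma dist2_ell y x :
  ell A B C (dist2 y) x = 4 * grad_prod A B C xi xi x /\
  grad_prod A B C (dist2 y) (dist2 y) x = 4 * dist2 y x * grad_prod A B C xi xi x.
Proof.
have E i : partial i (dist2 y) = fun z =>
    2 * (xi z - xi y) * partial i xi z + 2 * (eta z - eta y) * partial i eta z.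
  apply: partial_eq => z; rewrite /dist2; der.
  by move: (partial i xi z) (partial i eta z) => p q; rewrite /=; ring.
have E2 i j : partial i (partial j (dist2 y)) = fun z =>
    2 * partial i xi z * partial j xi z + 2 * partial i eta z * partial j eta z +
    2 * (xi z - xi y) * partial i (partial j xi) z + 2 * (eta z - eta y) * partial i (partial j eta) z.
  rewrite E; apply: partial_eq => z; der.
  move: (partial i xi z) (partial i eta z) (partial j xi z) (partial j eta z).
  move: (partial i (partial j xi) z) (partial i (partial j eta) z) => p q a b c d.
  by ring.
have := Lxi x; have := Leta x; have := conf x; have := orth x.
rewrite /ell /grad_prod !E2 !E /dist2.
move: (partial 0 (partial 0 xi) x) (partial 0 (partial 1 xi) x) (partial 1 (partial 1 xi) x).
move: (partial 0 (partial 0 eta) x) (partial 0 (partial 1 eta) x) (partial 1 (partial 1 eta) x).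
move: (partial 0 xi x) (partial 1 xi x) (partial 0 eta x) (partial 1 eta x).
move: (xi x - xi y) (eta x - eta y) (A x) (B x) (C x).
move=> X Y a b c p q r s e11 e12 e22 x11 x12 x22 H1 H2 H3 H4; split.
  have -> : c * (2 * p * p + 2 * r * r + 2 * X * x11 + 2 * Y * e11) -
    2 * b * (2 * p * q + 2 * r * s + 2 * X * x12 + 2 * Y * e12) +
    a * (2 * q * q + 2 * s * s + 2 * X * x22 + 2 * Y * e22) =
    2 * (c * (p * p) - b * (p * q + q * p) + a * (q * q)) +
    2 * (c * (r * r) - b * (r * s + s * r) + a * (s * s)) +
    2 * X * (c * x11 - 2 * b * x12 + a * x22) + 2 * Y * (c * e11 - 2 * b * e12 + a * e22).
    by ring.
  by rewrite H4 H3 H2; ring.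
set N := c * (p * p) - _ + _ in H2 *.
set N' := c * (r * r) - _ + _ in H2 *.
set O := c * (p * r) - _ + _ in H1 *.
have -> : 4 * (X ^+ 2 + Y ^+ 2) * N = 4 * X ^+ 2 * N + 4 * Y ^+ 2 * N' + 8 * X * Y * O.
  by rewrite H1 -H2; ring.
by rewrite /N /N' /O; ring.
Qed.

(* The correction -2a/(q+a) makes ln(q+a) strictly superharmonic where q > 3a. *)
Definition barrier y (a : R) x : R := ln (dist2 y x + a) - 2 * a / (dist2 y x + a).

Lemma smooth_barrier y a : 0 < a -> smooth (barrier y a).
Proof.
move=> a0; have q0 x : 0 < dist2 y x + a by rewrite ltr_wpDl // dist2_ge0.
have Sd := smooth_dist2 y.
by rewrite /barrier; smo => // x; rewrite gt_eqF.
Qed.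

(** The correction never exceeds 2, so the barrier keeps the logarithmic growth that makes it win at
    infinity. *)
Lemma barrier_ge y a x : 0 < a -> ln (supdist x y ^+ 2 + a) - 2 <= barrier y a x.
Proof.
move=> a0; have q0 : 0 < dist2 y x + a by rewrite ltr_wpDl // dist2_ge0.
rewrite /barrier lerD //.
  by rewrite ler_ln ?posrE // ?lerD2r ?supdist_dist2 // ltr_wpDl // sqr_ge0.
rewrite lerN2 ler_pdivrMr //.
by have := dist2_ge0 y x; nra.
Qed.

Lemma ell_barrier y a x : 0 < a -> 3 * a < dist2 y x -> ell A B C (barrier y a) x < 0.
Proof.
move=> a0 aq; have q0 z : 0 < dist2 y z + a by rewrite ltr_wpDl // dist2_ge0.
pose p1 (t : R) := (t + a)^-1 + 2 * a / (t + a) ^+ 2.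
pose p2 (t : R) := - (t + a) ^- 2 - 4 * a / (t + a) ^+ 3.
have H1 z : is_derive (dist2 y z) 1 (fun t : R => ln (t + a) - 2 * a / (t + a))
    (p1 (dist2 y z)).
  have z0 := q0 z; rewrite /p1; move: (dist2 y z) z0 => t t0.
  have D : is_derive t 1 (fun t : R => t + a) 1 by exact: is_derive_shift.
  have Dl : is_derive t 1 (fun t : R => ln (t + a)) (1 / (t + a)).
    exact: (@sder_ln _ _ (fun t => t + a) t 1 1 t0 D).
  have t1 : t + a != 0 by rewrite gt_eqF.
  apply: sder_eq (sderD Dl (sderN (sderM (sderC (2 * a) t 1) (@sderV _ _ (fun t : R => t + a) t 1 1 t1 D)))) _.
  by field.
have H2 z : is_derive (dist2 y z) 1 p1 (p2 (dist2 y z)).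
  have z0 := q0 z; rewrite /p1 /p2; move: (dist2 y z) z0 => t t0.
  have D : is_derive t 1 (fun t : R => t + a) 1 by exact: is_derive_shift.
  have t1 : t + a != 0 by rewrite gt_eqF.
  have t2 : (t + a) ^+ 2 != 0 by rewrite expf_neq0.
  apply: sder_eq (sderD (@sderV _ _ (fun t : R => t + a) t 1 1 t1 D) (sderM (sderC (2 * a) t 1)
    (@sderV _ _ (fun t : R => (t + a) ^+ 2) t 1 _ t2 (@sderX _ _ (fun t : R => t + a) 2 t 1 1 D)))) _.
  by rewrite /=; field.
have [Eq Gq] := dist2_ell y x.
(* By [dist2_ell] the value is [4 J (p1 q + q p2 q)] with J the conformal factor and q the squared
   distance, and [p1 q + q p2 q = a (3 a - q) / (q + a) ^ 3]. *)
have -> : ell A B C (barrier y a) x =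
    - (4 * grad_prod A B C xi xi x * (a * (dist2 y x - 3 * a) / (dist2 y x + a) ^+ 3)).
  have -> := ell_comp A B C x (smooth_dist2 y) H1 H2.
  rewrite Eq Gq; have := q0 x; rewrite /p1 /p2.
  move: (grad_prod _ _ _ _ _ _) (dist2 y x) => J q qa.
  by field; rewrite gt_eqF.
rewrite oppr_lt0 mulr_gt0 ?mulr_gt0 ?J_gt0 ?invr_gt0 ?exprn_gt0 //.
by rewrite subr_gt0.
Qed.

Lemma ell_comb u w (e : R) x : smooth u -> smooth w ->
  ell A B C (fun y => u y + e * w y) x = ell A B C u x + e * ell A B C w x.
Proof.
move=> Su Sw.
have E i v1 v2 : smooth v1 -> smooth v2 -> partial i (fun y => v1 y + e * v2 y) =
    fun y => partial i v1 y + e * partial i v2 y.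
  move=> S1 S2; apply: partial_eq => y; der.
  by rewrite mulr0 addr0.
rewrite /ell !E //; try exact: smooth_partial.
move: (partial 0 (partial 0 u) x) (partial 0 (partial 1 u) x) (partial 1 (partial 1 u) x).
move: (partial 0 (partial 0 w) x) (partial 0 (partial 1 w) x) (partial 1 (partial 1 w) x).
by move=> *; ring.
Qed.

(** If [u x1 < u x0], then [u] stays above [u x1] by a margin on a small square around [x0]. On an
    annulus around this square, [u] plus a small multiple of the barrier is a strict supersolution
    which is larger on both boundary squares than at [x1]: inside by the margin, outside by the
    growth of the barrier and the lower bound [m]. This contradicts [annulus_min]. *)
Lemma liouville u (m : R) : smooth u -> (forall x, ell A B C u x <= 0) ->
  (forall x, m <= u x) -> forall x y, u x = u y.
Proof.
move=> Su Lu um.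
suff H x0 x1 : u x0 <= u x1 by move=> x y; apply/eqP; rewrite eq_le !H.
rewrite leNgt; apply/negP => u10.
pose dl := (u x0 - u x1) / 2.
have dl0 : 0 < dl by rewrite divr_gt0 // subr_gt0.
have [r0 r00 Hr0] := continuous_planeP (@smooth_cont _ _ Su x0) dl0.
pose r := r0 / 2.
have r_gt0 : 0 < r by rewrite divr_gt0.
have ur x : supdist x x0 <= r -> u x1 + dl < u x.
  have rr : r < r0 by rewrite /r; lra.
  rewrite /supdist ge_max => /andP[h1 h2].
  have := Hr0 x (le_lt_trans h1 rr) (le_lt_trans h2 rr).
  by rewrite ltr_norml /dl => /andP[] +  _; move: (u x) (u x0) (u x1) => ? ? ?; lra.
have x1r : r < supdist x1 x0.
  rewrite ltNge; by apply/negP => /ur; rewrite gtrDl ltNge (ltW dl0).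
(* With this value [3 a < r ^ 2], so the barrier is strict on the whole exterior of the inner
   square. *)
pose a := r ^+ 2 / 4.
have a0 : 0 < a by rewrite divr_gt0 // exprn_gt0.
pose b := barrier x0 a.
have bm x : ln a - 2 <= b x.
  apply: le_trans (barrier_ge _ _ a0); rewrite lerD2r.
  by rewrite ler_ln ?posrE // ?ltr_wpDl ?sqr_ge0 // lerDr sqr_ge0.
(* As [ln a - 2] is a lower bound of the barrier, [e] times its possible drop below [b x1] stays
   under the margin [dl]. *)
pose e := dl / (b x1 - (ln a - 2) + 1).
have bd : 0 < b x1 - (ln a - 2) + 1 by rewrite ltr_wpDl // subr_ge0.
have e0 : 0 < e by rewrite divr_gt0.
have edl : e * (b x1 - (ln a - 2)) < dl.
  rewrite /e mulrAC ltr_pdivrMr // ltr_pM2l //.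
  by move: (b x1) (ln a) => ? ?; lra.
(* Where the barrier is at least [T - 2], the sum is at least [m + e (T - 2)], which exceeds its
   value at [x1] by [e]. The radius [s] gets there because [s >= 1] gives [s ^ 2 >= s >= expR T]. *)
pose T := (u x1 + e * b x1 - m) / e + 2 + 1.
pose s := Num.max (supdist x1 x0) (Num.max (expR T) 1).
have s1 : 1 <= s by rewrite !le_max lexx !orbT.
have sT : T <= ln (s ^+ 2 + a).
  rewrite -ler_expR lnK ?posrE ?ltr_wpDl ?sqr_ge0 //.
  have : expR T <= s by rewrite !le_max lexx orbT.
  by move: s1 a0; rewrite expr2; move: (expR T) => t h1 h2 h3; nra.
pose v x := u x + e * b x.
have Sb : smooth b by exact: smooth_barrier.
have Sv : smooth v by rewrite /v; smo.
have K1 : r <= supdist x1 x0 <= s by rewrite (ltW x1r) /s le_max lexx.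
have [|z [zb]] := annulus_min Sv _ K1.
  move=> x rx; rewrite /v ell_comb // -[X in _ < X]addr0; apply: ler_ltD => //.
  rewrite pmulr_rlt0 //; apply: ell_barrier => //.
  apply: lt_le_trans (supdist_dist2 _ _).
  have : r ^+ 2 <= supdist x x0 ^+ 2 by rewrite ler_sqr ?nnegrE // ?(le_trans (ltW r_gt0)).
  by apply: lt_le_trans; rewrite /a; have : 0 < r ^+ 2 by [rewrite exprn_gt0]; move: (r ^+ 2) => t t0; lra.
apply/negP; rewrite -ltNge; case: zb => [zr|sE].
  have := ur z; rewrite zr lexx => /(_ isT).
  have := bm z; have := edl; have := e0; rewrite /v.
  by move: (u z) (u x1) (b z) (b x1) (ln a) => uz u1 bz b1 la h1 h2 h3 h4; nra.
have : T - 2 <= b z.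
  by apply: le_trans (barrier_ge x0 z a0); rewrite sE lerD2r.
have := um z; rewrite /v /T.
have : (u x1 + e * b x1 - m) / e * e = u x1 + e * b x1 - m by rewrite divfK // gt_eqF.
move: ((u x1 + e * b x1 - m) / e) => k; move: e0.
by move: (u z) (u x1) (b z) (b x1) => uz u1 bz b1 h1 h2 h3 h4; nra.
Qed.

End Liouville.

(** * Jorgens' theorem *)

(* A symmetric matrix field with rows (A, B), (B, C), determinant 1 and
   curl-free rows is a Hessian with Monge-Ampere determinant 1; its constancy is
   Jorgens' theorem. *)
Section Codazzi.
Variable R : realType.
Variables A B C : R * R -> R.
Hypotheses (SA : smooth A) (SB : smooth B) (SC : smooth C).
Hypothesis A_gt0 : forall x, 0 < A x.
Hypothesis det1 : forall x, A x * C x - B x ^+ 2 = 1.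
Hypothesis AB : forall x, partial 1 A x = partial 0 B x.
Hypothesis BC : forall x, partial 1 B x = partial 0 C x.

Lemma codazzi_C_gt0 x : 0 < C x.
Proof.
have := det1 x; have := sqr_ge0 (B x); rewrite -(pmulr_rgt0 _ (A_gt0 x)).
by move: (A x * C x) => ac; lra.
Qed.

Lemma codazzi_det_der i x :
  partial i A x * C x + A x * partial i C x = 2 * B x * partial i B x.
Proof.
have E : partial i (fun y => A y * C y - B y ^+ 2) = fun=> 0.
  by apply: partial_eq => y; rewrite (funext det1); exact: sderC.
have : partial i (fun y => A y * C y - B y ^+ 2) x =
    partial i A x * C x + A x * partial i C x - 2 * B x * partial i B x.
  have -> // : partial i (fun y => A y * C y - B y ^+ 2) = fun x =>
    partial i A x * C x + A x * partial i C x - 2 * B x * partial i B x.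
  by apply: partial_eq => y; der; rewrite /=; ring.
by rewrite E => /esym/eqP; rewrite subr_eq0 => /eqP.
Qed.

Lemma codazzi_quadratic_ge0 x (v1 v2 : R) :
  0 <= A x * v1 ^+ 2 + 2 * B x * v1 * v2 + C x * v2 ^+ 2.
Proof.
rewrite -(pmulr_rge0 _ (A_gt0 x)).
have -> : A x * (A x * v1 ^+ 2 + 2 * B x * v1 * v2 + C x * v2 ^+ 2) =
  (A x * v1 + B x * v2) ^+ 2 + (A x * C x - B x ^+ 2) * v2 ^+ 2 by ring.
by rewrite det1 mul1r addr_ge0 // sqr_ge0.
Qed.

(* The isothermal coordinates are the gradient of |x|^2/2 + Phi, where Phi is a
   potential of the Hessian: this map does not contract distances. *)
Lemma liouville_codazzi u (m : R) : smooth u -> (forall x, ell A B C u x <= 0) ->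
  (forall x, m <= u x) -> forall x y, u x = u y.
Proof.
move=> Su Lu um.
have SA1 : smooth (fun x => 1 + A x) by smo.
have SC1 : smooth (fun x => 1 + C x) by smo.
have EA i : partial i (fun x => 1 + A x) = partial i A.
  by apply: partial_eq => y; der; rewrite add0r.
have EC i : partial i (fun x => 1 + C x) = partial i C.
  by apply: partial_eq => y; der; rewrite add0r.
have [|xi [Sxi /funext xi0 /funext xi1]] := poincare SA1 SB.
  by move=> x; rewrite EA.
have [|eta [Seta /funext eta0 /funext eta1]] := poincare SB SC1.
  by move=> x; rewrite EC.
apply: (@liouville R A B C _ _ xi eta _ _ _ _ _ _ _ _ u m) => //.
(* By the curl-free equations, [ell xi] and [ell eta] are the two partial derivatives of the
   determinant, which is constant. *)
- move=> x; rewrite /ell xi0 xi1 EA.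
  have := codazzi_det_der 0 x; rewrite BC.
  by move: (partial 0 A x) (partial 0 B x) (partial 0 C x) => a b c; lra.
- move=> x; rewrite /ell eta0 eta1 EC EC.
  have := codazzi_det_der 1 x; rewrite AB BC.
  by move: (partial 0 B x) (partial 0 C x) (partial 1 C x) => a b c; lra.
- move=> x; rewrite /grad_prod xi0 xi1 eta0 eta1; have := det1 x.
  move: (A x) (B x) (C x) => a b c H.
  have Hc : a * c = 1 + b ^+ 2 by lra.
  have Ha : a * (a * c) = a * (1 + b ^+ 2) by rewrite Hc.
  have Hc2 : c * (a * c) = c * (1 + b ^+ 2) by rewrite Hc.
  by nra.
- move=> x; rewrite /grad_prod xi0 xi1 eta0 eta1; have := det1 x.
  move: (A x) (B x) (C x) => a b c H.
  have Hb : b * (a * c - b ^+ 2) = b by rewrite H mulr1.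
  by nra.
- move=> x; rewrite /grad_prod xi0 xi1; have := det1 x.
  have := A_gt0 x; have := codazzi_C_gt0 x.
  move: (A x) (B x) (C x) => a b c c0 a0 H.
  have -> : c * ((1 + a) * (1 + a)) - b * ((1 + a) * b + b * (1 + a)) + a * (b * b)
    = c + 2 * (a * c - b ^+ 2) + a * (a * c - b ^+ 2) by ring.
  by rewrite H; lra.
(* Along the segment from [y] to [x], the product of [v = x - y] with [(xi, eta)] has derivative
   [|v| ^ 2] plus a nonnegative quadratic form. So the increment of [(xi, eta)] has product at least
   [|v| ^ 2] with [v], and its length is at least [|v|]. *)
- move=> x y; set v1 := x.1 - y.1; set v2 := x.2 - y.2.
  pose v : R * R := (v1, v2).
  pose Q z := v1 ^+ 2 + v2 ^+ 2 + (A z * v1 ^+ 2 + 2 * B z * v1 * v2 + C z * v2 ^+ 2).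
  have dir w z : smooth w ->
      is_derive z v w (v1 * partial 0 w z + v2 * partial 1 w z).
    move=> Sw; apply: (@is_derive_dir R w (partial 0 w) (partial 1 w) z v).
    - by move=> t; exact: smooth_der.
    - by move=> t; exact: smooth_der.
    - by apply: smooth_cont; exact: smooth_partial.
    - by apply: smooth_cont; exact: smooth_partial.
  have [t|c _] := @mvt R (fun t => v1 * xi (t *: v + y) + v2 * eta (t *: v + y))
    (fun t => Q (t *: v + y)) 0 1.
    apply: (@is_derive_along _ _ (fun z => v1 * xi z + v2 * eta z) y v).
    apply: sder_eq; first by apply: sderD; apply: sderM; first [exact: sderC | exact: dir].
    rewrite xi0 xi1 eta0 eta1 /Q; move: (t *: v + y) => z; ring.
  rewrite scale1r scale0r add0r subr0 mulr1.
  have -> : v + y = x by apply: injective_projections; rewrite /= subrK.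
  have := codazzi_quadratic_ge0 (c *: v + y) v1 v2; rewrite /Q.
  move: (A _ * _ + _ + _) => q q0 E.
  have := sqr_ge0 (xi x - xi y - v1); have := sqr_ge0 (eta x - eta y - v2).
  by move: E; move: (xi x) (xi y) (eta x) (eta y) => ? ? ? ? E s1 s2; nra.
Qed.

(** [P] and [Q] are, up to the sign of [P], the real and imaginary parts of the Beltrami coefficient
    [(A - C + 2 i B) / (A + C + 2)]. The system [key] says that they are conjugate for the operator,
    and [P > -1], so Liouville's theorem applies. *)
Lemma codazzi_cst : exists a b c : R,
  [/\ forall x, A x = a, forall x, B x = b & forall x, C x = c].
Proof.
pose S x := 2 + A x + C x.
have S0 x : 0 < S x by rewrite /S; have := A_gt0 x; have := codazzi_C_gt0 x; move: (A x) (C x) => ? ?; lra.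
pose P x := (C x - A x) / S x.
pose Q x := 2 * B x / S x.
have S_neq0 x : S x != 0 by rewrite gt_eqF.
have SP : smooth P by rewrite /P /S; smo.
have SQ : smooth Q by rewrite /Q /S; smo.
have EP i : partial i P = fun x => ((partial i C x - partial i A x) * S x -
    (C x - A x) * (partial i A x + partial i C x)) / S x ^+ 2.
  apply: partial_eq => x; rewrite /P /S; der; first exact: S_neq0.
  by field; exact: S_neq0.
have EQ i : partial i Q = fun x => (2 * partial i B x * S x -
    2 * B x * (partial i A x + partial i C x)) / S x ^+ 2.
  apply: partial_eq => x; rewrite /Q /S; der; first exact: S_neq0.
  by field; exact: S_neq0.
have key x : partial 0 Q x = B x * partial 0 P x - A x * partial 1 P x /\
    partial 1 Q x = C x * partial 0 P x - B x * partial 1 P x.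
  rewrite !EP !EQ AB BC /S.
  have := codazzi_det_der 0 x; have := codazzi_det_der 1 x; rewrite AB BC.
  have := A_gt0 x; have := codazzi_C_gt0 x; have := det1 x.
  move: (partial 0 A x) (partial 0 B x) (partial 0 C x) (partial 1 C x).
  move: (A x) (B x) (C x) => a b c a1 b1 c1 c2 H c0 a0 H1 H0.
  have b2 : 0 < 1 + b ^+ 2 by have := sqr_ge0 b; lra.
  have Ec : c = (1 + b ^+ 2) / a by rewrite (_ : 1 + b ^+ 2 = c * a) ?mulfK ?gt_eqF //; lra.
  have Ea1 : a1 = (2 * b * b1 - a * c1) / c by rewrite -H0 addrK mulfK // gt_eqF.
  have Ec2 : c2 = (2 * b * c1 - b1 * c) / a by rewrite -H1 addrAC subrr add0r mulrC mulKf // gt_eqF.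
  have s0 : 2 + a + c != 0 by rewrite gt_eqF //; lra.
  have N (n1 n2 n3 t1 t2 s : R) : s != 0 -> n1 = t1 * n2 - t2 * n3 ->
      n1 / s = t1 * (n2 / s) - t2 * (n3 / s) by move=> ? ->; field.
  have s2 : (2 + a + c) ^+ 2 != 0 by rewrite expf_neq0.
  by split; apply: (N) => //; rewrite Ec2 Ea1 Ec; field; rewrite ?gt_eqF.
have EQ0 : partial 0 Q = fun x => B x * partial 0 P x - A x * partial 1 P x.
  by apply/funext => x; have [] := key x.
have EQ1 : partial 1 Q = fun x => C x * partial 0 P x - B x * partial 1 P x.
  by apply/funext => x; have [] := key x.
(* This is the equality of the mixed derivatives of [Q]; the first-order terms cancel by the
   curl-free equations. *)
have LP x : ell A B C P x = 0.
  have D0 : partial 0 (partial 1 Q) = fun x => C x * partial 0 (partial 0 P) x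
      + partial 0 C x * partial 0 P x - B x * partial 0 (partial 1 P) x - partial 0 B x * partial 1 P x.
    by rewrite EQ1; apply: partial_eq => y; der; ring.
  have D1 : partial 1 (partial 0 Q) = fun x => B x * partial 1 (partial 0 P) x
      + partial 1 B x * partial 0 P x - A x * partial 1 (partial 1 P) x - partial 1 A x * partial 1 P x.
    by rewrite EQ0; apply: partial_eq => y; der; ring.
  have := congr1 (fun F => F x) (partialC 0 1 SQ).
  rewrite /= D0 D1 (partialC 1 0 SP) AB BC /ell.
  move: (partial 0 (partial 0 P) x) (partial 0 (partial 1 P) x) (partial 1 (partial 1 P) x).
  by move=> p q r; lra.
have PS x : P x * S x = C x - A x by rewrite divfK.
have QS x : Q x * S x = 2 * B x by rewrite divfK.
have Pcst x y : P x = P y.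
  apply: (@liouville_codazzi P (-1)) => // [z|z]; first by rewrite LP.
  rewrite /P ler_pdivlMr // /S; have := A_gt0 z; have := codazzi_C_gt0 z.
  by move: (A z) (C z) => ? ?; lra.
have dP i x : partial i P x = 0.
  have -> // : partial i P = fun=> 0.
  by apply: partial_eq => y; rewrite (_ : P = fun=> P y); [exact: sderC|apply/funext => z].
have Qcst x y : Q x = Q y.
  apply: (@liouville_codazzi Q (-1)) => // [z|z].
    have E i : partial i Q = fun=> 0.
      by apply/funext => t; case: (ord2P i) => ->; rewrite ?EQ0 ?EQ1 !dP !mulr0 subrr.
    have E2 i : partial i (fun=> 0) = (fun=> 0 : R) by apply: partial_eq => t; exact: sderC.
    by rewrite /ell !E !E2 !mulr0 subrr addr0.
  rewrite /Q ler_pdivlMr // /S.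
  have := A_gt0 z; have := codazzi_C_gt0 z; have := det1 z.
  move: (A z) (B z) (C z) => a b c H c0 a0.
  suff : 0 < a * (a + 2 * b + c) by rewrite pmulr_rgt0 //; lra.
  have -> : a * (a + 2 * b + c) = (a + b) ^+ 2 + (a * c - b ^+ 2) by ring.
  by rewrite H ltr_wpDl // sqr_ge0.
have Scst x y : S x = S y.
  (* With determinant 1, [(C - A) ^ 2 + 4 B ^ 2 = (S - 2) ^ 2 - 4 = S (S - 4)], so that [P] and [Q]
     determine [S], and then the matrix. *)
  have K z : (S z - 4) * S z = (P z ^+ 2 + Q z ^+ 2) * S z * S z.
    have -> : (P z ^+ 2 + Q z ^+ 2) * S z * S z = (P z * S z) ^+ 2 + (Q z * S z) ^+ 2 by ring.
    rewrite PS QS /S; have := det1 z; move: (A z) (B z) (C z) => a b c H.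
    by lra.
  have K2 z : S z * (1 - (P z ^+ 2 + Q z ^+ 2)) = 4.
    have := K z => /(mulIf (S_neq0 z)); move: (P z ^+ 2 + Q z ^+ 2) (S z) => m s; lra.
  have m0 : 1 - (P x ^+ 2 + Q x ^+ 2) != 0.
    by apply/eqP => m0; have := K2 x; rewrite m0 mulr0; lra.
  apply: (mulIf m0); rewrite K2 (Pcst x y) (Qcst x y) K2 //.
exists (A 0), (B 0), (C 0).
have CA x : C x - A x = C 0 - A 0 by rewrite -!PS (Pcst x 0) (Scst x 0).
have CA2 x : C x + A x = C 0 + A 0.
  by have := Scst x 0; rewrite /S; move: (A x) (C x) (A 0) (C 0) => *; lra.
split=> x.
- by have := CA x; have := CA2 x; move: (A x) (C x) (A 0) (C 0) => *; lra.
- have : 2 * B x = 2 * B 0 by rewrite -!QS (Qcst x 0) (Scst x 0).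
  by move: (B x) (B 0) => *; lra.
- by have := CA x; have := CA2 x; move: (A x) (C x) (A 0) (C 0) => *; lra.
Qed.

End Codazzi.

(** * The metric of the graph in null coordinates *)

Section Matrix2.
Variable F : fieldType.

Lemma det2 (M : 'M[F]_2) : \det M = M 0 0 * M 1 1 - M 0 1 * M 1 0.
Proof.
rewrite (expand_det_row _ 0) !big_ord_recl big_ord0 addr0 /cofactor !det_mx11.
rewrite !mxE /= !expr0 expr1 mul1r mulN1r mulrN.
have -> : lift (lift ord0 ord0) 0 = 0 :> 'I_2 by apply: val_inj.
by have -> : lift 0 (0 : 'I_1) = 1 :> 'I_2 by apply: val_inj.
Qed.

Lemma invmx2 (M : 'M[F]_2) (k l : 'I_2) : \det M != 0 ->
  invmx M k l = (if k == l then (if k == 0 then M 1 1 else M 0 0) else - M k l) / \det M.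
Proof.
move=> d0.
have uM : M \in unitmx by rewrite unitmxE unitfE.
pose N : 'M[F]_2 := \matrix_(k, l) ((if k == l then (if k == 0 then M 1 1 else M 0 0) else - M k l) / \det M).
suff MN : M *m N = 1%:M.
  have -> : invmx M = N by rewrite -[N](mulKmx uM) MN mulmx1.
  by rewrite mxE.
have dE := det2 M.
apply/matrixP => i j; rewrite !mxE !big_ord_recl big_ord0 addr0 !mxE.
have -> : lift ord0 ord0 = 1 :> 'I_2 by apply: val_inj.
case: (ord2P i) => ->; case: (ord2P j) => -> /=; rewrite ?mulr1n ?mulr0n.
all: by rewrite dE in d0 *; field.
Qed.

Lemma trace_invmx2 (G : 'M[F]_2) (V : 'I_2 -> 'I_2 -> F) : \det G != 0 ->
  G 1 0 = G 0 1 -> V 1 0 = V 0 1 ->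
  \sum_(i < 2) \sum_(j < 2) invmx G i j * V i j = 0 ->
  G 1 1 * V 0 0 - 2 * G 0 1 * V 0 1 + G 0 0 * V 1 1 = 0.
Proof.
move=> d0 GS VS; rewrite !big_ord_recl !big_ord0 !addr0.
have -> : lift ord0 ord0 = 1 :> 'I_2 by apply: val_inj.
change (ord0 : 'I_2) with (0 : 'I_2).
rewrite !invmx2 //= GS VS => H.
by apply: (mulIf (invr_neq0 d0)); rewrite mul0r -[RHS]H; ring.
Qed.

End Matrix2.

(** * The stationarity equation in coordinates *)

Section SmoothVector.
Variables (R : realType) (m : nat).
Implicit Types (F : R * R -> 'rV[R]_m).

Lemma pderiv_coord F i j x : derivable F x (axis R i) ->
  pderiv i (fun y => F y 0 j) x = pderiv i F x 0 j.
Proof. by move=> dF; rewrite /pderiv derive_mx // mxE. Qed.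

Lemma Cn_coord n F j : Cn n F -> Cn n (fun x => F x 0 j).
Proof.
elim: n F => [|n IH] F [cF H].
  by split=> // x; exact: (continuous_comp (cF x) (@coord_continuous _ _ _ 0 j (F x))).
split=> [x|i].
  exact: (continuous_comp (cF x) (@coord_continuous _ _ _ 0 j (F x))).
have [dF CF] := H i; split=> [x|]; first by have /derivable_mxP := dF x; apply.
rewrite (_ : pderiv i _ = fun x => pderiv i F x 0 j); first exact: IH.
by apply/funext => x; exact: pderiv_coord.
Qed.

Lemma smooth_coord F j : smooth F -> smooth (fun x => F x 0 j).
Proof. by move=> SF n; exact: Cn_coord. Qed.

Lemma smooth_derivable F i x : smooth F -> derivable F x (axis R i).
Proof. by move=> /(_ 1%N) [_ /(_ i) [dF _]]. Qed.

Lemma smooth_pderivV F i : smooth F -> smooth (pderiv i F).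
Proof. by move=> SF n; have [_ /(_ i) []] := SF n.+1. Qed.

Lemma partial_coord F i j x : smooth F ->
  partial i (fun y => F y 0 j) x = pderiv i F x 0 j.
Proof. by move=> SF; rewrite partialE pderiv_coord //; exact: smooth_derivable. Qed.

Lemma pderiv2_graph_pt F i j x : smooth F ->
  pderiv i (pderiv j (graph_pt F)) x = row_mx 0 (pderiv i (pderiv j F) x).
Proof.
move=> SF.
have -> : pderiv j (graph_pt F) = fun x => row_mx (\row_k (j == k)%:R) (pderiv j F x).
  by apply/funext => y; apply: pderiv_graph_pt; exact: smooth_derivable.
have E a : (fun y => (row_mx (\row_k (j == k)%:R) (pderiv j F y) : 'rV[R]_(2 + m)) 0 a) =
    match fintype.split a with
    | inl k => fun=> (j == k)%:R
    | inr k => fun y => pderiv j F y 0 k end.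
  by apply/funext => y; rewrite mxE; case: fintype.split => // k; rewrite mxE.
have SD := smooth_pderivV j SF.
have D : derivable (fun y => row_mx (\row_k (j == k)%:R) (pderiv j F y) : 'rV[R]_(2 + m))
    x (axis R i).
  apply/derivable_mxP => r a; rewrite ord1 E; case: fintype.split => k.
    exact: (@ex_derive _ _ _ _ _ _ _ (sderC _ x (axis R i))).
  by have /derivable_mxP := @smooth_derivable _ i x SD; apply.
rewrite {1}/pderiv derive_mx //; apply/rowP => a; rewrite mxE E [RHS]mxE.
case: fintype.split => k.
  by rewrite mxE; exact: (@derive_val _ _ _ _ _ _ _ (sderC _ x (axis R i))).
by rewrite -(pderiv_coord k (@smooth_derivable _ i x SD)).
Qed.

End SmoothVector.

(* The first two coordinates of the tangential correction are its coefficients,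
   so that they vanish. *)
Lemma normal_trace_eq0 (R : comNzRingType) (m : nat) (H : 'I_2 -> 'I_2 -> R)
    (c : 'I_2 -> 'I_2 -> 'I_2 -> 'I_2 -> R) (V : 'I_2 -> 'I_2 -> 'rV[R]_m)
    (P : 'I_2 -> 'rV[R]_m) :
  \sum_(i < 2) \sum_(j < 2) H i j *: (row_mx 0 (V i j)
    - \sum_(k < 2) \sum_(l < 2) c i j k l *: row_mx (\row_(a < 2) (k == a)%:R) (P k)) = 0 ->
  forall a, \sum_(i < 2) \sum_(j < 2) H i j * V i j 0 a = 0.
Proof.
move=> /rowP E.
pose d k := \sum_(i < 2) \sum_(j < 2) H i j * \sum_(l < 2) c i j k l.
have S (v : 'I_(2 + m)) (w : 'I_2 -> 'I_2 -> R) (q : 'I_2 -> R) :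
    (forall i j, (row_mx 0 (V i j) : 'rV_(2 + m)) 0 v = w i j) ->
    (forall k, (row_mx (\row_(a < 2) (k == a)%:R) (P k) : 'rV_(2 + m)) 0 v = q k) ->
    \sum_(i < 2) \sum_(j < 2) H i j * w i j = d 0 * q 0 + d 1 * q 1.
  move=> wE qE.
  have T i j : (H i j *: (row_mx 0 (V i j) - \sum_(k < 2) \sum_(l < 2) c i j k l *:
      row_mx (\row_(a < 2) (k == a)%:R) (P k)) : 'rV_(2 + m)) 0 v = H i j *
      (w i j - \sum_(k < 2) (\sum_(l < 2) c i j k l) * q k).
    rewrite mxE; congr (_ * _); rewrite mxE wE mxE; congr (_ - _).
    rewrite summxE; apply: eq_bigr => k _; rewrite summxE mulr_suml.
    by apply: eq_bigr => l _; rewrite mxE qE.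
  have := E v; rewrite summxE [RHS]mxE.
  under eq_bigr => i _ do rewrite summxE (eq_bigr _ (fun j _ => T i j)).
  rewrite /d !big_ord_recl !big_ord0.
  have -> : lift ord0 ord0 = 1 :> 'I_2 by apply: val_inj.
  change (ord0 : 'I_2) with (0 : 'I_2) => H0.
  by apply/eqP; rewrite -subr_eq0 -[X in _ == X]H0; apply/eqP; ring.
have d0 k : d k = 0.
  have := S (lshift m k) (fun _ _ => 0) (fun k' => (k' == k)%:R).
  rewrite big1 => [/(_ _ _)|i _]; last by rewrite big1 // => j _; rewrite mulr0.
  move=> /(_ _ _)/esym; rewrite (_ : d 0 * (0 == k)%:R + d 1 * (1 == k)%:R = d k).
    by apply=> [i j|k']; rewrite row_mxEl !mxE.
  by case: (ord2P k) => -> /=; ring.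
move=> a; rewrite (S (rshift 2 a) (fun i j => V i j 0 a) (fun k => P k 0 a)).
- by rewrite !d0 !mul0r addr0.
- by move=> i j; rewrite row_mxEr.
- by move=> k; rewrite row_mxEr.
Qed.

Section NullCoordinates.
Variables (R : realType) (f : R * R -> 'rV[R]_2).
Hypothesis Sf : smooth f.

Definition null_minus (x : R * R) : R := f x 0 0 - f x 0 1.
Definition null_plus (x : R * R) : R := f x 0 0 + f x 0 1.

Local Notation s := null_minus.
Local Notation t := null_plus.

Lemma smooth_null_minus : smooth s.
Proof. by apply: smoothD; [|apply: smoothN]; exact: smooth_coord. Qed.

Lemma smooth_null_plus : smooth t.
Proof. by apply: smoothD; exact: smooth_coord. Qed.

Lemma partial_null_minus i : partial i s = fun x => pderiv i f x 0 0 - pderiv i f x 0 1.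
Proof.
have S0 := smooth_coord 0 Sf; have S1 := smooth_coord 1 Sf.
apply: partial_eq => x; rewrite /s -!partial_coord //.
by apply: sderD; [|apply: sderN]; exact: smooth_der.
Qed.

Lemma partial_null_plus i : partial i t = fun x => pderiv i f x 0 0 + pderiv i f x 0 1.
Proof.
have S0 := smooth_coord 0 Sf; have S1 := smooth_coord 1 Sf.
apply: partial_eq => x; rewrite /t -!partial_coord //.
by apply: sderD; exact: smooth_der.
Qed.

Lemma graph_metric_null x i j : graph_metric f x i j =
  (i == j)%:R + (partial i s x * partial j t x + partial i t x * partial j s x) / 2.
Proof.
rewrite mxE; congr (_ + _); rewrite !partial_null_minus !partial_null_plus.
rewrite /mink !big_ord_recl big_ord0 addr0 /=.
have -> : lift ord0 ord0 = 1 :> 'I_2 by apply: val_inj.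
move: (pderiv i f x) (pderiv j f x) => u v.
by field.
Qed.

Lemma graph_metric_sym x : graph_metric f x 1 0 = graph_metric f x 0 1.
Proof. by rewrite !graph_metric_null /=; congr (_ + _); ring. Qed.

Hypothesis space : spacelike f.

Lemma spacelike00 x : 0 < graph_metric f x 0 0.
Proof.
have : forall u : 'rV[R]_2, u != 0 ->
    0 < \sum_(i < 2) \sum_(j < 2) graph_metric f x i j * u 0 i * u 0 j by exact: space.
move: (graph_metric f x) => G H.
have u0 : (\row_i (i == 0)%:R : 'rV[R]_2) != 0.
  by apply/eqP => /rowP /(_ 0); rewrite !mxE => /eqP; rewrite oner_eq0.
have := H _ u0; rewrite !big_ord_recl !big_ord0 !mxE /=.
by rewrite !mulr1 !mulr0 !addr0.
Qed.

Lemma spacelike_det x : 0 < \det (graph_metric f x).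
Proof.
have g0 := spacelike00 x; have gS := graph_metric_sym x.
have : forall u : 'rV[R]_2, u != 0 ->
    0 < \sum_(i < 2) \sum_(j < 2) graph_metric f x i j * u 0 i * u 0 j by exact: space.
move: (graph_metric f x) g0 gS => G g0 gS H.
(* The quadratic form at [(- G 0 1, G 0 0)] equals [G 0 0] times the determinant. *)
pose u : 'rV[R]_2 := \row_i (if i == 0 then - G 0 1 else G 0 0).
have u1 : u 0 1 = G 0 0 by rewrite mxE.
have u0 : u 0 0 = - G 0 1 by rewrite mxE.
have un : u != 0.
  by apply/eqP => uE; move: u1; rewrite uE mxE => g00; move: g0; rewrite -g00 ltxx.
have := H u un; rewrite !big_ord_recl !big_ord0.
have -> : lift ord0 ord0 = 1 :> 'I_2 by apply: val_inj.
change (ord0 : 'I_2) with (0 : 'I_2); rewrite u0 u1 det2 gS.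
move: (G 0 0) (G 0 1) (G 1 1) g0 => a b c a0 {}H.
by rewrite -(pmulr_rgt0 _ a0); move: H; lra.
Qed.

Hypothesis stat : stationary f.

(** Second derivatives of the graph point only have components in the last coordinates. By
    [normal_trace_eq0] the tangential correction drops out of the trace, and multiplying by the
    determinant clears the inverse matrix. *)
Lemma stationary_coord x j :
  graph_metric f x 1 1 * pderiv 0 (pderiv 0 f) x 0 j
  - 2 * graph_metric f x 0 1 * pderiv 0 (pderiv 1 f) x 0 j
  + graph_metric f x 0 0 * pderiv 1 (pderiv 1 f) x 0 j = 0.
Proof.
have d0 : \det (graph_metric f x) != 0 by rewrite gt_eqF // spacelike_det.
have E10 : pderiv 1 (pderiv 0 f) x 0 j = pderiv 0 (pderiv 1 f) x 0 j.
  have H i : (fun y => pderiv i f y 0 j) = partial i (fun y => f y 0 j).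
    by apply/funext => y; rewrite partial_coord.
  have K i i' : pderiv i (pderiv i' f) x 0 j = partial i (partial i' (fun y => f y 0 j)) x.
    by rewrite -H partial_coord //; exact: smooth_pderivV.
  apply: etrans (K 1 0) _; apply/esym; apply: etrans (K 0 1) _.
  by rewrite partialC //; exact: smooth_coord.
have E : \sum_(i < 2) \sum_(i' < 2) invmx (graph_metric f x) i i' *:
    normal_part f x (pderiv i (pderiv i' (graph_pt f)) x) = 0.
  have h0 : (2^-1 : R) != 0 by rewrite invr_eq0 pnatr_eq0.
  by apply: (scalerI h0); rewrite scaler0; exact: (stat x).
pose c i i' k l := invmx (graph_metric f x) k l *
  mink (pderiv i (pderiv i' (graph_pt f)) x) (pderiv l (graph_pt f) x).
have := @normal_trace_eq0 R 2 (fun i i' => invmx (graph_metric f x) i i') c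
   (fun i i' => pderiv i (pderiv i' f) x) (fun k => pderiv k f x).
have -> : \sum_(i < 2) \sum_(i' < 2) invmx (graph_metric f x) i i' *:
    (row_mx 0 (pderiv i (pderiv i' f) x) - \sum_(k < 2) \sum_(l < 2) c i i' k l *:
     row_mx (\row_(a < 2) (k == a)%:R) (pderiv k f x)) = 0.
  rewrite -[RHS]E; apply: eq_bigr => i _; apply: eq_bigr => i' _; rewrite /normal_part.
  congr (_ *: _); congr (_ - _); first by rewrite pderiv2_graph_pt.
  apply: eq_bigr => k _; apply: eq_bigr => l _; congr (_ *: _).
  exact (esym (pderiv_graph_pt (smooth_derivable Sf))).
move=> /(_ erefl j) T.
pose V i i' := pderiv i (pderiv i' f) x 0 j.
have E10' : V 1 0 = V 0 1 by exact E10.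
have T' : \sum_(i < 2) \sum_(i' < 2) invmx (graph_metric f x) i i' * V i i' = 0.
  exact T.
exact (trace_invmx2 d0 (graph_metric_sym x) E10' T').
Qed.

Lemma stationary_null u : u = s \/ u = t -> forall x,
  graph_metric f x 1 1 * partial 0 (partial 0 u) x
  - 2 * graph_metric f x 0 1 * partial 0 (partial 1 u) x
  + graph_metric f x 0 0 * partial 1 (partial 1 u) x = 0.
Proof.
have S0 := smooth_coord 0 Sf; have S1 := smooth_coord 1 Sf.
have K i i' j x : partial i (partial i' (fun y => f y 0 j)) x = pderiv i (pderiv i' f) x 0 j.
  rewrite -partial_coord; last exact: smooth_pderivV.
  by congr (partial i _ x); apply/funext => y; rewrite partial_coord.
have Km i i' x : partial i (partial i' s) x =
    pderiv i (pderiv i' f) x 0 0 - pderiv i (pderiv i' f) x 0 1.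
  have D i'' (v w : R * R -> R) : smooth v -> smooth w ->
      partial i'' (fun y => v y - w y) = fun y => partial i'' v y - partial i'' w y.
    by move=> Sv Sw; apply: partial_eq => y; der.
  by rewrite /s !D ?K //; exact: smooth_partial.
have Kp i i' x : partial i (partial i' t) x =
    pderiv i (pderiv i' f) x 0 0 + pderiv i (pderiv i' f) x 0 1.
  have D i'' (v w : R * R -> R) : smooth v -> smooth w ->
      partial i'' (fun y => v y + w y) = fun y => partial i'' v y + partial i'' w y.
    by move=> Sv Sw; apply: partial_eq => y; der.
  by rewrite /t !D ?K //; exact: smooth_partial.
move=> ust x; have E0 := stationary_coord x 0; have E1 := stationary_coord x 1.
have linB (a b c p0 q0 r0 p1 q1 r1 : R) : a * p0 - 2 * b * q0 + c * r0 = 0 ->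
    a * p1 - 2 * b * q1 + c * r1 = 0 ->
    a * (p0 - p1) - 2 * b * (q0 - q1) + c * (r0 - r1) = 0.
  by clear => H0 H1; lra.
have linD (a b c p0 q0 r0 p1 q1 r1 : R) : a * p0 - 2 * b * q0 + c * r0 = 0 ->
    a * p1 - 2 * b * q1 + c * r1 = 0 ->
    a * (p0 + p1) - 2 * b * (q0 + q1) + c * (r0 + r1) = 0.
  by clear => H0 H1; lra.
case: ust => ->.
  by rewrite (Km 0 0) (Km 0 1) (Km 1 1); exact (linB _ _ _ _ _ _ _ _ _ E0 E1).
by rewrite (Kp 0 0) (Kp 0 1) (Kp 1 1); exact (linD _ _ _ _ _ _ _ _ _ E0 E1).
Qed.

End NullCoordinates.

(* s = f_0 - f_1 and t = f_0 + f_1, so that g_ij = delta_ij + (s_i t_j + t_i s_j) / 2. *)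
Section StationaryPair.
Variable R : realType.
Variables s t : R * R -> R.
Hypotheses (Ss : smooth s) (St : smooth t).

Definition pair00 x : R := 1 + partial 0 s x * partial 0 t x.
Definition pair01 x : R := (partial 0 s x * partial 1 t x + partial 1 s x * partial 0 t x) / 2.
Definition pair11 x : R := 1 + partial 1 s x * partial 1 t x.
Definition pair_det x : R := pair00 x * pair11 x - pair01 x ^+ 2.
Definition pair_area x : R := Num.sqrt (pair_det x).

Hypothesis pos00 : forall x, 0 < pair00 x.
Hypothesis pos_det : forall x, 0 < pair_det x.
Hypothesis stat_s : forall x, ell pair00 pair01 pair11 s x = 0.
Hypothesis stat_t : forall x, ell pair00 pair01 pair11 t x = 0.

Lemma pair_area_gt0 x : 0 < pair_area x.
Proof. by rewrite sqrtr_gt0 pos_det. Qed.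

Lemma pair_areaK x : pair_area x ^+ 2 = pair_det x.
Proof. by rewrite sqr_sqrtr // ltW // pos_det. Qed.

Lemma smooth_pair00 : smooth pair00. Proof. by rewrite /pair00; smo. Qed.
Lemma smooth_pair01 : smooth pair01. Proof. by rewrite /pair01; smo. Qed.
Lemma smooth_pair11 : smooth pair11. Proof. by rewrite /pair11; smo. Qed.

Lemma smooth_pair_det : smooth pair_det.
Proof.
have := smooth_pair00; have := smooth_pair01; have := smooth_pair11.
by move=> *; rewrite /pair_det; smo.
Qed.

Lemma smooth_pair_area : smooth pair_area.
Proof.
by have Sd := smooth_pair_det; rewrite /pair_area; smo; exact: pos_det.
Qed.

(** The common denominator reduces the comparison of two such derivatives to a polynomial identity
    in the derivatives of [s] and [t]. *)
Lemma partial_normalized i (u : R * R -> R) x : smooth u -> partial i (fun y => u y / pair_area y) x =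
  (2 * partial i u x * pair_det x - u x * partial i pair_det x) / (2 * pair_area x ^+ 3).
Proof.
move=> Su; have Sd := smooth_pair_det.
have W0 := pair_area_gt0.
have EW : partial i pair_area = fun y => partial i pair_det y / (2 * pair_area y).
  by apply: partial_eq => y; rewrite /pair_area; der => //; exact: pos_det.
have SW := smooth_pair_area.
have -> : partial i (fun y => u y / pair_area y) = fun y =>
    partial i u y / pair_area y - u y * partial i pair_area y / pair_area y ^+ 2.
  apply: partial_eq => y; der; first by rewrite gt_eqF.
  by ring.
rewrite EW -pair_areaK; have := W0 x.
move: (pair_area x) (partial i u x) (u x) (partial i pair_det x) => w a b c w0.
by field; rewrite gt_eqF.
Qed.

Lemma partial_pair_det i x : partial i pair_det x =
  partial i pair00 x * pair11 x + pair00 x * partial i pair11 x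
  - 2 * pair01 x * partial i pair01 x.
Proof.
have S0 := smooth_pair00; have S1 := smooth_pair01; have S2 := smooth_pair11.
have -> // : partial i pair_det = fun x =>
  partial i pair00 x * pair11 x + pair00 x * partial i pair11 x
  - 2 * pair01 x * partial i pair01 x.
by apply: partial_eq => y; rewrite /pair_det; der; rewrite /=; ring.
Qed.

Lemma partial_pair00 i x : partial i pair00 x =
  partial i (partial 0 s) x * partial 0 t x + partial 0 s x * partial i (partial 0 t) x.
Proof.
have -> // : partial i pair00 = fun x =>
  partial i (partial 0 s) x * partial 0 t x + partial 0 s x * partial i (partial 0 t) x.
by apply: partial_eq => y; rewrite /pair00; der; ring.
Qed.

Lemma partial_pair01 i x : partial i pair01 x =
  (partial i (partial 0 s) x * partial 1 t x + partial 0 s x * partial i (partial 1 t) x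
  + partial i (partial 1 s) x * partial 0 t x + partial 1 s x * partial i (partial 0 t) x) / 2.
Proof.
have -> // : partial i pair01 = fun x =>
  (partial i (partial 0 s) x * partial 1 t x + partial 0 s x * partial i (partial 1 t) x
  + partial i (partial 1 s) x * partial 0 t x + partial 1 s x * partial i (partial 0 t) x) / 2.
by apply: partial_eq => y; rewrite /pair01; der; ring.
Qed.

Lemma partial_pair11 i x : partial i pair11 x =
  partial i (partial 1 s) x * partial 1 t x + partial 1 s x * partial i (partial 1 t) x.
Proof.
have -> // : partial i pair11 = fun x =>
  partial i (partial 1 s) x * partial 1 t x + partial 1 s x * partial i (partial 1 t) x.
by apply: partial_eq => y; rewrite /pair11; der; ring.
Qed.

(** Harmonicity of the coordinate x_2 on the graph in divergence form; [pair_codazzi11] is that of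
    x_1. The difference of the two sides is an explicit combination of the two stationarity
    equations. *)
Lemma pair_codazzi01 x :
  partial 1 (fun y => pair00 y / pair_area y) x = partial 0 (fun y => pair01 y / pair_area y) x.
Proof.
have S0 := smooth_pair00; have S1 := smooth_pair01.
rewrite !partial_normalized //; congr (_ / _).
have := stat_s x; have := stat_t x.
rewrite !partial_pair_det !partial_pair00 !partial_pair01 !partial_pair11 /ell.
rewrite (partialC 1 0 Ss) (partialC 1 0 St) /pair_det /pair00 /pair01 /pair11.
move: (partial 0 (partial 0 s) x) (partial 0 (partial 1 s) x) (partial 1 (partial 1 s) x).
move: (partial 0 (partial 0 t) x) (partial 0 (partial 1 t) x) (partial 1 (partial 1 t) x).
move: (partial 0 s x) (partial 1 s x) (partial 0 t x) (partial 1 t x).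
clear => p q P Q t00 t01 t11 s00 s01 s11 Et Es.
apply/eqP; rewrite -subr_eq0; apply/eqP.
set Et' := (X in X = 0) in Et; set Es' := (X in X = 0) in Es.
transitivity ((p * Q + q * P) / 2 * (p * Et' + P * Es') - (1 + p * P) * (q * Et' + Q * Es')).
  by rewrite /Et' /Es'; field.
by rewrite Et Es; ring.
Qed.

Lemma pair_codazzi11 x :
  partial 1 (fun y => pair01 y / pair_area y) x = partial 0 (fun y => pair11 y / pair_area y) x.
Proof.
have S0 := smooth_pair11; have S1 := smooth_pair01.
rewrite !partial_normalized //; congr (_ / _).
have := stat_s x; have := stat_t x.
rewrite !partial_pair_det !partial_pair00 !partial_pair01 !partial_pair11 /ell.
rewrite (partialC 1 0 Ss) (partialC 1 0 St) /pair_det /pair00 /pair01 /pair11.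
move: (partial 0 (partial 0 s) x) (partial 0 (partial 1 s) x) (partial 1 (partial 1 s) x).
move: (partial 0 (partial 0 t) x) (partial 0 (partial 1 t) x) (partial 1 (partial 1 t) x).
move: (partial 0 s x) (partial 1 s x) (partial 0 t x) (partial 1 t x).
clear => p q P Q t00 t01 t11 s00 s01 s11 Et Es.
apply/eqP; rewrite -subr_eq0; apply/eqP.
set Et' := (X in X = 0) in Et; set Es' := (X in X = 0) in Es.
transitivity ((1 + q * Q) * (p * Et' + P * Es') - (p * Q + q * P) / 2 * (q * Et' + Q * Es')).
  by rewrite /Et' /Es'; field.
by rewrite Et Es; ring.
Qed.

Lemma pair_conformal_cst : exists a b c : R, [/\ 0 < a, a * c - b ^+ 2 = 1 &
  forall x, [/\ pair00 x = pair_area x * a, pair01 x = pair_area x * b &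
    pair11 x = pair_area x * c]].
Proof.
have S0 := smooth_pair00; have S1 := smooth_pair01; have S2 := smooth_pair11.
have SW := smooth_pair_area.
have W0 x : pair_area x != 0 by rewrite gt_eqF // pair_area_gt0.
have [|||x|x|x|x|a [b [c [Ea Eb Ec]]]] := @codazzi_cst R (fun y => pair00 y / pair_area y)
  (fun y => pair01 y / pair_area y) (fun y => pair11 y / pair_area y).
- by smo; exact: W0.
- by smo; exact: W0.
- by smo; exact: W0.
- by rewrite divr_gt0 // pair_area_gt0.
- have := pair_areaK x; rewrite /pair_det.
  have := W0 x; move: (pair_area x) (pair00 x) (pair01 x) (pair11 x) => w u v z w0 E.
  transitivity ((u * z - v ^+ 2) / w ^+ 2); first by field.
  by rewrite -E divff // expf_neq0.
- exact: pair_codazzi01.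
- exact: pair_codazzi11.
exists a, b, c; split.
- by rewrite -(Ea 0) divr_gt0 // pair_area_gt0.
- rewrite -(Ea 0) -(Eb 0) -(Ec 0); have := pair_areaK 0; rewrite /pair_det.
  have := W0 0; move: (pair_area 0) (pair00 0) (pair01 0) (pair11 0) => w u v z w0 E.
  transitivity ((u * z - v ^+ 2) / w ^+ 2); first by field.
  by rewrite -E divff // expf_neq0.
- by move=> x; rewrite -(Ea x) -(Eb x) -(Ec x); split; rewrite mulrC divfK.
Qed.

End StationaryPair.

(** * Curvature of a metric in a constant conformal class *)

Section ConformalCurvature.
Variables (R : realType) (W : R * R -> R) (M : 'M[R]_2) (G : R * R -> 'M[R]_2).
Hypothesis SW : smooth W.
Hypothesis W_gt0 : forall x, 0 < W x.
Hypothesis M_sym : M 1 0 = M 0 1.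
Hypothesis M_det : M 0 0 * M 1 1 - M 0 1 ^+ 2 = 1.
Hypothesis M_gt0 : 0 < M 0 0.
Hypothesis GE : forall x i j, G x i j = W x * M i j.

Lemma conformal_det x : \det (G x) = W x ^+ 2.
Proof.
rewrite det2 !GE M_sym; have <- : W x ^+ 2 * (M 0 0 * M 1 1 - M 0 1 ^+ 2) = W x ^+ 2.
  by rewrite M_det mulr1.
by ring.
Qed.

Lemma conformal_area x : area_density G x = W x.
Proof. by rewrite /area_density conformal_det sqrtr_sqr gtr0_norm. Qed.

Definition log_der i x : R := partial i W x / W x.

Definition cofactor2 (k l : 'I_2) : R :=
  if k == l then (if k == 0 then M 1 1 else M 0 0) else - M k l.

(** The coefficient of [d_n (ln W)] in Gamma^k_ij for the metric [W M]. As [M] has determinant 1,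
    [cofactor2] is its inverse. *)
Definition christoffel_coef (k i j n : 'I_2) : R :=
  2^-1 * ((n == i)%:R * (k == j)%:R + (n == j)%:R * (k == i)%:R
    - M i j * cofactor2 k n).

Lemma conformal_christoffel k i j x : christoffel G k i j x =
  christoffel_coef k i j 0 * log_der 0 x + christoffel_coef k i j 1 * log_der 1 x.
Proof.
have dG n a b : pderiv n (fun y => G y a b) x = partial n W x * M a b.
  rewrite -partialE (_ : (fun y => _) = fun y => W y * M a b); last first.
    by apply/funext => y; rewrite GE.
  have -> // : partial n (fun y => W y * M a b) = fun y => partial n W y * M a b.
  by apply: partial_eq => y; der; rewrite mulr0 add0r mulrC.
have W0 : W x != 0 by rewrite gt_eqF.
have dx : \det (G x) != 0 by rewrite conformal_det expf_neq0.
rewrite /christoffel big_ord_recl big_ord_recl big_ord0 addr0.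
have -> : lift ord0 ord0 = 1 :> 'I_2 by apply: val_inj.
change (ord0 : 'I_2) with (0 : 'I_2).
have iE a b : invmx (G x) a b = cofactor2 a b / W x.
  rewrite invmx2 // conformal_det !GE /cofactor2.
  by case: eqP => _; [case: eqP => _|]; field.
rewrite !iE !dG /log_der /christoffel_coef.
have M11 : M 1 1 = (1 + M 0 1 ^+ 2) / M 0 0.
  by rewrite -M_det subrK mulrC mulKf // gt_eqF.
have a0 : M 0 0 != 0 by rewrite gt_eqF.
case: (ord2P k) => ->; case: (ord2P i) => ->; case: (ord2P j) => ->;
  rewrite /cofactor2 /= ?M_sym ?M11;
  move: (partial 0 W x) (partial 1 W x) => w0 w1; field; rewrite ?W0 ?a0 //.
Qed.

(* The formula K = - (1/2) Delta_M (ln W) / W of isothermal coordinates. *)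
Lemma conformal_gauss x : gauss_curvature G x * area_density G x =
  - 2^-1 * (ell (fun=> M 0 0) (fun=> M 0 1) (fun=> M 1 1) W x / W x
    - grad_prod (fun=> M 0 0) (fun=> M 0 1) (fun=> M 1 1) W W x / W x ^+ 2).
Proof.
have W0 y : W y != 0 by rewrite gt_eqF.
have Sl i : smooth (log_der i) by rewrite /log_der; smo.
have dl n i y : partial n (log_der i) y =
    partial n (partial i W) y / W y - partial i W y * partial n W y / W y ^+ 2.
  have -> // : partial n (log_der i) = fun y => partial n (partial i W) y / W y -
    partial i W y * partial n W y / W y ^+ 2.
  by apply: partial_eq => z; rewrite /log_der; der => //; ring.
have dC n k i j : pderiv n (christoffel G k i j) x =
    christoffel_coef k i j 0 * partial n (log_der 0) x
    + christoffel_coef k i j 1 * partial n (log_der 1) x.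
  rewrite -partialE (funext (conformal_christoffel k i j)).
  set F := fun y => _; have -> // : partial n F =
    fun y => christoffel_coef k i j 0 * partial n (log_der 0) y
    + christoffel_coef k i j 1 * partial n (log_der 1) y.
  have S0 := Sl 0; have S1 := Sl 1.
  by apply: partial_eq => y; rewrite /F; der; rewrite !mulr0 !addr0.
rewrite conformal_area /gauss_curvature /riemann conformal_det.
rewrite !big_ord_recl !big_ord0 !addr0.
have -> : lift ord0 ord0 = 1 :> 'I_2 by apply: val_inj.
change (ord0 : 'I_2) with (0 : 'I_2).
rewrite !dC !conformal_christoffel !GE !dl /log_der /ell /grad_prod (partialC 1 0 SW).
have M11 : M 1 1 = (1 + M 0 1 ^+ 2) / M 0 0.
  by rewrite -M_det subrK mulrC mulKf // gt_eqF.
have a0 : M 0 0 != 0 by rewrite gt_eqF.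
move: (partial 0 (partial 0 W) x) (partial 0 (partial 1 W) x) (partial 1 (partial 1 W) x).
move: (partial 0 W x) (partial 1 W x) (W x) (W0 x) => w0 w1 w wn w00 w01 w11.
rewrite /christoffel_coef /cofactor2 /= ?M_sym ?M11.
by move: (M 0 0) (M 0 1) a0 => a b an; field; rewrite an wn.
Qed.

End ConformalCurvature.

(* a + ib is holomorphic for the complex structure of L = C d_00 - 2 B d_01 + A d_11
   and without zeros; tau is its argument. *)
Section Phase.
Variable R : realType.
Variables A B C : R.
Hypotheses (A_gt0 : 0 < A) (det1 : A * C - B ^+ 2 = 1).
Variables a b : R * R -> R.
Hypotheses (Sa : smooth a) (Sb : smooth b).
Hypothesis CR0 : forall x, partial 0 a x = A * partial 1 b x - B * partial 0 b x.
Hypothesis CR1 : forall x, partial 1 a x = B * partial 1 b x - C * partial 0 b x.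
Hypothesis nz : forall x, a x ^+ 2 + b x ^+ 2 != 0.

Lemma phase_L_b x : C * partial 0 (partial 0 b) x - 2 * B * partial 0 (partial 1 b) x
  + A * partial 1 (partial 1 b) x = 0.
Proof.
have E1 : partial 1 (partial 0 a) x = A * partial 1 (partial 1 b) x - B * partial 1 (partial 0 b) x.
  rewrite (funext CR0).
  have -> // : partial 1 (fun x => A * partial 1 b x - B * partial 0 b x) =
    fun x => A * partial 1 (partial 1 b) x - B * partial 1 (partial 0 b) x.
  by apply: partial_eq => y; der; ring.
have E0 : partial 0 (partial 1 a) x = B * partial 0 (partial 1 b) x - C * partial 0 (partial 0 b) x.
  rewrite (funext CR1).
  have -> // : partial 0 (fun x => B * partial 1 b x - C * partial 0 b x) =
    fun x => B * partial 0 (partial 1 b) x - C * partial 0 (partial 0 b) x.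
  by apply: partial_eq => y; der; ring.
move: E0; rewrite (partialC 0 1 Sa) E1 (partialC 1 0 Sb).
move: (partial 0 (partial 0 b) x) (partial 0 (partial 1 b) x) (partial 1 (partial 1 b) x).
by clear E1 => p q r; lra.
Qed.

(** The components of the differential of the argument of [a + i b]. *)
Definition phase_form i x : R :=
  (a x * partial i b x - b x * partial i a x) / (a x ^+ 2 + b x ^+ 2).

Lemma smooth_phase_form i : smooth (phase_form i).
Proof. by rewrite /phase_form; smo. Qed.

Lemma partial_phase_form i j x : partial i (phase_form j) x =
  (partial i a x * partial j b x + a x * partial i (partial j b) x
   - partial i b x * partial j a x - b x * partial i (partial j a) x) / (a x ^+ 2 + b x ^+ 2)
  - (a x * partial j b x - b x * partial j a x) *
    (2 * a x * partial i a x + 2 * b x * partial i b x) / (a x ^+ 2 + b x ^+ 2) ^+ 2.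
Proof.
have -> // : partial i (phase_form j) = fun x =>
  (partial i a x * partial j b x + a x * partial i (partial j b) x
   - partial i b x * partial j a x - b x * partial i (partial j a) x) / (a x ^+ 2 + b x ^+ 2)
  - (a x * partial j b x - b x * partial j a x) *
    (2 * a x * partial i a x + 2 * b x * partial i b x) / (a x ^+ 2 + b x ^+ 2) ^+ 2.
by apply: partial_eq => y; rewrite /phase_form; der => //; rewrite /=; ring.
Qed.

Lemma partial2_a x :
  [/\ partial 0 (partial 0 a) x = A * partial 0 (partial 1 b) x - B * partial 0 (partial 0 b) x,
      partial 0 (partial 1 a) x = B * partial 0 (partial 1 b) x - C * partial 0 (partial 0 b) x
    & partial 1 (partial 1 a) x = B * partial 1 (partial 1 b) x - C * partial 0 (partial 1 b) x].
Proof.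
have K i (p q : R) : partial i (fun x => p * partial 1 b x - q * partial 0 b x) =
    fun x => p * partial i (partial 1 b) x - q * partial i (partial 0 b) x.
  by apply: partial_eq => y; der; ring.
by rewrite (funext CR0) (funext CR1) !K (partialC 1 0 Sb).
Qed.

Lemma phase_exists : exists tau : R * R -> R, [/\ smooth tau,
  forall i x, partial i tau x = phase_form i x
  & forall x, ell (fun=> A) (fun=> B) (fun=> C) tau x = 0].
Proof.
have [|tau [Stau t0 t1]] := poincare (smooth_phase_form 0) (smooth_phase_form 1).
  move=> x; rewrite !partial_phase_form (partialC 1 0 Sa) (partialC 1 0 Sb).
  have := nz x.
  move: (partial 0 (partial 1 a) x) (partial 0 (partial 1 b) x).
  move: (partial 0 a x) (partial 1 a x) (partial 0 b x) (partial 1 b x) (a x) (b x).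
  by move=> a0 a1 b0 b1 p q a01 b01 n0; field.
have E i : partial i tau = phase_form i.
  by apply/funext => x; case: (ord2P i) => ->.
exists tau; split=> // [i x|x]; first by rewrite E.
rewrite /ell !E !partial_phase_form.
have [-> -> ->] := partial2_a x; have := phase_L_b x; rewrite CR0 CR1.
have := nz x.
move: (partial 0 (partial 0 b) x) (partial 0 (partial 1 b) x) (partial 1 (partial 1 b) x).
move: (partial 0 b x) (partial 1 b x) (a x) (b x) => b0 b1 p q b00 b01 b11 n0 H.
have A0 : A != 0 by rewrite gt_eqF.
have Cc : C = (1 + B ^+ 2) / A by rewrite -det1 subrK mulrC mulKf.
have b11E : b11 = (2 * B * b01 - C * b00) / A.
  by apply: (mulfI A0); rewrite [RHS]mulrC divfK //; lra.
by rewrite b11E Cc; field; rewrite n0 A0.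
Qed.

Variables d1 d2 : R.
Local Notation D2 := (d1 ^+ 2 + d2 ^+ 2).

(** [phase_cos + i phase_sin] is [(d1 + i d2) e^(-2 i tau)], with tau the argument of [a + i b],
    written rationally in [a] and [b]. This explains the constant modulus and the factors 2 in the
    derivatives. *)
Definition phase_cos x : R :=
  (d1 * (a x ^+ 2 - b x ^+ 2) + 2 * d2 * a x * b x) / (a x ^+ 2 + b x ^+ 2).
Definition phase_sin x : R :=
  (d2 * (a x ^+ 2 - b x ^+ 2) - 2 * d1 * a x * b x) / (a x ^+ 2 + b x ^+ 2).

Lemma smooth_phase_cos : smooth phase_cos.
Proof. by rewrite /phase_cos; smo. Qed.

Lemma smooth_phase_sin : smooth phase_sin.
Proof. by rewrite /phase_sin; smo. Qed.

Lemma phase_cos2_sin2 x : phase_cos x ^+ 2 + phase_sin x ^+ 2 = D2.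
Proof.
rewrite /phase_cos /phase_sin; have := nz x; move: (a x) (b x) => p q n0.
by field.
Qed.

Lemma partial_phase_cos i : partial i phase_cos = fun x => 2 * phase_form i x * phase_sin x.
Proof.
apply: partial_eq => x; rewrite /phase_cos; der => //.
rewrite /phase_form /phase_sin /=.
have := nz x; move: (partial i a x) (partial i b x) (a x) (b x).
by move=> ai bi p q n0; field.
Qed.

Lemma partial_phase_sin i : partial i phase_sin = fun x => - 2 * phase_form i x * phase_cos x.
Proof.
apply: partial_eq => x; rewrite /phase_sin; der => //.
rewrite /phase_form /phase_cos /=.
have := nz x; move: (partial i a x) (partial i b x) (a x) (b x).
by move=> ai bi p q n0; field.
Qed.

(** A holomorphic function of constant argument is constant: with the Cauchy-Riemann system,
    [a db = b da] is a linear system for the gradient of [b] whose determinant is [a ^ 2 + b ^ 2];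
    the two identities in the proof are Cramer's rule. *)
Lemma phase_cst : (forall i x, phase_form i x = 0) ->
  forall i x, partial i a x = 0 /\ partial i b x = 0.
Proof.
move=> H i x.
have K j : a x * partial j b x = b x * partial j a x.
  have /eqP := H j x; rewrite mulf_eq0 invr_eq0 (negbTE (nz x)) orbF subr_eq0.
  by move/eqP.
have := K 0; have := K 1; rewrite CR0 CR1 => K1 K0.
have [b0 b1] : partial 0 b x = 0 /\ partial 1 b x = 0.
  have := nz x; move: (a x) (b x) (partial 0 b x) (partial 1 b x) K0 K1 => p q b0 b1.
  move=> K0 K1 n0.
  split; apply: (mulfI n0); rewrite mulr0.
    transitivity ((p - q * B) * (p * b0 - q * (A * b1 - B * b0)) +
      q * A * (p * b1 - q * (B * b1 - C * b0)) + q ^+ 2 * (1 - (A * C - B ^+ 2)) * b0).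
      by ring.
    by rewrite K0 K1 det1; ring.
  transitivity (- q * C * (p * b0 - q * (A * b1 - B * b0)) +
      (p + q * B) * (p * b1 - q * (B * b1 - C * b0)) + q ^+ 2 * (1 - (A * C - B ^+ 2)) * b1).
    by ring.
  by rewrite K0 K1 det1; ring.
by case: (ord2P i) => ->; rewrite ?CR0 ?CR1 b0 b1 !mulr0 subrr.
Qed.

Variable C0 : R.
Hypothesis C0_gt0 : 0 < C0.
Hypothesis D2_gt0 : 0 < D2.

(** The sharp bound is the square root of [D2]; [1 + D2] is a rational majorant. *)
Lemma phase_bounds x : `|phase_cos x| <= 1 + D2 /\ `|phase_sin x| <= 1 + D2.
Proof.
have := phase_cos2_sin2 x; move: (phase_cos x) (phase_sin x) D2 => k1 k2 d E.
have := sqr_ge0 k1; have := sqr_ge0 k2; rewrite !ler_norml => h1 h2.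
by split; apply/andP; split; nra.
Qed.

(* w is a primitive of (C0 cos + D2)^2 d tau: its Dirichlet density is controlled by
   the curvature density, which only carries the first power of |C0 cos + D2|, while
   w - kappa tau stays bounded. *)
Lemma phase_weight (tau : R * R -> R) : smooth tau ->
  (forall i x, partial i tau x = phase_form i x) ->
  exists w : R * R -> R, exists kappa c0 : R, [/\ smooth w, 0 < kappa,
    forall x, `|w x - kappa * tau x| <= c0
    & forall i x, partial i w x = (C0 * phase_cos x + D2) ^+ 2 * partial i tau x].
Proof.
move=> Stau dtau.
have Sc := smooth_phase_cos; have Ss := smooth_phase_sin.
(* Expanding [(C0 cos + D2) ^ 2] gives [C0 ^ 2 cos ^ 2 + 2 C0 D2 cos + D2 ^ 2]. Its mean over a
   period of tau is [kappa], since [cos ^ 2] has mean [D2 / 2], and [g] is a periodic primitive of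
   the mean minus the square. *)
pose g x := C0 ^+ 2 * (phase_cos x * phase_sin x) / 4 + C0 * D2 * phase_sin x.
pose kappa := C0 ^+ 2 * D2 / 2 + D2 ^+ 2.
exists (fun x => kappa * tau x - g x), kappa,
  (C0 ^+ 2 * ((1 + D2) * (1 + D2)) / 4 + C0 * D2 * (1 + D2)); split.
- by rewrite /g; smo.
- by rewrite /kappa addr_gt0 // ?exprn_gt0 // divr_gt0 // mulr_gt0 // exprn_gt0.
- move=> x; rewrite addrAC subrr add0r normrN /g.
  have [h1 h2] := phase_bounds x.
  apply: le_trans (ler_normD _ _) _; apply: lerD.
    have m0 : 0 < C0 ^+ 2 / 4 by rewrite divr_gt0 // exprn_gt0.
    rewrite -![C0 ^+ 2 * _ / 4]mulrAC normrM (gtr0_norm m0) ler_wpM2l ?(ltW m0) //.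
    by rewrite normrM ler_pM.
  have m0 : 0 < C0 * D2 by rewrite mulr_gt0.
  by rewrite normrM (gtr0_norm m0) ler_wpM2l // ltW.
- move=> i x; rewrite dtau.
  have -> : partial i (fun x => kappa * tau x - g x) = fun x =>
      kappa * phase_form i x
      - (C0 ^+ 2 * (2 * phase_form i x * phase_sin x * phase_sin x
         - 2 * phase_form i x * phase_cos x * phase_cos x) / 4
         - C0 * D2 * (2 * phase_form i x * phase_cos x)).
    apply: partial_eq => y; rewrite /g; der.
    rewrite partial_phase_cos partial_phase_sin dtau.
    by move: (phase_form i y) (phase_cos y) (phase_sin y) => *; field.
  have E : phase_sin x * phase_sin x = D2 - phase_cos x ^+ 2.
    by rewrite -(phase_cos2_sin2 x); ring.
  rewrite -(mulrA _ (phase_sin x)) E /kappa.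
  by move: (phase_form i x) (phase_cos x) => *; field.
Qed.

End Phase.

(** * The Courant-Lebesgue lemma *)

Section PlaneMeasure.
Variable R : realType.

Let mu := @lebesgue_measure R.

(** An open set is the countable union of the rational boxes that it contains, and each box is a
    measurable rectangle. *)
Lemma open_plane_measurable (O : set (R * R)) : open O ->
  (measurable : set (set (measurableTypeR R * measurableTypeR R))) O.
Proof.
move=> oO.
pose box (q : rat * rat * rat) : set (R * R) :=
  `]ratr q.1.1 - ratr q.2, ratr q.1.1 + ratr q.2[ `*`
  `]ratr q.1.2 - ratr q.2, ratr q.1.2 + ratr q.2[.
pose F q := if `[< box q `<=` O >] then box q else set0.
have -> : O = \bigcup_q F q.
  apply/seteqP; split => [x Ox|x [q _]]; last first.
    by rewrite /F; case: asboolP => // H Hx; exact: H.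
  have /nbhs_ballP[e /= e0 He] : nbhs x O by exact: open_nbhs_nbhs.
  (* A centre within [e / 4] of [x] and a half-width between [e / 4] and [e / 2] give a box that
     contains [x] and stays within distance [e] of it. *)
  have e4 : e / 4 < e / 2 by lra.
  have [q2 /itvP Hq2] := rat_in_itvoo e4.
  have H1 (z : R) : z - e / 4 < z + e / 4 by lra.
  have [q1 /itvP Hq1] := rat_in_itvoo (H1 x.1).
  have [q1' /itvP Hq1'] := rat_in_itvoo (H1 x.2).
  have [a1 a2] : x.1 - e / 4 < ratr q1 /\ ratr q1 < x.1 + e / 4 by rewrite !Hq1.
  have [b1 b2] : x.2 - e / 4 < ratr q1' /\ ratr q1' < x.2 + e / 4 by rewrite !Hq1'.
  have [c1 c2] : e / 4 < ratr q2 /\ ratr q2 < e / 2 by rewrite !Hq2.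
  exists (q1, q1', q2) => //; rewrite /F; case: asboolP => [_|[]].
    by split; rewrite /= in_itv /=; apply/andP; split; lra.
  move=> y [/=]; rewrite !in_itv /= => /andP[? ?] /andP[? ?].
  apply: He; split; rewrite /ball /= ltr_norml; apply/andP; split; lra.
apply: countable_bigcupT_measurable; first exact: countableP.
move=> q; rewrite /F; case: asboolP => _; last exact: measurable0.
by apply: measurableX; exact: measurable_itv.
Qed.

Lemma continuous_plane_measurable (u : R * R -> R) : continuous u ->
  measurable_fun (setT : set (measurableTypeR R * measurableTypeR R)) u.
Proof.
move=> cu; move=> mD; apply: (measurability _ (RGenOInfty.measurableE R)) => //.
move=> _ [_ [r ->] <-]; rewrite setTI; apply: open_plane_measurable.
apply: open_comp => [x _|]; first exact: cu.
by rewrite set_itvE; exact: open_gt.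
Qed.

(** Were the integral larger on every vertical line of a strip of width [r], Tonelli's theorem would
    make the plane integral at least [E + 1]. The additional 1 provides the strict inequality. *)
Lemma good_vertical_line (v : R * R -> R) (E p r : R) : 0 < r -> continuous v ->
  (forall x, 0 <= v x) -> (\int[mu \x mu]_x (v x)%:E <= E%:E)%E ->
  exists2 c, p <= c <= p + r & (\int[mu]_y (v (c, y))%:E <= ((E + 1) / r)%:E)%E.
Proof.
move=> r0 cv v0 vE; apply: contrapT => H.
have mv : measurable_fun setT (EFin \o v).
  by apply/measurable_EFinP; exact: continuous_plane_measurable.
have v0' x : (0 <= (EFin \o v) x)%E by rewrite lee_fin.
have mF := measurable_fun_fubini_tonelli_F (m2 := mu) _ mv v0'.
have F0 x : (0 <= fubini_F mu (EFin \o v) x)%E.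
  by apply: integral_ge0 => y _; exact: v0'.
have : (\int[mu \x mu]_x (EFin \o v) x <= E%:E)%E by exact: vE.
rewrite (fubini_tonelli1 (m1 := mu) (m2 := mu) (EFin \o v) mv v0') leNgt => /negP; apply.
pose I : set R := `[p, p + r]%classic.
have I1 : (E%:E < \int[mu]_(x in I) ((E + 1) / r)%R%:E)%E.
  rewrite /I integral_cst //= lebesgue_measure_itv /= lte_fin ltrDl r0 -EFinD -EFinM lte_fin.
  by rewrite [p + r - p]addrAC subrr add0r divfK ?gt_eqF // ltrDl.
have I3 : (\int[mu]_(x in I) fubini_F mu (EFin \o v) x <=
    \int[mu]_x fubini_F mu (EFin \o v) x)%E.
  by apply: ge0_subset_integral => //; exact: measurable_itv.
apply: lt_le_trans I1 (le_trans _ I3).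
have E0 : 0 <= E.
  by rewrite -lee_fin; apply: le_trans vE; apply: integral_ge0 => x _; exact: v0'.
apply: ge0_le_integral.
- exact: measurable_itv.
- by move=> x _; rewrite lee_fin divr_ge0 // ?(ltW r0) // addr_ge0.
- exact: measurable_cst.
- exact: measurable_funS mF.
- move=> x; rewrite {1}/I /= in_itv /= => xp; apply: ltW; rewrite ltNge; apply/negP => Fx.
  by apply: H; exists x.
Qed.

(** The same argument with the other order of integration. *)
Lemma good_horizontal_line (v : R * R -> R) (E p r : R) : 0 < r -> continuous v ->
  (forall x, 0 <= v x) -> (\int[mu \x mu]_x (v x)%:E <= E%:E)%E ->
  exists2 c, p <= c <= p + r & (\int[mu]_x (v (x, c))%:E <= ((E + 1) / r)%:E)%E.
Proof.
move=> r0 cv v0 vE; apply: contrapT => H.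
have mv : measurable_fun setT (EFin \o v).
  by apply/measurable_EFinP; exact: continuous_plane_measurable.
have v0' x : (0 <= (EFin \o v) x)%E by rewrite lee_fin.
have mF := measurable_fun_fubini_tonelli_G (m1 := mu) _ mv v0'.
have F0 x : (0 <= fubini_G mu (EFin \o v) x)%E.
  by apply: integral_ge0 => y _; exact: v0'.
have : (\int[mu \x mu]_x (EFin \o v) x <= E%:E)%E by exact: vE.
rewrite (fubini_tonelli2 (m1 := mu) (m2 := mu) (EFin \o v) mv v0') leNgt => /negP; apply.
pose I : set R := `[p, p + r]%classic.
have I1 : (E%:E < \int[mu]_(x in I) ((E + 1) / r)%R%:E)%E.
  rewrite /I integral_cst //= lebesgue_measure_itv /= lte_fin ltrDl r0 -EFinD -EFinM lte_fin.
  by rewrite [p + r - p]addrAC subrr add0r divfK ?gt_eqF // ltrDl.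
have I3 : (\int[mu]_(x in I) fubini_G mu (EFin \o v) x <=
    \int[mu]_x fubini_G mu (EFin \o v) x)%E.
  by apply: ge0_subset_integral => //; exact: measurable_itv.
apply: lt_le_trans I1 (le_trans _ I3).
have E0 : 0 <= E.
  by rewrite -lee_fin; apply: le_trans vE; apply: integral_ge0 => x _; exact: v0'.
apply: ge0_le_integral.
- exact: measurable_itv.
- by move=> x _; rewrite lee_fin divr_ge0 // ?(ltW r0) // addr_ge0.
- exact: measurable_cst.
- exact: measurable_funS mF.
- move=> x; rewrite {1}/I /= in_itv /= => xp; apply: ltW; rewrite ltNge; apply/negP => Fx.
  by apply: H; exists x.
Qed.

(* AM-GM: [2 |dphi| <= 1 / r + r dphi^2] *)
Lemma oscillation_line (phi dphi : R -> R) (K r y z : R) : 0 < r ->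
  (forall t : R, is_derive t 1 phi (dphi t)) -> continuous dphi ->
  (\int[mu]_t (dphi t ^+ 2)%:E <= (K / r)%:E)%E ->
  - (2 * r) <= y <= 2 * r -> - (2 * r) <= z <= 2 * r -> `|phi y - phi z| <= 2 + K / 2.
Proof.
move=> r0 dp cd Kr.
have cd2 : continuous (fun t => dphi t ^+ 2).
  by move=> t; exact: (continuousM (cd t) (cd t)).
wlog yz : y z / z <= y.
  move=> H hy hz; case: (leP z y) => zy; first exact: H.
  by rewrite distrC; apply: H => //; exact: ltW.
move=> /andP[_ y2] /andP[z2 _].
case: (ltgtP z y) yz => // [zy _|-> _]; last first.
  rewrite subrr normr0.
  have : 0 <= K / r.
    rewrite -lee_fin; apply: le_trans Kr; apply: integral_ge0 => t _.
    by rewrite lee_fin sqr_ge0.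
  by rewrite pmulr_lge0 ?invr_gt0 // => K0; rewrite addr_ge0 // divr_ge0.
have [G [dG _]] := primitive cd2.
have GK : G y - G z <= K / r.
  rewrite -lee_fin; apply: le_trans Kr.
  have cG : continuous G.
    move=> t; apply/differentiable_continuous/derivable1_diffP.
    exact: (@ex_derive _ _ _ _ _ _ _ (dG t)).
  rewrite EFinB -(@continuous_FTC2 R (fun t => dphi t ^+ 2) G z y zy).
  - apply: ge0_subset_integral => //.
      by apply/measurable_EFinP; exact: continuous_measurable_fun.
    by move=> t _; rewrite lee_fin sqr_ge0.
  - exact: continuous_subspaceT.
  - split=> [t _||]; first exact: (@ex_derive _ _ _ _ _ _ _ (dG t)).
      exact: (cvg_at_right_filter (cG z)).
    exact: (cvg_at_left_filter (cG y)).
  - by move=> t _; rewrite derive1E; exact: (@derive_val _ _ _ _ _ _ _ (dG t)).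
have amgm (t e : R) : e ^+ 2 = 1 -> 2 * (e * t) <= r^-1 + r * t ^+ 2.
  move=> e1; rewrite -(ler_pM2l r0).
  have : 0 <= (1 - e * r * t) ^+ 2 by exact: sqr_ge0.
  have -> : (1 - e * r * t) ^+ 2 = 1 - 2 * (e * r * t) + e ^+ 2 * r ^+ 2 * t ^+ 2 by ring.
  rewrite e1 mulrDr divff ?gt_eqF //; lra.
have main (e : R) : e ^+ 2 = 1 -> e * (phi y - phi z) <= 2 + K / 2.
  move=> e1.
  (* By the inequality [amgm] this function does not increase. Over a length of at most [4 r] the
     linear term contributes at most 4 and the energy term at most [K]; the signs [e = 1] and
     [e = -1] give the absolute value. *)
  have [t|t _ Et] := @mvt R (fun t => 2 * (e * phi t) - (r^-1 * t + r * G t))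
     (fun t => 2 * (e * dphi t) - (r^-1 + r * dphi t ^+ 2)) z y.
    apply: sder_eq (sderD (sderM (sderC 2 t 1) (sderM (sderC e t 1) (dp t)))
      (sderN (sderD (sderM (sderC r^-1 t 1) (is_derive_id t 1)) (sderM (sderC r t 1) (dG t))))) _.
    by ring.
  have : (2 * (e * dphi t) - (r^-1 + r * dphi t ^+ 2)) * (y - z) <= 0.
    by rewrite mulr_le0_ge0 // ?subr_le0 ?amgm // subr_ge0 ltW.
  rewrite -Et => H.
  have h1 : r^-1 * (y - z) <= 4.
    rewrite mulrC ler_pdivrMr //; lra.
  have h2 : r * (G y - G z) <= K by rewrite mulrC -ler_pdivlMr.
  move: H h1 h2; move: (phi y) (phi z) (G y) (G z) (r^-1) => p q g h i H h1 h2.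
  clear -H h1 h2; lra.
rewrite ler_norml; apply/andP; split.
  have := main (-1); rewrite sqrrN expr1n => /(_ erefl).
  by move: (phi y) (phi z) => p q; clear => H; lra.
by have := main 1; rewrite expr1n mul1r; apply.
Qed.

End PlaneMeasure.

Section CourantLebesgue.
Variable R : realType.

Let mu := @lebesgue_measure R.

Definition rectangle_edge (a b c d : R) (z : R * R) : Prop :=
  [/\ a <= z.1 <= b, c <= z.2 <= d
    & (z.1 = a \/ z.1 = b) \/ (z.2 = c \/ z.2 = d)].

(** Each side is a good line in a strip of width [r]. Its energy is of order [1 / r] and its length
    of order [r], so the oscillation on it is at most [k], independently of [r]. Every edge point is
    joined to the corner [(a, c)] along at most two sides, whence [4 k]. *)
Lemma courant_lebesgue (w : R * R -> R) (E : R) : smooth w ->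
  (forall i, (\int[mu \x mu]_x (partial i w x ^+ 2)%:E <= E%:E)%E) ->
  exists m, forall r, 0 < r -> exists a b c d : R,
    [/\ - (2 * r) <= a <= - r, r <= b <= 2 * r, - (2 * r) <= c <= - r, r <= d <= 2 * r
      & forall z z', rectangle_edge a b c d z -> rectangle_edge a b c d z' ->
        `|w z - w z'| <= m].
Proof.
move=> Sw wE; pose k := 2 + (E + 1) / 2; exists (4 * k) => r r0.
have cw i : continuous (partial i w) by apply: smooth_cont; exact: smooth_partial.
have cw2 i : continuous (fun x => partial i w x ^+ 2).
  by move=> x; exact: (continuousM (cw i x) (cw i x)).
have w0 i x : 0 <= partial i w x ^+ 2 by exact: sqr_ge0.
have vert p : exists2 c, p <= c <= p + r & forall y z, - (2 * r) <= y <= 2 * r ->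
    - (2 * r) <= z <= 2 * r -> `|w (c, y) - w (c, z)| <= k.
  have [c cp cE] := @good_vertical_line R _ E p r r0 (cw2 1) (w0 1) (wE 1).
  exists c => // y z; apply: (@oscillation_line R (fun t => w (c, t)) (fun t => partial 1 w (c, t)) (E + 1) r y z r0 _ _ cE).
    by move=> t; apply: sder_slice1; exact: smooth_der.
  move=> t; apply/differentiable_continuous/derivable1_diffP.
  exact: (@ex_derive _ _ _ _ _ _ _ (sder_slice1 (smooth_der 1 (c, t) (smooth_partial 1 Sw)))).
have horiz p : exists2 c, p <= c <= p + r & forall y z, - (2 * r) <= y <= 2 * r ->
    - (2 * r) <= z <= 2 * r -> `|w (y, c) - w (z, c)| <= k.
  have [c cp cE] := @good_horizontal_line R _ E p r r0 (cw2 0) (w0 0) (wE 0).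
  exists c => // y z; apply: (@oscillation_line R (fun t => w (t, c)) (fun t => partial 0 w (t, c)) (E + 1) r y z r0 _ _ cE).
    by move=> t; apply: sder_slice0; exact: smooth_der.
  move=> t; apply/differentiable_continuous/derivable1_diffP.
  exact: (@ex_derive _ _ _ _ _ _ _ (sder_slice0 (smooth_der 0 (t, c) (smooth_partial 0 Sw)))).
have [a ar wa] := vert (- (2 * r)); have [b br wb] := vert r.
have [c cr wc] := horiz (- (2 * r)); have [d dr wd] := horiz r.
have {}ar : - (2 * r) <= a <= - r by move: ar => /andP[? ?]; apply/andP; split; lra.
have {}br : r <= b <= 2 * r by move: br => /andP[? ?]; apply/andP; split; lra.
have {}cr : - (2 * r) <= c <= - r by move: cr => /andP[? ?]; apply/andP; split; lra.
have {}dr : r <= d <= 2 * r by move: dr => /andP[? ?]; apply/andP; split; lra.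
exists a, b, c, d; split=> //.
have in2 (x y t : R) : - (2 * r) <= x <= 2 * r -> - (2 * r) <= y <= 2 * r ->
    x <= t <= y -> - (2 * r) <= t <= 2 * r.
  by move=> /andP[? ?] /andP[? ?] /andP[? ?]; apply/andP; split; lra.
have a2 : - (2 * r) <= a <= 2 * r by move: ar => /andP[? ?]; apply/andP; split; lra.
have b2 : - (2 * r) <= b <= 2 * r by move: br => /andP[? ?]; apply/andP; split; lra.
have c2 : - (2 * r) <= c <= 2 * r by move: cr => /andP[? ?]; apply/andP; split; lra.
have d2 : - (2 * r) <= d <= 2 * r by move: dr => /andP[? ?]; apply/andP; split; lra.
have k0 : 0 <= k by apply: le_trans (wa a a a2 a2); exact: normr_ge0.
have tri (x y z e f : R) : `|x - y| <= e -> `|y - z| <= f -> `|x - z| <= e + f.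
  by move=> h1 h2; apply: le_trans (ler_distD y _ _) _; exact: lerD.
have corner z : rectangle_edge a b c d z -> `|w z - w (a, c)| <= k + k.
  case: z => z1 z2 [/= /(in2 _ _ _ a2 b2) z12 /(in2 _ _ _ c2 d2) z22].
  case=> [[] ->|[] ->].
  - by apply: le_trans (wa _ _ z22 c2) _; rewrite lerDl.
  - by apply: tri (wb _ _ z22 c2) (wc _ _ b2 a2).
  - by apply: le_trans (wc _ _ z12 a2) _; rewrite lerDl.
  - by apply: tri (wd _ _ z12 a2) (wa _ _ d2 c2).
move=> z z' /corner hz /corner; rewrite distrC => hz'.
have -> : 4 * k = k + k + (k + k) by ring.
exact: tri hz hz'.
Qed.

Variables A B C : R.
Hypotheses (A_gt0 : 0 < A) (det1 : A * C - B ^+ 2 = 1).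

Local Notation L := (ell (fun=> A) (fun=> B) (fun=> C)).

Lemma C_gt0 : 0 < C.
Proof.
have AC : A * C = 1 + B ^+ 2 by rewrite -det1 subrK.
by rewrite -(pmulr_rgt0 _ A_gt0) AC ltr_wpDr // sqr_ge0.
Qed.

(* Subtracting a small multiple of x_1^2 makes L u negative. *)
Lemma rectangle_min_principle (u : R * R -> R) (a b c d m : R) : smooth u ->
  (forall x, L u x = 0) -> a <= b -> c <= d ->
  (forall z, rectangle_edge a b c d z -> m <= u z) ->
  forall x, a <= x.1 <= b -> c <= x.2 <= d -> m - 1 <= u x.
Proof.
move=> Su Lu ab cd um x xab xcd.
pose n := a ^+ 2 + b ^+ 2 + 1.
have n0 : 0 < n by rewrite /n ltr_wpDl // addr_ge0 // sqr_ge0.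
have sqn (t : R) : a <= t <= b -> t ^+ 2 <= n.
  move=> /andP[at_ tb]; have sa := sqr_ge0 a; have sb := sqr_ge0 b; rewrite /n.
  case: (leP 0 t) => t0.
    have : t ^+ 2 <= b ^+ 2 by rewrite ler_sqr ?nnegrE // (le_trans t0).
    by clear -sa sb => ?; lra.
  have : (- t) ^+ 2 <= (- a) ^+ 2 by rewrite ler_sqr ?nnegrE ?lerN2 // oppr_ge0 ltW // (le_lt_trans at_).
  by rewrite !sqrrN; clear -sa sb => ?; lra.
(* [n] bounds [x.1 ^ 2] on the rectangle, so the perturbation is at most 1 in absolute value: this
   is the loss in the conclusion. *)
pose e := - n^-1.
pose v y := u y + e * (y.1 ^+ 2).
have Sq : smooth (fun y : R * R => y.1 ^+ 2) by smo.
have Sv : smooth v by rewrite /v; smo.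
have Lq y : L (fun y : R * R => y.1 ^+ 2) y = 2 * C.
  have E i : partial i (fun y : R * R => y.1 ^+ 2) = fun y => 2 * y.1 * (i == 0)%:R.
    by apply: partial_eq => z; der; rewrite /=; ring.
  have E2 i j : partial i (fun y : R * R => 2 * y.1 * (j == 0)%:R) =
      fun y => 2 * (i == 0)%:R * (j == 0)%:R.
    by apply: partial_eq => z; der; rewrite /=; ring.
  by rewrite /ell !E !E2 /=; ring.
pose K : set (R * R) := `[a, b] `*` `[c, d].
have Kx : K x by split; rewrite /= in_itv.
have [||||| z [[/= Kz1 Kz2] nKz Hz]] := @min_not_interior R (fun=> A) (fun=> B) (fun=> C) v K
    (@compact_rectangle R a b c d).
- by exists x.
- by [].
- by move=> _; rewrite det1.
- exact: Sv.
- move=> y _; rewrite /v ell_comb // Lu Lq add0r pmulr_llt0 ?mulr_gt0 ?C_gt0 //.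
  by rewrite /e oppr_lt0 invr_gt0.
move: Kz1 Kz2; rewrite !in_itv /= => Kz1 Kz2.
have ze : rectangle_edge a b c d z.
  split=> //; apply: contrapT => H; apply: nKz.
  move: H => /not_orP[/not_orP[/eqP za /eqP zb] /not_orP[/eqP zc /eqP zd]].
  move: Kz1 Kz2 => /andP[Ka Kb] /andP[Kc Kd].
  have cs t : continuous (fun _ : R * R => t : R) by move=> ?; exact: cst_continuous.
  have c1 : continuous (fun y : R * R => y.1) by exact: smooth_cont (smooth_fst R).
  have c2 : continuous (fun y : R * R => y.2) by exact: smooth_cont (smooth_snd R).
  have n1 := nbhs_continuous_lt (cs a) c1 (x := z).
  have n2 := nbhs_continuous_lt c1 (cs b) (x := z).
  have n3 := nbhs_continuous_lt (cs c) c2 (x := z).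
  have n4 := nbhs_continuous_lt c2 (cs d) (x := z).
  rewrite !lt_neqAle Ka Kb Kc Kd ![_ == z.1]eq_sym ![_ == z.2]eq_sym za zb zc zd in n1 n2 n3 n4.
  have n12 : nbhs z (fun y => a < y.1 < b).
    by apply: filterS2 (n1 isT) (n2 isT) => y y1 y2; apply/andP.
  have n34 : nbhs z (fun y => c < y.2 < d).
    by apply: filterS2 (n3 isT) (n4 isT) => y y1 y2; apply/andP.
  apply: filterS2 n12 n34 => y /andP[y1 y2] /andP[y3 y4].
  by split; rewrite /= in_itv /= !ltW.
have := um z ze; have := Hz x Kx; rewrite /v /e.
have : n^-1 * z.1 ^+ 2 <= 1 by rewrite mulrC ler_pdivrMr // mul1r sqn.
have : 0 <= n^-1 * x.1 ^+ 2 by rewrite mulr_ge0 ?sqr_ge0 // invr_ge0 ltW.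
by rewrite !mulNr; move: (u x) (u z) (_ * x.1 ^+ 2) (_ * z.1 ^+ 2)=> *; lra.
Qed.

(** [w] oscillates by at most [m] on the edges of arbitrarily large rectangles, hence [tau] by at
    most [(m + 2 c0) / kappa]. The minimum principle for [tau] at [x] and for [- tau] at 0 carries
    this inside with a bound that does not depend on the rectangle. *)
Lemma liouville_dirichlet (tau w : R * R -> R) (kappa c0 E : R) : smooth tau ->
  (forall x, L tau x = 0) -> smooth w -> 0 < kappa ->
  (forall x, `|w x - kappa * tau x| <= c0) ->
  (forall i, (\int[mu \x mu]_x (partial i w x ^+ 2)%:E <= E%:E)%E) ->
  forall x y, tau x = tau y.
Proof.
move=> St Lt Sw k0 wt wE.
have [m Hm] := courant_lebesgue Sw wE.
have [M EM] : exists M, M = (m + 2 * c0) / kappa by eexists.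
have bound x : - (2 * (M + 1)) <= tau x - tau 0.
  pose r := `|x.1| + `|x.2| + 1.
  have r0 : 0 < r by rewrite /r ltr_wpDl // addr_ge0.
  have [a [b [c [d [ar br cr dr Hw]]]]] := Hm r r0.
  have edge_osc z z' : rectangle_edge a b c d z -> rectangle_edge a b c d z' ->
      tau z - M <= tau z'.
    move=> hz hz'; rewrite lerBlDr addrC -lerBlDr EM ler_pdivlMr //.
    have := Hw z z' hz hz'; have := wt z; have := wt z'.
    rewrite !ler_norml; move: (tau z) (tau z') (w z) (w z').
    move=> p q p' q' /andP[h1 h2] /andP[h3 h4] /andP[h5 h6].
    lra.
  have ab : a <= b by move: ar br => /andP[? ?] /andP[? ?]; lra.
  have cd : c <= d by move: cr dr => /andP[? ?] /andP[? ?]; lra.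
  have pe : rectangle_edge a b c d (a, c) by split; rewrite /= ?lexx //; left; left.
  have inr (t : R) : `|t| <= r -> (a <= t <= b) /\ (c <= t <= d).
    rewrite ler_norml => /andP[? ?]; move: ar br cr dr => /andP[? ?] /andP[? ?] /andP[? ?] /andP[? ?].
    by split; apply/andP; split; lra.
  have /inr[x1 _] : `|x.1| <= r by rewrite /r -addrA lerDl addr_ge0.
  have /inr[_ x2] : `|x.2| <= r by rewrite /r addrAC lerDr addr_ge0.
  have /inr[z1 z2] : `|0 : R| <= r by rewrite normr0 ltW.
  have lo := @rectangle_min_principle tau a b c d (tau (a, c) - M) St Lt ab cd
    (fun z => edge_osc _ _ pe) x x1 x2.
  have SN : smooth (fun y => - tau y) by smo.
  have LN y : L (fun y => - tau y) y = 0.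
    have E1 i : partial i (fun y => - tau y) = fun y => - partial i tau y.
      by apply: partial_eq => z; der.
    have E2 i j : partial i (fun y => - partial j tau y) = fun y => - partial i (partial j tau) y.
      by apply: partial_eq => z; der.
    have := Lt y; rewrite /ell !E1 !E2.
    move: (partial 0 (partial 0 tau) y) (partial 0 (partial 1 tau) y) (partial 1 (partial 1 tau) y).
    by move=> p q s H; rewrite -[RHS]oppr0 -H; ring.
  have upe z : rectangle_edge a b c d z -> - tau (a, c) - M <= - tau z.
    move=> hz; have := edge_osc z (a, c) hz pe.
    by move: (tau z) (tau (a, c))=> *; lra.
  have up := @rectangle_min_principle (fun y => - tau y) a b c d (- tau (a, c) - M) SN LN ab cd
    upe 0 z1 z2.
  by move: lo up; move: (tau x) (tau 0) (tau (a, c))=> *; lra.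
have SC (t : R) : smooth (fun _ : R * R => t) by exact: smooth_cst.
have pC i (t : R) : partial i (fun _ : R * R => t) = fun=> 0.
  by apply: partial_eq => x; exact: sderC.
apply: (@liouville_codazzi R (fun=> A) (fun=> B) (fun=> C) _ _ _ _ _ _ _ tau (tau 0 - 2 * (M + 1))) => //.
- by move=> x; rewrite !pC.
- by move=> x; rewrite !pC.
- by move=> x; rewrite Lt.
- by move=> x; have := bound x; move: (tau x) (tau 0)=> *; lra.
Qed.

End CourantLebesgue.

(** * Unique continuation for harmonic gradients *)

Section Harmonic.
Variable R : realType.

Local Notation laplace := (ell (fun=> 1 : R) (fun=> 0 : R) (fun=> 1 : R)).

Definition gradient_sqr (u : R * R -> R) x : R := partial 0 u x ^+ 2 + partial 1 u x ^+ 2.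

Lemma gradient_sqr_ge0 u x : 0 <= gradient_sqr u x.
Proof. by rewrite addr_ge0 // sqr_ge0. Qed.

Lemma smooth_gradient_sqr u : smooth u -> smooth (gradient_sqr u).
Proof. by move=> Su; rewrite /gradient_sqr; smo. Qed.

(** For the holomorphic function F = u_0 - i u_1, the Laplacian of ln(|F|^2 + k) is 4 k |F'|^2 /
    (|F|^2 + k)^2. The positive [k] keeps the logarithm smooth at the zeros of F. *)
Lemma log_gradient_subharmonic (u : R * R -> R) (k : R) x : smooth u -> 0 < k ->
  (forall x, laplace u x = 0) ->
  0 <= laplace (fun y => ln (gradient_sqr u y + k)) x.
Proof.
move=> Su k0 Lu.
have E11 y : partial 1 (partial 1 u) y = - partial 0 (partial 0 u) y.
  have := Lu y; rewrite /ell.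
  by move: (partial 0 (partial 0 u) y) (partial 0 (partial 1 u) y) (partial 1 (partial 1 u) y) => *; lra.
have E10 : partial 1 (partial 0 u) = partial 0 (partial 1 u) by rewrite partialC.
have S0 := smooth_partial 0 Su; have S1 := smooth_partial 1 Su.
have S00 := smooth_partial 0 S0; have S01 := smooth_partial 0 S1.
have E11i i y : partial i (partial 1 (partial 1 u)) y = - partial i (partial 0 (partial 0 u)) y.
  rewrite (funext E11).
  have -> // : partial i (fun y => - partial 0 (partial 0 u) y) =
    fun y => - partial i (partial 0 (partial 0 u)) y.
  by apply: partial_eq => z; der.
have h0 y : 0 < gradient_sqr u y + k by rewrite ltr_wpDl // gradient_sqr_ge0.
have Eg i : partial i (fun y => ln (gradient_sqr u y + k)) = fun y =>
    (2 * partial 0 u y * partial i (partial 0 u) y + 2 * partial 1 u y * partial i (partial 1 u) y)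
    / (gradient_sqr u y + k).
  apply: partial_eq => y; have hy := h0 y; rewrite /gradient_sqr in hy *; der => //.
  by rewrite /=; congr (_ / _); ring.
have hn y : gradient_sqr u y + k != 0 by rewrite gt_eqF.
have Egg i : partial i (fun y =>
    (2 * partial 0 u y * partial i (partial 0 u) y + 2 * partial 1 u y * partial i (partial 1 u) y)
    / (gradient_sqr u y + k)) = fun y =>
    (2 * partial i (partial 0 u) y ^+ 2 + 2 * partial 0 u y * partial i (partial i (partial 0 u)) y
     + 2 * partial i (partial 1 u) y ^+ 2 + 2 * partial 1 u y * partial i (partial i (partial 1 u)) y)
     / (gradient_sqr u y + k)
    - (2 * partial 0 u y * partial i (partial 0 u) y + 2 * partial 1 u y * partial i (partial 1 u) y) ^+ 2
     / (gradient_sqr u y + k) ^+ 2.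
  apply: partial_eq => y; have hy := hn y; rewrite /gradient_sqr in hy *; der => //.
  by rewrite /=; field.
rewrite /ell !Eg !Egg.
have -> : partial 1 (partial 1 (partial 0 u)) x = - partial 0 (partial 0 (partial 0 u)) x.
  by rewrite E10 (partialC 1 0 S1) -E11i.
have -> : partial 1 (partial 1 (partial 1 u)) x = - partial 0 (partial 0 (partial 1 u)) x.
  by rewrite E11i (partialC 1 0 S0) E10.
rewrite E11 E10 mulr0 mul0r subr0 !mul1r; have := h0 x; rewrite /gradient_sqr.
move: (partial 0 (partial 0 (partial 0 u)) x) (partial 0 (partial 0 (partial 1 u)) x).
move: (partial 0 (partial 0 u) x) (partial 0 (partial 1 u) x) (partial 0 u x) (partial 1 u x).
move=> al be p q a3 b3 hp.
set h := p ^+ 2 + q ^+ 2 + k in hp *.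
have -> : (2 * al ^+ 2 + 2 * p * a3 + 2 * be ^+ 2 + 2 * q * b3) / h
   - (2 * p * al + 2 * q * be) ^+ 2 / h ^+ 2
   + ((2 * be ^+ 2 + 2 * p * - a3 + 2 * (- al) ^+ 2 + 2 * q * - b3) / h
   - (2 * p * be + 2 * q * - al) ^+ 2 / h ^+ 2) =
   4 * (al ^+ 2 + be ^+ 2) * k / h ^+ 2.
  by rewrite /h; field; rewrite -/h gt_eqF.
by rewrite !mulr_ge0 ?addr_ge0 ?sqr_ge0 ?invr_ge0 ?exprn_ge0 // ltW.
Qed.

(* Hadamard's three circles theorem for ln |grad u|^2, with an inner circle on
   which it is -oo. *)
Lemma harmonic_gradient_continuation (u : R * R -> R) (x0 : R * R) : smooth u ->
  (forall x, laplace u x = 0) -> nbhs x0 (fun x => gradient_sqr u x = 0) ->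
  forall x, gradient_sqr u x = 0.
Proof.
move=> Su Lu /nbhs_ballP[r0 /= r00 Hr0] x1.
apply/eqP; rewrite eq_le gradient_sqr_ge0 andbT leNgt; apply/negP => g0.
pose r := r0 / 2.
have r_gt0 : 0 < r by rewrite divr_gt0.
have rr : r < r0 by rewrite /r; lra.
have zr z : supdist z x0 <= r -> gradient_sqr u z = 0.
  rewrite /supdist ge_max => /andP[h1 h2]; apply: Hr0.
  by split; rewrite /ball /= distrC; [apply: le_lt_trans h1 _|apply: le_lt_trans h2 _].
have x1r : r < supdist x1 x0.
  by rewrite ltNge; apply/negP => /zr E; move: g0; rewrite E ltxx.
have Sg := smooth_gradient_sqr Su.
have pf i : partial i (@fst R R) = fun=> (i == 0)%:R.
  by apply: partial_eq => x; exact: sder_fst.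
have ps i : partial i (@snd R R) = fun=> (i == 1)%:R.
  by apply: partial_eq => x; exact: sder_snd.
have pc i (c : R) : partial i (fun=> c) = fun=> 0.
  by apply: partial_eq => x; exact: sderC.
pose a := r ^+ 2 / 4.
have a0 : 0 < a by rewrite divr_gt0 // exprn_gt0.
(* For the flat Laplacian the coordinates themselves are isothermal, and [expand] holds with
   equality. *)
pose b := barrier (@fst R R) (@snd R R) x0 a.
have Sb : smooth b by apply: smooth_barrier => //; [exact: smooth_fst|exact: smooth_snd].
have ex (x y : R * R) : (x.1 - y.1) ^+ 2 + (x.2 - y.2) ^+ 2 <= (x.1 - y.1) ^+ 2 + (x.2 - y.2) ^+ 2 by [].
have bge x : ln (supdist x x0 ^+ 2 + a) - 2 <= b x := barrier_ge ex x0 x a0.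
have Lb x : r <= supdist x x0 -> laplace b x < 0.
  move=> rx; apply: ell_barrier => //.
  - exact: smooth_fst.
  - exact: smooth_snd.
  - by move=> y; rewrite /ell !pf !pc; ring.
  - by move=> y; rewrite /ell !ps !pc; ring.
  - by move=> y; rewrite /grad_prod !pf !ps /=; ring.
  - by move=> y; rewrite /grad_prod !pf !ps /=; ring.
  - by move=> y; rewrite /grad_prod !pf /=; rewrite !mulr1 !mulr0 !addr0 mul0r subr0 ltr01.
  apply: lt_le_trans (supdist_dist2 ex _ _).
  have : r ^+ 2 <= supdist x x0 ^+ 2 by rewrite ler_sqr ?nnegrE ?(ltW r_gt0) // (le_trans (ltW r_gt0)).
  apply: lt_le_trans; rewrite /a; have : 0 < r ^+ 2 by rewrite exprn_gt0.
  by move: (r ^+ 2) => t t0; lra.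
pose T := b x1 + 1 + 2.
pose s := Num.max (supdist x1 x0) (Num.max (expR T) 1).
have s1 : 1 <= s by rewrite !le_max lexx !orbT.
have sT : T <= ln (s ^+ 2 + a).
  rewrite -ler_expR lnK ?posrE ?ltr_wpDl ?sqr_ge0 //.
  have : expR T <= s by rewrite !le_max lexx orbT.
  by move: s1 a0; rewrite expr2; move: (expR T) => t h1 h2 h3; nra.
have [M0 HM0] := @bounded_on_rectangle R (gradient_sqr u) (x0.1 - s) (x0.1 + s)
  (x0.2 - s) (x0.2 + s) (smooth_cont Sg).
pose M := `|M0|.
have HM z : supdist z x0 <= s -> gradient_sqr u z <= M.
  case: z => z1 z2; rewrite /supdist ge_max /= !ler_distl => /andP[h1 h2].
  by apply: le_trans (ler_norm _) _; apply: le_trans (HM0 _ _ h1 h2) _; exact: ler_norm.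
pose g := gradient_sqr u x1.
(* On the outer square the barrier exceeds [b x1] by at least 1 and [U] is at most [ln (M + 1)];
   this slope makes [lam b - U] larger there than at [x1]. *)
pose lam := `|ln (M + 1) - ln g| + 1.
have lam0 : 0 < lam by rewrite /lam ltr_wpDl.
have lamM : ln (M + 1) - ln g < lam.
  by rewrite /lam; apply: le_lt_trans (ler_norm _) _; rewrite ltrDl.
have bm x : ln a - 2 <= b x.
  apply: le_trans (bge x); rewrite lerD2r.
  by rewrite ler_ln ?posrE // ?ltr_wpDl ?sqr_ge0 // lerDr sqr_ge0.
(* On the inner square [U] equals [ln k], as the gradient vanishes there. [k] is chosen last, after
   [lam], so small that [- ln k] outweighs [lam] times the possible drop of the barrier below
   [b x1]. *)
pose k := Num.min 1 (g * expR (- (lam * (b x1 - (ln a - 2))) - 1)).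
have k0 : 0 < k by rewrite lt_min ltr01 mulr_gt0 // expR_gt0.
have k1 : k <= 1 by rewrite ge_min lexx.
have lnk : ln k <= ln g - lam * (b x1 - (ln a - 2)) - 1.
  have kg : k <= g * expR (- (lam * (b x1 - (ln a - 2))) - 1) by rewrite ge_min lexx orbT.
  have e0 : 0 < expR (- (lam * (b x1 - (ln a - 2))) - 1) by exact: expR_gt0.
  have : ln k <= ln (g * expR (- (lam * (b x1 - (ln a - 2))) - 1)).
    by rewrite ler_ln ?posrE // mulr_gt0.
  by rewrite lnM ?posrE // expRK addrA.
pose U y := ln (gradient_sqr u y + k).
have h0 y : 0 < gradient_sqr u y + k by rewrite ltr_wpDl // gradient_sqr_ge0.
have SU : smooth U by rewrite /U; smo.
pose v y := lam * b y - U y.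
have Sv : smooth v by rewrite /v; smo.
have gU : ln g <= U x1 by rewrite /U ler_ln ?posrE // lerDl ltW.
have Lv z : r <= supdist z x0 -> laplace v z < 0.
  move=> rz.
  have -> : v = fun y => (- 1) * U y + lam * b y.
    by apply/funext => y; rewrite /v mulN1r addrC.
  rewrite ell_comb //; last by smo.
  have := log_gradient_subharmonic z Su k0 Lu; rewrite -/U => HU.
  have SN : smooth (fun _ : R * R => 0 : R) by exact: smooth_cst.
  have := @ell_comb R (fun=> 1) (fun=> 0) (fun=> 1) (fun=> 0) U (-1) z SN SU.
  rewrite [X in ell _ _ _ X](_ : _ = (fun y => -1 * U y)); last by apply/funext => y; rewrite add0r.
  move=> ->.
  have -> : laplace (fun=> 0) z = 0 by rewrite /ell !pc; ring.
  have Lbz : lam * laplace b z < 0 by rewrite pmulr_rlt0 // Lb.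
  by move: HU Lbz; move: (laplace U z) (lam * _) => *; lra.
have K1 : r <= supdist x1 x0 <= s by rewrite (ltW x1r) /s le_max lexx.
have det : 1 * 1 - 0 ^+ 2 = 1 :> R by ring.
have [z [zb]] := @annulus_min R (fun=> 1) (fun=> 0) (fun=> 1) (fun=> ltr01) (fun=> det)
  v x0 r s x1 Sv Lv K1.
apply/negP; rewrite -ltNge /v; case: zb => [zE|zE].
  have zz : U z = ln k by rewrite /U zr ?zE // add0r.
  rewrite zz; have := bm z; move: lnk gU lam0.
  by move: (b z) (b x1) (ln a) (ln g) (ln k) (U x1) => *; nra.
have bz : b x1 + 1 <= b z.
  by apply: le_trans (bge z); rewrite zE; move: sT; rewrite /T; move: (ln _) (b x1) => *; lra.
have M1 : 0 < M + 1 by rewrite ltr_wpDl // /M.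
have gM : gradient_sqr u z + k <= M + 1 by apply: lerD => //; apply: HM; rewrite zE.
have UM : U z <= ln (M + 1) by rewrite /U ler_ln ?posrE.
move: bz UM lamM gU lam0.
by move: (b z) (b x1) (ln g) (ln (M + 1)) (U x1) (U z) => *; nra.
Qed.

End Harmonic.

(** * Rigidity of the graph *)

Section AffineMaps.
Variables (R : realType) (V : lmodType R).

Definition plane_linear (u v : V) (x : R * R) : V := x.1 *: u + x.2 *: v.

Lemma plane_linear_is_linear u v : linear (plane_linear u v).
Proof.
by move=> k x y; rewrite /plane_linear /= !scalerDl scalerDr !scalerA addrACA.
Qed.

HB.instance Definition _ u v :=
  GRing.isLinear.Build R (R * R)%type V _ (plane_linear u v) (plane_linear_is_linear u v).

Lemma affine_linearI (F : R * R -> V) (u v c : V) :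
  (forall x, F x = x.1 *: u + x.2 *: v + c) -> affine_linear F.
Proof. by move=> FE; exists (plane_linear u v), c. Qed.

Lemma affine_linearE (F : R * R -> V) : affine_linear F ->
  exists u v c : V, forall x, F x = x.1 *: u + x.2 *: v + c.
Proof.
move=> [L [c FE]]; exists (L (1, 0)), (L (0, 1)), c => x; rewrite FE; congr (_ + c).
rewrite -!linearZ -linearD; congr (L _).
apply: injective_projections => /=.
  by rewrite scaler0 addr0; apply/esym; exact: mulr1.
by rewrite scaler0 add0r; apply/esym; exact: mulr1.
Qed.

End AffineMaps.

Section ConstantGradient.
Variable R : realType.

Lemma constant_partials (u : R * R -> R) (p q : R) : smooth u ->
  (forall x, partial 0 u x = p) -> (forall x, partial 1 u x = q) ->
  forall x, u x = x.1 * p + x.2 * q + u (0, 0).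
Proof.
move=> Su u0 u1 [x y] /=.
have [c _] := @mvt_axis0 R u (partial 0 u) 0 y x (fun z => smooth_der 0 z Su).
have [c' _] := @mvt_axis1 R u (partial 1 u) 0 0 y (fun z => smooth_der 1 z Su).
rewrite u0 u1 !subr0 => E1 E0.
by rewrite -[LHS](subrK (u (0, y))) E0 -[u (0, y)](subrK (u (0, 0))) E1; ring.
Qed.

Lemma gradient_sqr_eq0 (u : R * R -> R) x : gradient_sqr u x = 0 -> forall i, partial i u x = 0.
Proof.
move/eqP; rewrite paddr_eq0 ?sqr_ge0 // !sqrf_eq0 => /andP[/eqP u0 /eqP u1] i.
by case: (ord2P i) => ->.
Qed.

End ConstantGradient.

Section ConstantConformalClass.
Variable R : realType.
Variables (s t W : R * R -> R) (A B C : R).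
Hypotheses (Ss : smooth s) (St : smooth t) (SW : smooth W).
Hypothesis W_gt0 : forall x, 0 < W x.
Hypotheses (A_gt0 : 0 < A) (det1 : A * C - B ^+ 2 = 1).
Hypothesis g00 : forall x, pair00 s t x = W x * A.
Hypothesis g01 : forall x, pair01 s t x = W x * B.
Hypothesis g11 : forall x, pair11 s t x = W x * C.
Hypothesis stat_s : forall x, ell (pair00 s t) (pair01 s t) (pair11 s t) s x = 0.
Hypothesis stat_t : forall x, ell (pair00 s t) (pair01 s t) (pair11 s t) t x = 0.

Local Notation L := (ell (fun=> A) (fun=> B) (fun=> C)).

Lemma conformal_ell u x : ell (pair00 s t) (pair01 s t) (pair11 s t) u x = 0 -> L u x = 0.
Proof.
rewrite /ell g00 g01 g11.
move: (partial 0 (partial 0 u) x) (partial 0 (partial 1 u) x) (partial 1 (partial 1 u) x).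
move=> p q r H; apply: (mulfI (lt0r_neq0 (W_gt0 x))); rewrite mulr0 -[RHS]H; ring.
Qed.

(* phi_re u + i phi_im u is the complex derivative of u for the complex structure of
   the constant conformal class; for u = s and u = t their product is the constant
   hopf_re + i hopf_im. *)
Definition phi_re (u : R * R -> R) x : R := A * partial 1 u x - B * partial 0 u x.
Definition phi_im (u : R * R -> R) x : R := partial 0 u x.

Lemma smooth_phi_re u : smooth u -> smooth (phi_re u).
Proof. by move=> Su; rewrite /phi_re; smo. Qed.

Lemma smooth_phi_im u : smooth u -> smooth (phi_im u).
Proof. by move=> Su; rewrite /phi_im; smo. Qed.

Definition hopf_re : R := 1 - A ^+ 2 - B ^+ 2.
Definition hopf_im : R := 2 * B.
Local Notation d1 := hopf_re.
Local Notation d2 := hopf_im.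

Lemma pair_products x :
  [/\ partial 0 s x * partial 0 t x = W x * A - 1,
      partial 0 s x * partial 1 t x + partial 1 s x * partial 0 t x = 2 * (W x * B)
    & partial 1 s x * partial 1 t x = W x * C - 1].
Proof.
have := g00 x; have := g01 x; have := g11 x; rewrite /pair00 /pair01 /pair11.
by move: (partial 0 s x) (partial 1 s x) (partial 0 t x) (partial 1 t x) => *; split; lra.
Qed.

(** The products of first derivatives of [s] and [t] are known from the metric, and in phi_s phi_t
    the terms containing [W] cancel because the conformal matrix has determinant 1. This expresses
    the conformality of the isothermal parametrization of the graph. *)
Lemma hopf_product x :
  phi_re s x * phi_re t x - phi_im s x * phi_im t x = d1 /\
  phi_re s x * phi_im t x + phi_im s x * phi_re t x = d2.
Proof.
have [] := pair_products x; rewrite /phi_re /phi_im /hopf_re /hopf_im.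
move: (partial 0 s x) (partial 1 s x) (partial 0 t x) (partial 1 t x) => p q P Q E0 E1 E2.
split.
  transitivity (A ^+ 2 * (q * Q) - A * B * (p * Q + q * P) + (B ^+ 2 - 1) * (p * P)); first by ring.
  rewrite E0 E1 E2.
  transitivity (W x * A * (A * C - B ^+ 2) - W x * A - A ^+ 2 - B ^+ 2 + 1); first by ring.
  by rewrite det1; ring.
transitivity (A * (p * Q + q * P) - 2 * B * (p * P)); first by ring.
by rewrite E0 E1; ring.
Qed.

(** The real part of phi_s times the conjugate of phi_t; in contrast to [hopf_product] the area
    density does not cancel but appears linearly. *)
Lemma area_phase x : 2 * A * W x = 1 + A ^+ 2 + B ^+ 2
  + (phi_re s x * phi_re t x + phi_im s x * phi_im t x).
Proof.
have [] := pair_products x; rewrite /phi_re /phi_im.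
move: (partial 0 s x) (partial 1 s x) (partial 0 t x) (partial 1 t x) => p q P Q E0 E1 E2.
transitivity (1 + A ^+ 2 + B ^+ 2 +
  (A ^+ 2 * (q * Q) - A * B * (p * Q + q * P) + (B ^+ 2 + 1) * (p * P))); last by ring.
rewrite E0 E1 E2.
transitivity (W x * A * (A * C - B ^+ 2) + W x * A); first by rewrite det1; ring.
by ring.
Qed.

Lemma phi_norms x : (phi_re s x ^+ 2 + phi_im s x ^+ 2) * (phi_re t x ^+ 2 + phi_im t x ^+ 2)
  = d1 ^+ 2 + d2 ^+ 2.
Proof. by have [<- <-] := hopf_product x; ring. Qed.

Lemma phi_CR u x : smooth u -> L u x = 0 ->
  partial 0 (phi_re u) x = A * partial 1 (phi_im u) x - B * partial 0 (phi_im u) x /\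
  partial 1 (phi_re u) x = B * partial 1 (phi_im u) x - C * partial 0 (phi_im u) x.
Proof.
move=> Su; have E i : partial i (phi_re u) = fun x =>
    A * partial i (partial 1 u) x - B * partial i (partial 0 u) x.
  by apply: partial_eq => y; rewrite /phi_re; der; ring.
have -> : phi_im u = partial 0 u by [].
rewrite !E (partialC 1 0 Su) /ell.
move: (partial 0 (partial 0 u) x) (partial 0 (partial 1 u) x) (partial 1 (partial 1 u) x).
by move=> p q r H; split=> //; lra.
Qed.

Lemma constant_phi u : (forall i x, partial i (phi_re u) x = 0 /\ partial i (phi_im u) x = 0) ->
  smooth u -> exists p q, forall x, u x = x.1 * p + x.2 * q + u (0, 0).
Proof.
move=> H Su.
have cst (v : R * R -> R) : smooth v -> (forall i x, partial i v x = 0) ->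
    forall x, v x = v (0, 0).
  move=> Sv v0 x; have := @constant_partials _ v 0 0 Sv (v0 0) (v0 1) x.
  by rewrite !mulr0 !add0r.
have im := cst _ (smooth_phi_im Su) (fun i x => proj2 (H i x)).
have re := cst _ (smooth_phi_re Su) (fun i x => proj1 (H i x)).
exists (phi_im u (0, 0)), ((phi_re u (0, 0) + B * phi_im u (0, 0)) / A).
apply: constant_partials => // x.
rewrite -(re x) -(im x) /phi_re /phi_im subrK mulrC mulKf // gt_eqF //.
Qed.

End ConstantConformalClass.

(** * Rigidity when the Hopf constant does not vanish *)

Section PhaseRigidity.
Variable R : realType.
Variables A B C : R.
Hypotheses (A_gt0 : 0 < A) (det1 : A * C - B ^+ 2 = 1).
Variables a b : R * R -> R.
Hypotheses (Sa : smooth a) (Sb : smooth b).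
Hypothesis CR0 : forall x, partial 0 a x = A * partial 1 b x - B * partial 0 b x.
Hypothesis CR1 : forall x, partial 1 a x = B * partial 1 b x - C * partial 0 b x.
Hypothesis nz : forall x, a x ^+ 2 + b x ^+ 2 != 0.
Variables d1 d2 C0 : R.
Local Notation D2 := (d1 ^+ 2 + d2 ^+ 2).
Local Notation k1 := (phase_cos a b d1 d2).
Local Notation k2 := (phase_sin a b d1 d2).
Local Notation L := (ell (fun=> A) (fun=> B) (fun=> C)).
Local Notation "<< u , v >>" := (grad_prod (fun=> A) (fun=> B) (fun=> C) u v).
Hypotheses (C0_gt0 : 0 < C0) (D2_gt0 : 0 < D2).
Variable W : R * R -> R.
Hypothesis W_gt0 : forall x, 0 < W x.
Hypothesis WE : forall x, 2 * A * W x = C0 + k1 x.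

(** As tau is harmonic, the operator acts on [W] only through second derivatives in tau. The
    numerator comes from [k1 (C0 + k1) + k2 ^ 2 = C0 k1 + D2]. *)
Lemma phase_log_laplacian (tau : R * R -> R) x : smooth tau ->
  (forall i x, partial i tau x = phase_form a b i x) -> (forall x, L tau x = 0) ->
  - 2^-1 * (L W x / W x - << W, W >> x / W x ^+ 2) =
  2 * << tau, tau >> x * (C0 * k1 x + D2) / (C0 + k1 x) ^+ 2.
Proof.
move=> St dt Lt.
have Sk1 := smooth_phase_cos Sa Sb nz d1 d2; have Sk2 := smooth_phase_sin Sa Sb nz d1 d2.
have A0 : A != 0 by rewrite gt_eqF.
have W1 i : partial i W = fun y => partial i tau y * k2 y / A.
  have -> : W = fun y => (C0 + k1 y) / (2 * A).
    apply/funext => y; rewrite -WE mulrC mulKf //.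
    by rewrite mulf_neq0 // pnatr_eq0.
  apply: partial_eq => y; der.
  rewrite (partial_phase_cos Sa Sb nz) dt.
  by move: (phase_form _ _ _ _) (k2 y) => *; field.
have W2 i j : partial i (partial j W) = fun y =>
    (partial i (partial j tau) y * k2 y - 2 * partial j tau y * partial i tau y * k1 y) / A.
  rewrite W1; apply: partial_eq => y; der.
  rewrite (partial_phase_sin Sa Sb nz) -dt.
  move: (partial i (partial j tau) y) (partial i tau y) (partial j tau y).
  by move: (k1 y) (k2 y) => *; ring.
have := Lt x; have := W_gt0 x; have := WE x; have := phase_cos2_sin2 nz d1 d2 x.
rewrite /ell /grad_prod !W2 !W1.
move: (partial 0 (partial 0 tau) x) (partial 0 (partial 1 tau) x) (partial 1 (partial 1 tau) x).
move: (partial 0 tau x) (partial 1 tau x) (W x) (k1 x) (k2 x).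
move=> p q w c s t00 t01 t11 cs wE w0 H.
have -> : D2 = c ^+ 2 + s ^+ 2 by rewrite cs.
have -> : C0 = 2 * A * w - c by rewrite wE addrK.
have wn : w != 0 by rewrite gt_eqF.
transitivity (- 2^-1 * ((s * (C * t00 - 2 * B * t01 + A * t11) / A
   - 2 * c * (C * (p * p) - B * (p * q + q * p) + A * (q * q)) / A) / w
   - s ^+ 2 * (C * (p * p) - B * (p * q + q * p) + A * (q * q)) / A ^+ 2 / w ^+ 2)).
  by field; rewrite A0 wn.
by rewrite H subrK; field; rewrite A0 wn.
Qed.

(** Uniform ellipticity: a positive matrix of determinant 1 and trace [A + C] has both eigenvalues
    at least [1 / (A + C)]. *)
Lemma gradient_le_grad_prod (u : R * R -> R) i x :
  partial i u x ^+ 2 <= (A + C) * << u, u >> x.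
Proof.
have i01 : partial i u x = if i == 0 then partial 0 u x else partial 1 u x.
  by case: (ord2P i) => ->.
rewrite i01 /grad_prod; move: (partial 0 u x) (partial 1 u x) => p q.
have -> : (A + C) * (C * (p * p) - B * (p * q + q * p) + A * (q * q)) =
  (A * C - B ^+ 2) * (p ^+ 2 + q ^+ 2) + ((C * p - B * q) ^+ 2 + (A * q - B * p) ^+ 2) by ring.
rewrite det1 mul1r; have h := addr_ge0 (sqr_ge0 (C * p - B * q)) (sqr_ge0 (A * q - B * p)).
have p2 := sqr_ge0 p; have q2 := sqr_ge0 q.
by case: (i == 0); move: h p2 q2; move: (_ + _) (p ^+ 2) (q ^+ 2) => *; lra.
Qed.

Let mu := @lebesgue_measure R.

(** The Dirichlet integral of [w] is finite because its density is at most [c1] times the curvature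
    density. So tau is constant, which makes [a + i b] constant and the curvature, proportional to
    [<< tau, tau >>], zero. *)
Lemma phase_rigidity (K : R * R -> R) :
  (forall x, K x * W x = - 2^-1 * (L W x / W x - << W, W >> x / W x ^+ 2)) ->
  (\int[mu \x mu]_x (`|K x| * W x)%:E < +oo)%E ->
  (forall i x, partial i a x = 0 /\ partial i b x = 0) /\ forall x, K x = 0.
Proof.
move=> KE Kfin.
have Sk1 := smooth_phase_cos Sa Sb nz d1 d2.
have [tau [St dt Lt]] := phase_exists A_gt0 det1 Sa Sb CR0 CR1 nz.
have {}KE x : K x * W x = 2 * << tau, tau >> x * (C0 * k1 x + D2) / (C0 + k1 x) ^+ 2.
  by rewrite KE; exact: phase_log_laplacian.
have [w [kappa [c0 [Sw kappa0 wtau dw]]]] :=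
  phase_weight Sa Sb nz C0_gt0 D2_gt0 St dt.
have AC0 : 0 < A + C by rewrite addr_gt0 // (C_gt0 A_gt0 det1).
have Ck x : 0 < C0 + k1 x by rewrite -WE mulr_gt0 // mulr_gt0.
have Q0 x : 0 <= << tau, tau >> x.
  rewrite -(pmulr_rge0 _ AC0); apply: le_trans (gradient_le_grad_prod tau 0 x).
  exact: sqr_ge0.
pose m := C0 * (1 + D2) + D2.
pose n := C0 + (1 + D2).
have m_ge0 : 0 <= m by rewrite addr_ge0 ?mulr_ge0 ?addr_ge0 ?sqr_ge0 // ltW.
(* [m] bounds [|C0 k1 + D2|] and [n] bounds [C0 + k1]. In [c1], the cube trades three of the four
   powers of [|C0 k1 + D2|] in the density of [w], [A + C] comes from ellipticity, and [n ^ 2 / 2]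
   undoes the factor [2 / (C0 + k1) ^ 2] of the curvature. *)
pose c1 := m ^+ 3 * (A + C) * n ^+ 2 / 2.
have c1_ge0 : 0 <= c1.
  by apply: divr_ge0 => //; apply: mulr_ge0 (sqr_ge0 n); apply: mulr_ge0 (ltW AC0); exact: exprn_ge0.
have bound i x : partial i w x ^+ 2 <= c1 * (`|K x| * W x).
  have -> : `|K x| * W x = `|K x * W x| by rewrite normrM (gtr0_norm (W_gt0 x)).
  rewrite KE dw.
  have [kb _] := phase_bounds nz d1 d2 x.
  have := gradient_le_grad_prod tau i x; have := Q0 x; have := Ck x; have := kb.
  move: (<< tau, tau >> x) (partial i tau x) (k1 x) => Q p k kb' Ck' Q0' pQ.
  have em : `|C0 * k + D2| <= m.
    apply: le_trans (ler_normD _ _) _; rewrite (gtr0_norm D2_gt0) lerD2r.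
    by rewrite normrM (gtr0_norm C0_gt0) ler_wpM2l // ltW.
  have kn : C0 + k <= n by rewrite lerD2l (le_trans (ler_norm _) kb').
  rewrite !normrM normfV (ger0_norm (exprn_ge0 _ (ltW Ck'))) (ger0_norm Q0') ger0_norm //.
  have -> : ((C0 * k + D2) ^+ 2 * p) ^+ 2 = `|C0 * k + D2| ^+ 4 * p ^+ 2.
    rewrite exprMn -exprM; congr (_ * _).
    by rewrite (_ : 4 = 2 * 2)%N // !exprM real_normK ?num_real.
  move: em; move: `|_| (normr_ge0 (C0 * k + D2)) => e e0 em.
  have h1 : e ^+ 4 * p ^+ 2 <= (m ^+ 3 * e) * ((A + C) * Q).
    apply: ler_pM pQ; [exact: exprn_ge0|exact: sqr_ge0|].
    have -> : e ^+ 4 = e ^+ 3 * e by ring.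
    by rewrite ler_wpM2r // lerXn2r // nnegrE.
  apply: le_trans h1 _.
  rewrite /c1 (_ : _ * (2 * Q * e / _) = m ^+ 3 * e * ((A + C) * Q) * (n ^+ 2 / (C0 + k) ^+ 2)).
    rewrite ler_peMr ?mulr_ge0 ?exprn_ge0 // ?(ltW AC0) //.
    by rewrite ler_pdivlMr ?exprn_gt0 // mul1r lerXn2r ?nnegrE ?(ltW Ck') // (le_trans (ltW Ck')).
  by field; rewrite gt_eqF.
have cK : continuous (fun x => `|K x| * W x).
  have -> : (fun x => `|K x| * W x) = fun x => `|2 * << tau, tau >> x * (C0 * k1 x + D2) / (C0 + k1 x) ^+ 2|.
    by apply/funext => x; rewrite -KE normrM (gtr0_norm (W_gt0 x)).
  have S : smooth (fun x => 2 * << tau, tau >> x * (C0 * k1 x + D2) / (C0 + k1 x) ^+ 2).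
    rewrite /grad_prod; smo => x; by rewrite expf_neq0 // gt_eqF.
  move=> x; exact: (continuous_comp (smooth_cont S (x := x)) (@norm_continuous _ _ _)).
have mK : measurable_fun setT (fun x => (`|K x| * W x)%:E).
  by apply/measurable_EFinP; exact: continuous_plane_measurable.
have K0 x : (0 <= (`|K x| * W x)%:E)%E by rewrite lee_fin mulr_ge0 // ltW.
pose T := (\int[mu \x mu]_x (`|K x| * W x)%:E)%E.
have T0 : (0 <= T)%E by apply: integral_ge0 => x _; exact: K0.
have Tfin : T \is a fin_num by rewrite ge0_fin_numE.
have wE i : (\int[mu \x mu]_x (partial i w x ^+ 2)%:E <= (c1 * fine T)%:E)%E.
  rewrite EFinM fineK // /T.
  have <- := ge0_integralZl_EFin (mu \x mu)%E measurableT (fun x _ => K0 x) mK c1_ge0.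
  have cw2 : continuous (fun x => partial i w x ^+ 2).
    have c := smooth_cont (smooth_partial i Sw).
    by move=> x; exact: (continuousM (c x) (c x)).
  have cK1 : continuous (fun x => c1 * (`|K x| * W x)).
    move=> x; have cc : {for x, continuous (fun _ : R * R => c1)} by exact: cst_continuous.
    exact: (continuousM cc (cK x)).
  have mw : measurable_fun setT (fun x => (partial i w x ^+ 2)%:E).
    by apply/measurable_EFinP; exact: continuous_plane_measurable.
  have mc : measurable_fun setT (fun x => (c1 * (`|K x| * W x))%:E).
    by apply/measurable_EFinP; exact: continuous_plane_measurable.
  have w0 x : (0 <= (partial i w x ^+ 2)%:E)%E by rewrite lee_fin sqr_ge0.
  have wK x : ((partial i w x ^+ 2)%:E <= (c1 * (`|K x| * W x))%:E)%E by rewrite lee_fin.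
  exact: (ge0_le_integral (mu \x mu)%E measurableT (fun x _ => w0 x) mw mc (fun x _ => wK x)).
have tau_cst := liouville_dirichlet A_gt0 det1 St Lt Sw kappa0 wtau wE.
have dt0 i x : partial i tau x = 0.
  have -> // : partial i tau = fun=> 0.
  apply: partial_eq => y; rewrite (_ : tau = fun=> tau y); first exact: sderC.
  by apply/funext => z; exact: tau_cst.
split; first by apply: (phase_cst det1 CR0 CR1 nz) => i x; rewrite -dt.
move=> x; apply: (mulIf (lt0r_neq0 (W_gt0 x))).
by rewrite KE /grad_prod !dt0; rewrite !(mulr0, mul0r, addr0, subr0).
Qed.

End PhaseRigidity.

(** * Null vectors and the case of a vanishing Hopf constant *)

Section NullVectors.
Variable R : realType.

(* The vector with null coordinates f_0 - f_1 = a and f_0 + f_1 = b. *)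
Definition null_vector (a b : R) : 'rV[R]_2 :=
  \row_i (if i == 0 then (a + b) / 2 else (b - a) / 2).

Lemma null_vectorE (v : 'rV[R]_2) : v = null_vector (v 0 0 - v 0 1) (v 0 0 + v 0 1).
Proof.
apply/rowP => i; rewrite mxE; case: (ord2P i) => -> /=; by field.
Qed.

Lemma null_vectorD a b a' b' :
  null_vector (a + a') (b + b') = null_vector a b + null_vector a' b'.
Proof.
by apply/rowP => i; rewrite !mxE; case: (ord2P i) => -> /=; field.
Qed.

Lemma null_vectorZ k a b : null_vector (k * a) (k * b) = k *: null_vector a b.
Proof.
by apply/rowP => i; rewrite !mxE; case: (ord2P i) => -> /=; field.
Qed.

Lemma null_vector_eq0 a b : null_vector a b = 0 -> a = 0 /\ b = 0.
Proof.
move=> /rowP H; have := H 0; have := H 1; rewrite !mxE /= => H1 H0.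
by split; lra.
Qed.

Lemma null_vector_lightlike a b : a * b = 0 -> lightlike (null_vector a b).
Proof.
move=> ab; rewrite /lightlike /mink !big_ord_recl big_ord0 addr0 !mxE /=.
by transitivity (a * b) => //; field.
Qed.

Lemma sum_ord2 (F : 'I_2 -> R) : \sum_(i < 2) F i = F 0 + F 1.
Proof.
by rewrite !big_ord_recl big_ord0 addr0; congr (_ + F _); apply: val_inj.
Qed.

(** The two alternatives are separated by whether [h] is affine: if it is, so is [f]. *)
Lemma affine_or_harmonic (f : R * R -> 'rV[R]_2) (h : R * R -> R) (y0 y1 : 'rV[R]_2) :
  smooth h -> (forall x, ell (fun=> 1) (fun=> 0) (fun=> 1) h x = 0) ->
  y0 != 0 -> lightlike y0 -> (forall x, f x = h x *: y0 + y1) ->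
  affine_linear f \/
  exists (h : R * R -> R) (y0 y1 : 'rV[R]_2),
     [/\ harmonic_function h, ~ @affine_linear R R^o h, y0 != 0, lightlike y0
       & forall x, f x = h x *: y0 + y1].
Proof.
move=> Sh Lh y00 y0l fE.
have [ha|ha] := pselect (@affine_linear R R^o h).
  left; have [u [v [c hE]]] := affine_linearE ha.
  apply: (@affine_linearI _ _ f ((u : R) *: y0) ((v : R) *: y0) ((c : R) *: y0 + y1)) => x.
  rewrite fE hE !scalerDl addrA; congr (_ + _ + _ + _); by rewrite -scalerA.
right; exists h, y0, y1.
suff hh : harmonic_function h by split; [exact hh|exact ha|exact y00|exact y0l|exact fE].
split; first exact (Sh 2%N).
move=> x; apply: etrans (sum_ord2 _) _; rewrite -partialE.
have := Lh x; rewrite /ell.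
move: (partial 0 (partial 0 h) x) (partial 0 (partial 1 h) x) (partial 1 (partial 1 h) x).
by move=> p q r H; rewrite -[RHS]H; ring.
Qed.

(* If the Hopf differential phi_s phi_t vanishes, one of the factors vanishes on an
   open set, hence everywhere. *)
Lemma harmonic_gradient_product (s t : R * R -> R) : smooth s -> smooth t ->
  (forall x, ell (fun=> 1) (fun=> 0) (fun=> 1) t x = 0) ->
  (forall x, gradient_sqr s x * gradient_sqr t x = 0) ->
  (forall x, gradient_sqr s x = 0) \/ (forall x, gradient_sqr t x = 0).
Proof.
move=> Ss St Lt st.
have [|/existsNP[x0 sx0]] := pselect (forall x, gradient_sqr s x = 0); first by left.
right; apply: (@harmonic_gradient_continuation R t x0) => //.
have cs : continuous (gradient_sqr s) by apply: smooth_cont; exact: smooth_gradient_sqr.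
have c0 : continuous (fun _ : R * R => 0 : R) by move=> ?; exact: cst_continuous.
have s0 : 0 < gradient_sqr s x0 by rewrite lt_neqAle gradient_sqr_ge0 andbT eq_sym; apply/eqP.
apply: filterS (nbhs_continuous_lt c0 cs s0) => x sx.
by apply: (mulfI (lt0r_neq0 sx)); rewrite mulr0.
Qed.

End NullVectors.

Unset Implicit Arguments.

Theorem theorem6p1 (R : realType) (f : R * R -> 'rV[R]_2)
    (f_smooth : smooth f)
    (M_spacelike : spacelike f)
    (M_stationary : stationary f)
    (M_curv : (total_abs_curvature (graph_metric f) < +oo)%E) :
  (affine_linear f \/
   exists (h : R * R -> R) (y0 y1 : 'rV[R]_2),
     [/\ harmonic_function h, ~ @affine_linear R R^o h, y0 != 0, lightlike y0
       & forall x, f x = h x *: y0 + y1])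
  /\ (forall x, gauss_curvature (graph_metric f) x = 0).
Proof.
pose s := null_minus f; pose t := null_plus f.
have Ss : smooth s by exact: smooth_null_minus.
have St : smooth t by exact: smooth_null_plus.
have fE x : f x = null_vector (s x) (t x) by exact: null_vectorE.
have G00 x : graph_metric f x 0 0 = pair00 s t x.
  rewrite graph_metric_null // /pair00 -/s -/t /=.
  by move: (partial 0 s x) (partial 0 t x) => p q; field.
have G01 x : graph_metric f x 0 1 = pair01 s t x.
  rewrite graph_metric_null // /pair01 -/s -/t /=.
  by move: (partial 0 s x) (partial 0 t x) (partial 1 s x) (partial 1 t x) => p q p' q'; field.
have G11 x : graph_metric f x 1 1 = pair11 s t x.
  rewrite graph_metric_null // /pair11 -/s -/t /=.
  by move: (partial 1 s x) (partial 1 t x) => p q; field.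
have G10 x : graph_metric f x 1 0 = pair01 s t x by rewrite graph_metric_sym.
have p00 x : 0 < pair00 s t x by rewrite -G00; exact: spacelike00.
have pdet x : 0 < pair_det s t x.
  have := spacelike_det f_smooth M_spacelike x.
  by rewrite det2 G00 G01 G10 G11 /pair_det expr2.
have stat (u : R * R -> R) : u = s \/ u = t -> forall x, ell (pair00 s t) (pair01 s t) (pair11 s t) u x = 0.
  move=> ust x; have := stationary_null f_smooth M_spacelike M_stationary ust x.
  by rewrite G00 G01 G11.
have stat_s := stat s (or_introl erefl); have stat_t := stat t (or_intror erefl).
have [A [B [C [A0 det1 gE]]]] := pair_conformal_cst Ss St p00 pdet stat_s stat_t.
pose W := pair_area s t.
have SW : smooth W by exact: smooth_pair_area.
have W0 x : 0 < W x by exact: pair_area_gt0.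
have g00 x : pair00 s t x = W x * A by have [] := gE x.
have g01 x : pair01 s t x = W x * B by have [] := gE x.
have g11 x : pair11 s t x = W x * C by have [] := gE x.
pose M : 'M[R]_2 := \matrix_(i, j) (if i == j then (if i == 0 then A else C) else B).
have M00 : M 0 0 = A by rewrite mxE.
have M01 : M 0 1 = B by rewrite mxE.
have M10 : M 1 0 = M 0 1 by rewrite !mxE.
have M11 : M 1 1 = C by rewrite mxE.
have GE x i j : graph_metric f x i j = W x * M i j.
  by case: (ord2P i) => ->; case: (ord2P j) => ->;
    rewrite ?M10 ?M00 ?M01 ?M11 ?G10 ?G00 ?G01 ?G11 ?g00 ?g01 ?g11.
have Mdet : M 0 0 * M 1 1 - M 0 1 ^+ 2 = 1 by rewrite M00 M01 M11.
have M0 : 0 < M 0 0 by rewrite M00.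
have areaE x : area_density (graph_metric f) x = W x by exact: (conformal_area W0 M10 Mdet GE x).
have KE x := conformal_gauss SW W0 M10 Mdet M0 GE x.
have {}KE x : gauss_curvature (graph_metric f) x * W x = - 2^-1 *
    (ell (fun=> A) (fun=> B) (fun=> C) W x / W x
     - grad_prod (fun=> A) (fun=> B) (fun=> C) W W x / W x ^+ 2).
  by have := KE x; rewrite areaE M00 M01 M11.
have Ls x := conformal_ell W0 g00 g01 g11 (stat_s x).
have Lt x := conformal_ell W0 g00 g01 g11 (stat_t x).
pose d1 := hopf_re A B; pose d2 := hopf_im B.
have phiN x := phi_norms det1 g00 g01 g11 x.
have [d0|d_neq0] := eqVneq (d1 ^+ 2 + d2 ^+ 2) 0.
  have phi0 x : (phi_re A B s x ^+ 2 + phi_im s x ^+ 2) * (phi_re A B t x ^+ 2 + phi_im t x ^+ 2) = 0.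
    by rewrite phiN -d0.
  (* [hopf_im = 0] gives [B = 0], then [hopf_re = 0] gives [A ^ 2 = 1], and positivity and
     determinant 1 leave only the identity matrix: the operator is the flat Laplacian. *)
  move/eqP: d0; rewrite paddr_eq0 ?sqr_ge0 // !sqrf_eq0 => /andP[/eqP e1 /eqP e2].
  have B0 : B = 0 by move: e2; rewrite /d2 /hopf_im; lra.
  have A1 : A = 1 by move: e1; rewrite /d1 /hopf_re B0 => ?; nra.
  have C1 : C = 1 by move: det1; rewrite A1 B0; lra.
  move: Ls Lt phi0; rewrite A1 B0 C1 => {}Ls {}Lt phi0.
  have gst x : gradient_sqr s x * gradient_sqr t x = 0.
    have := phi0 x; rewrite /phi_re /phi_im /gradient_sqr.
    by move: (partial 0 s x) (partial 0 t x) (partial 1 s x) (partial 1 t x) => p q p' q' <-; ring.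
  (* Here [g_11 = W]; if [s] or [t] is constant, [W] is identically 1 and the curvature formula
     gives 0. *)
  have W1 x : partial 0 s x * partial 0 t x = 0 -> W x = 1.
    move=> st0; have := g00 x; rewrite /pair00 st0 addr0 A1 mulr1.
    by move/esym.
  have K0 : (forall x, partial 0 s x * partial 0 t x = 0) ->
      forall x, gauss_curvature (graph_metric f) x = 0.
    move=> st0 x; have := KE x.
    have -> : W = fun=> 1 by apply/funext => y; exact: W1.
    have pc i (c : R) : partial i (fun=> c) = fun=> 0.
      by apply: partial_eq => y; exact: sderC.
    by rewrite /ell /grad_prod !pc !(mulr0, mul0r, addr0, subr0) mulr1.
  have cst (u : R * R -> R) : smooth u -> (forall x, gradient_sqr u x = 0) -> forall x, u x = u (0, 0).
    move=> Su u0 x; have ui i y : partial i u y = 0 by exact: gradient_sqr_eq0.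
    have := constant_partials Su (ui 0) (ui 1) x.
    by rewrite !mulr0 !add0r.
  have nz (a b : R) : a != 0 \/ b != 0 -> null_vector a b != 0.
    by move=> ab; apply/eqP => /null_vector_eq0 [a0 b0]; rewrite a0 b0 eqxx in ab; case: ab.
  have [s0|t0] := harmonic_gradient_product Ss St Lt gst; split.
  - apply: (affine_or_harmonic (y0 := null_vector 0 1) (y1 := null_vector (s (0, 0)) 0) St Lt).
    + by apply: nz; right.
    + by apply: null_vector_lightlike; rewrite mul0r.
    + move=> x; rewrite fE -null_vectorZ -null_vectorD (cst s Ss s0 x).
      by rewrite mulr0 mulr1 add0r addr0.
  - by apply: K0 => x; rewrite (gradient_sqr_eq0 (s0 x)) mul0r.
  - apply: (affine_or_harmonic (y0 := null_vector 1 0) (y1 := null_vector 0 (t (0, 0))) Ss Ls).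
    + by apply: nz; left.
    + by apply: null_vector_lightlike; rewrite mulr0.
    + move=> x; rewrite fE -null_vectorZ -null_vectorD (cst t St t0 x).
      by rewrite mulr0 mulr1 add0r addr0.
  - by apply: K0 => x; rewrite (gradient_sqr_eq0 (t0 x)) mulr0.
have D2 : 0 < d1 ^+ 2 + d2 ^+ 2 by rewrite lt_neqAle eq_sym d_neq0 addr_ge0 // sqr_ge0.
have C0 : 0 < 1 + A ^+ 2 + B ^+ 2 by rewrite -addrA ltr_pwDl // addr_ge0 // sqr_ge0.
(* Stated for an ordered pair because the hypotheses are symmetric: it yields the constancy of phi_s
   from [(s, t)] and that of phi_t from [(t, s)]. *)
have rigid (u v : R * R -> R) : smooth u -> (forall x, ell (fun=> A) (fun=> B) (fun=> C) u x = 0) ->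
    (forall x, phi_re A B u x * phi_re A B v x - phi_im u x * phi_im v x = d1 /\
       phi_re A B u x * phi_im v x + phi_im u x * phi_re A B v x = d2) ->
    (forall x, 2 * A * W x = 1 + A ^+ 2 + B ^+ 2 +
      (phi_re A B u x * phi_re A B v x + phi_im u x * phi_im v x)) ->
    (forall i x, partial i (phi_re A B u) x = 0 /\ partial i (phi_im u) x = 0) /\
    forall x, gauss_curvature (graph_metric f) x = 0.
  move=> Su Lu uv WE.
  have nz x : phi_re A B u x ^+ 2 + phi_im u x ^+ 2 != 0.
    apply/eqP => u0; move/eqP: d_neq0; apply.
    have [<- <-] := uv x; transitivity ((phi_re A B u x ^+ 2 + phi_im u x ^+ 2) *
      (phi_re A B v x ^+ 2 + phi_im v x ^+ 2)); first by ring.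
    by rewrite u0 mul0r.
  have CR x := phi_CR Su (Lu x).
  apply: (@phase_rigidity R A B C A0 det1 (phi_re A B u) (phi_im u) _ _ _ _ nz d1 d2
    (1 + A ^+ 2 + B ^+ 2) C0 D2 W W0 _ _ KE).
  - exact: smooth_phi_re.
  - exact: smooth_phi_im.
  - by move=> x; have [] := CR x.
  - by move=> x; have [] := CR x.
  (* With phi_u phi_v = d, phi_u times the conjugate of phi_v is the conjugate of d times phi_u^2 /
     |phi_u|^2, whose real part is [phase_cos]. *)
  - move=> x; rewrite WE; congr (_ + _).
    rewrite /phase_cos; have := nz x; have [<- <-] := uv x.
    by move: (phi_re _ _ _ _) (phi_im _ _) (phi_re _ _ _ _) (phi_im _ _) => a b a' b' n0; field.
  - move: M_curv; rewrite /total_abs_curvature.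
    by under eq_integral => x _ do rewrite areaE.
have [s_phi K0] : (forall i x, partial i (phi_re A B s) x = 0 /\ partial i (phi_im s) x = 0) /\
    forall x, gauss_curvature (graph_metric f) x = 0.
  apply: (rigid s t) => // x; first exact: (hopf_product det1 g00 g01 g11 x).
  exact: (area_phase det1 g00 g01 g11 x).
have [t_phi _] : (forall i x, partial i (phi_re A B t) x = 0 /\ partial i (phi_im t) x = 0) /\
    forall x, gauss_curvature (graph_metric f) x = 0.
  apply: (rigid t s) => // x.
    by rewrite /d1 /d2; have [<- <-] := hopf_product det1 g00 g01 g11 x; split; ring.
  by rewrite (area_phase det1 g00 g01 g11 x); ring.
split=> //; left.
have [p [q sE]] := constant_phi A0 s_phi Ss; have [p' [q' tE]] := constant_phi A0 t_phi St.
apply: (@affine_linearI _ _ f (null_vector p p') (null_vector q q')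
  (null_vector (s (0, 0)) (t (0, 0)))) => x.
by rewrite fE sE tE !null_vectorD !null_vectorZ.
Qed.
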